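(* Let $0<\tau<1$ and let $S$ be the fundamental solution of the (classical Zener, or SLS) wave equation $$\frac{\partial^2}{\partial t^2} u(x,t) = \mathcal{L}^{-1}_{s\to t} \Bigl(\frac{1+s}{1+\tau s}\Bigr) \ast_{t} \frac{\partial^2}{\partial x^2} u(x,t),\qquad x\in \mathbb{R},\ t>0.$$ Then $S$ is discontinuous at the boundary of the forward light cone $\{(x,t):|x|\le t/\sqrt\tau\}$. More precisely, it has the form $$S(x,t)= \frac{\sqrt{\tau}}{2}\exp\Bigl(-\frac{\sqrt{\tau}}{2}\Bigl(\frac{1}{\tau}-1\Bigr)|x|\Bigr)H(t-\sqrt{\tau}|x|) + E(x,t),$$ where $E$ is a continuous function supported in the forward cone $\{(x,t): |x| \le t/\sqrt{\tau}\}$.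
   Context: $\mathcal{L}^{-1}$ is the inverse Laplace transform, $\ast_t$ is convolution in $t$, and $H$ is the Heaviside function. $\mathcal{S}'(\mathbb{R}\times\mathbb{R}_+)$ denotes the space of tempered distributions on $\mathbb{R}^2$ (variables $(x,t)$) vanishing on $\mathbb{R}\times(-\infty,0)$. The fundamental solution $S\in \mathcal{S}'(\mathbb{R}\times\mathbb{R}_+)$ satisfies $\partial_t^2S-\mathcal{L}^{-1}\bigl(\frac{1+s}{1+\tau s}\bigr)\ast_t\partial_x^2S=\delta(x)\delta(t)$; its Laplace transform with respect to $t$ is $$\tilde S(x,s)=\frac{1}{2s}\sqrt{\frac{1+\tau s}{1+s}}\exp\Bigl(-|x|\,s\sqrt{\frac{1+\tau s}{1+s}}\Bigr),\quad x\in\mathbb{R},\ \operatorname{Re}s>0,$$ with the principal branch of the square root. *)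

(* Defs.v *)
From HB Require Import structures.
From mathcomp Require Import all_boot all_order all_algebra.
From mathcomp Require Import complex.
From mathcomp Require Import all_classical all_reals all_analysis.

Set Implicit Arguments.
Unset Strict Implicit.
Unset Printing Implicit Defensive.

Import Order.TTheory GRing.Theory Num.Theory.
Import numFieldNormedType.Exports.

Local Open Scope classical_set_scope.
Local Open Scope ring_scope.
Local Open Scope complex_scope.

Definition iter_derive (R : realType) (V : normedModType R) (vs : seq V)
    (f : V -> R) : V -> R :=
  foldr (fun v g => fun x => 'D_v g x) f vs.

(* Every iterated directional derivative exists and is differentiable, hence
   continuous, everywhere: for finite-dimensional V this is C^oo. *)
Definition smooth (R : realType) (V : normedModType R) (f : V -> R) : Prop :=
  forall (vs : seq V) (x : V), differentiable (iter_derive vs f) x.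

Definition schwartz_real (R : realType) (V : normedModType R) (f : V -> R)
    : Prop :=
  smooth f /\
  forall (k : nat) (vs : seq V), exists M : R,
    forall x : V, `|x| ^+ k * `|iter_derive vs f x| <= M.

(* The Schwartz seminorms of order at most N of f are bounded by M. *)
Definition schwartz_bound (R : realType) (V : normedModType R) (N : nat)
    (M : R) (f : V -> R) : Prop :=
  forall (k : nat) (vs : seq V), (k <= N)%N -> (size vs <= N)%N ->
    (forall v, v \in vs -> `|v| <= 1) ->
    forall x : V, `|x| ^+ k * `|iter_derive vs f x| <= M.

Definition Ref (R : realType) (V : Type) (f : V -> R[i]) : V -> R :=
  fun x => complex.Re (f x).
Definition Imf (R : realType) (V : Type) (f : V -> R[i]) : V -> R :=
  fun x => complex.Im (f x).

Definition schwartz (R : realType) (V : normedModType R) (f : V -> R[i])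
    : Prop :=
  schwartz_real (Ref f) /\ schwartz_real (Imf f).

Definition test_function (R : realType) (V : normedModType R) (U : set V)
    (f : V -> R[i]) : Prop :=
  [/\ smooth (Ref f), smooth (Imf f),
      compact (closure [set x | f x != 0]) &
      closure [set x | f x != 0] `<=` U].

Definition deriveC (R : realType) (V : normedModType R) (v : V)
    (f : V -> R[i]) : V -> R[i] :=
  fun x => 'D_v (Ref f) x +i* 'D_v (Imf f) x.

(* Functionals are total on V -> R[i]; only their values on Schwartz functions
   are meaningful. *)
Record tempered_distribution (R : realType) (V : normedModType R) := Tempered {
  td_fun :> (V -> R[i]) -> R[i];
  td_linear : forall (a : R[i]) (f g : V -> R[i]),
    schwartz f -> schwartz g ->
    td_fun (fun x => a * f x + g x) = a * td_fun f + td_fun g;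
  td_continuous : exists (C : R) (N : nat),
    forall (f : V -> R[i]) (M : R), schwartz f ->
      schwartz_bound N M (Ref f) -> schwartz_bound N M (Imf f) ->
      `|td_fun f| <= (C * M)%:C }.

Definition vanishes_on (R : realType) (V : normedModType R)
    (T : (V -> R[i]) -> R[i]) (U : set V) : Prop :=
  forall f : V -> R[i], test_function U f -> T f = 0.

Definition dist_derive (R : realType) (V : normedModType R) (v : V)
    (T : (V -> R[i]) -> R[i]) : (V -> R[i]) -> R[i] :=
  fun f => - T (deriveC v f).

Definition dirac_delta (R : realType) (V : normedModType R) (f : V -> R[i])
    : R[i] := f 0.

(* A distribution vanishing for t < 0 may be paired with smooth functions that
   decay only as t -> +oo, after multiplication by a function chi of this kind;
   the value does not depend on chi. *)
Definition cutoff (R : realType) (chi : R -> R) : Prop :=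
  [/\ smooth chi,
      exists2 a : R, 0 < a & forall t, - a < t -> chi t = 1 &
      exists b : R, forall t, t < b -> chi t = 0].

Definition expC (R : realType) (z : R[i]) : R[i] :=
  (expR (complex.Re z) * cos (complex.Im z)) +i* (expR (complex.Re z) * sin (complex.Im z)).

(* <T, exp(- s t)>, for T vanishing for t < 0 *)
Definition laplace (R : realType) (chi : R -> R)
    (T : (R -> R[i]) -> R[i]) (s : R[i]) : R[i] :=
  T (fun t => (chi t)%:C * expC (- (s * t%:C))).

Definition is_inverse_laplace (R : realType) (chi : R -> R)
    (K : tempered_distribution R) (F : R[i] -> R[i]) : Prop :=
  vanishes_on K [set t : R | t < 0] /\
  forall s : R[i], 0 < complex.Re s -> laplace chi K s = F s.

(* Convolution in t of distributions vanishing for t < 0: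
   <K *_t T, f> = <T_(x,t), <K_u, f(x, t + u)>>. *)
Definition convolution_t (R : realType) (chi : R -> R)
    (K : (R -> R[i]) -> R[i]) (T : (R * R -> R[i]) -> R[i])
    : (R * R -> R[i]) -> R[i] :=
  fun f => T (fun p => (chi p.2)%:C *
                       K (fun u => (chi u)%:C * f (p.1, p.2 + u))).

Definition dir_x (R : realType) : (R * R)%type := (1, 0).
Definition dir_t (R : realType) : (R * R)%type := (0, 1).

(* S_tt - K *_t S_xx = delta(x) delta(t), with S = 0 for t < 0.  The Zener
   equation is the case K = L^-1((1 + s) / (1 + tau s)). *)
Definition wave_fundamental_solution (R : realType) (chi : R -> R)
    (K : tempered_distribution R)
    (S : tempered_distribution (R * R)%type) : Prop :=
  vanishes_on S [set p | p.2 < 0] /\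
  forall f : R * R -> R[i], schwartz f ->
    dist_derive (dir_t R) (dist_derive (dir_t R) S) f
    - convolution_t chi K (dist_derive (dir_x R) (dist_derive (dir_x R) S)) f
    = dirac_delta f.

Notation lebesgue2 R :=
  (product_measure1 (@lebesgue_measure R) (@lebesgue_measure R)).

Definition pairing (R : realType) (g f : R * R -> R[i]) : R[i] :=
  (\int[lebesgue2 R]_p complex.Re (g p * f p)) +i*
  (\int[lebesgue2 R]_p complex.Im (g p * f p)).

Definition locally_integrable2 (R : realType) (U : set (R * R))
    (g : R * R -> R[i]) : Prop :=
  forall A : set (R * R), compact A -> A `<=` U ->
    (lebesgue2 R).-integrable A (EFin \o Ref g) /\
    (lebesgue2 R).-integrable A (EFin \o Imf g).

Definition represented_by (R : realType) (T : (R * R -> R[i]) -> R[i])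
    (U : set (R * R)) (g : R * R -> R[i]) : Prop :=
  locally_integrable2 U g /\
  forall f : R * R -> R[i], test_function U f -> T f = pairing g f.

(* No locally integrable representative of T near p is continuous at p. *)
Definition discontinuous_at (R : realType) (T : (R * R -> R[i]) -> R[i])
    (p : (R * R)%type) : Prop :=
  forall (U : set (R * R)) (g : R * R -> R[i]),
    open U -> U p -> represented_by T U g ->
    ~ ({for p, continuous (Ref g)} /\ {for p, continuous (Imf g)}).

Definition forward_cone (R : realType) (tau : R) : set (R * R) :=
  [set p | `|p.1| <= p.2 / Num.sqrt tau].

Definition heaviside (R : realType) (z : R) : R := if 0 <= z then 1 else 0.

Definition zener_leading_term (R : realType) (tau : R) (p : R * R) : R :=
  Num.sqrt tau / 2
  * expR (- (Num.sqrt tau / 2 * (tau^-1 - 1) * `|p.1|))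
  * heaviside (p.2 - Num.sqrt tau * `|p.1|).

(* Main.v *)
(* With 1 / s replaced by integration in time, the Laplace transform
     1/(2s) sqrt((1 + tau s)/(1 + s)) exp(- |x| s sqrt((1 + tau s)/(1 + s)))
   becomes a power series in the time t - sqrt tau |x| elapsed since the arrival
   of the front, whose coefficients depend on |x|: the first term is the leading
   term of the theorem, and the others add up to a continuous function E.
   To see that this kernel S0 is S, put s = - d/dt and let
   Q = s^2 (1 + tau s) - (1 + s) (d/dx)^2 be the adjoint operator, cleared of its
   denominator.  Integrating the terms of S0 against Q h along the two
   characteristics t = sqrt tau |x|, where all integrals in time have been thrown
   on h, the sum telescopes and gives <S0, Q h> = h(0) - tau h_t(0).
   Conversely, for a test function phi, solve h - tau h_t = phi backwards in time
   and put g(p) = <S0, h(p + .)>, so that Q g = phi.  The equation of S, tested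
   with g - tau g_t cut off in the past, is <S, phi> = g(0) - tau g_t(0), which is
   <S0, h - tau h_t> = <S0, phi>.  Here K acts on g - tau g' as g(0) - g'(0): this
   is the hypothesis on the Laplace transform when g is a polynomial in exp(- t)
   without constant term, and such polynomials are dense enough. *)

(* Put z = 1/s. The series m with sqrt((1 + tau s)/(1 + s)) = sqrt tau (1 + z m(z)) splits the
   exponent into - sqrt tau |x| s, a pure delay, and - sqrt tau |x| m(z), whose constant coefficient
   (1/tau - 1)/2 is the damping of the leading term. Coefficients in z grow at most geometrically,
   locally uniformly in x, while a power z^n costs a factor t^n/n!; so the identities are proved for
   finite truncations with errors C/2^N, and no infinite series is differentiated. [K] is known only
   through its Laplace transform, which is used at s = 1, 2, ...: in the variable y = exp(- t) a
   function vanishing for large t becomes smooth on all of R, and there Weierstrass approximation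
   with finitely many derivatives meets the finite order of [K]. The bumps that compare
   representatives have one source, the given cutoff [chi]. *)
Require Import Defs.
From HB Require Import structures.
From mathcomp Require Import all_boot all_order all_algebra.
From mathcomp Require Import complex.
From mathcomp Require Import all_classical all_reals all_analysis.
From mathcomp Require Import measurable_realfun ring lra.

Set Implicit Arguments.
Unset Strict Implicit.
Unset Printing Implicit Defensive.

Import Order.TTheory GRing.Theory Num.Theory.
Import numFieldNormedType.Exports.

Local Open Scope classical_set_scope.
Local Open Scope ring_scope.
Local Open Scope complex_scope.

(** * Smooth functions *)

Section smooth_functions.
Context {R : realType} {V : normedModType R}.
Implicit Types (f g : V -> R) (v x : V) (vs : seq V) (P : (V -> R) -> Prop).

Lemma iter_derive_rcons vs v f :
  iter_derive (rcons vs v) f = iter_derive vs (fun x => 'D_v f x).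
Proof. by rewrite /iter_derive foldr_rcons. Qed.

(** The list of directions is consumed from its end, the innermost derivative, so [P] passes from
    [f] to ['D_v f] along the induction. Smoothness then only asks for a class of functions stable
    under derivation, not for a formula of iterated derivatives. *)
Lemma smooth_coind P :
  (forall f, P f -> (forall x, differentiable f x) /\
                    forall v, P (fun x => 'D_v f x)) ->
  forall f, P f -> smooth f.
Proof.
move=> Pind f Pf vs; elim/last_ind: vs f Pf => [|vs v IH] f Pf x.
  by have [+ _] := Pind _ Pf; exact.
by rewrite iter_derive_rcons; apply: IH; have [_] := Pind _ Pf; exact.
Qed.

Lemma smooth_differentiable f : smooth f -> forall x, differentiable f x.
Proof. by move=> sf x; have := sf [::] x. Qed.

Lemma smooth_derivable f x v : smooth f -> derivable f x v.
Proof. by move=> /smooth_differentiable sf; exact: diff_derivable. Qed.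

Lemma smooth_is_derive f x v : smooth f -> is_derive x v f ('D_v f x).
Proof. by move=> sf; apply: derivableP; exact: smooth_derivable. Qed.

Lemma smooth_continuous f : smooth f -> continuous f.
Proof.
by move=> /smooth_differentiable sf x; exact: differentiable_continuous.
Qed.

Lemma smooth_derive f v : smooth f -> smooth (fun x => 'D_v f x).
Proof. by move=> sf vs x; have := sf (rcons vs v) x; rewrite iter_derive_rcons. Qed.

Lemma smooth_iter_derive f vs : smooth f -> smooth (iter_derive vs f).
Proof. by elim: vs => //= v vs IH sf; apply: smooth_derive; exact: IH. Qed.

Lemma smooth_cst (c : R) : smooth (cst c : V -> R).
Proof.
apply: (@smooth_coind (fun f => exists c : R, f = cst c)); last by exists c.
move=> _ [d ->]; split=> [x|v]; first exact: differentiable_cst.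
by exists 0; apply/funext => x; rewrite derive_cst.
Qed.

Lemma smoothD f g : smooth f -> smooth g -> smooth (fun x => f x + g x).
Proof.
move=> sf sg; apply: (@smooth_coind (fun h => exists f g,
  [/\ smooth f, smooth g & h = fun x => f x + g x])); last by exists f, g.
move=> _ [{}f [{}g [{}sf {}sg ->]]]; split=> [x|v].
  by apply: (@differentiableD _ _ _ f g); exact: smooth_differentiable.
exists (fun x => 'D_v f x), (fun x => 'D_v g x).
split; [exact: smooth_derive|exact: smooth_derive|].
by apply/funext => x; rewrite -deriveD//; exact: smooth_derivable.
Qed.

(** Products alone are not stable under derivation; their finite sums are, by the Leibniz rule. This
    is the invariant behind [smoothM]. *)
Inductive product_sum : (V -> R) -> Prop :=
| ProductSumM f g : smooth f -> smooth g -> product_sum (fun x => f x * g x)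
| ProductSumD f g : product_sum f -> product_sum g ->
    product_sum (fun x => f x + g x).

Lemma smoothM f g : smooth f -> smooth g -> smooth (fun x => f x * g x).
Proof.
move=> sf sg; apply: (smooth_coind (P := product_sum)); last exact: ProductSumM.
move=> h {f g sf sg}; elim=> {h} [f g sf sg|f g _ [df Pf] _ [dg Pg]].
  split=> [x|v].
    by apply: (@differentiableM _ _ f g); exact: smooth_differentiable.
  rewrite (_ : (fun x => _) = fun x => f x * 'D_v g x + g x * 'D_v f x).
    by apply: ProductSumD; apply: ProductSumM => //; exact: smooth_derive.
  by apply/funext => x; rewrite -deriveM//; exact: smooth_derivable.
split=> [x|v]; first exact: (@differentiableD _ _ _ f g).
rewrite (_ : (fun x => _) = fun x => 'D_v f x + 'D_v g x).
  exact: ProductSumD.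
by apply/funext => x; rewrite -deriveD//; exact: diff_derivable.
Qed.

Lemma smoothZ (c : R) f : smooth f -> smooth (fun x => c * f x).
Proof. by move=> sf; apply: smoothM => //; exact: smooth_cst. Qed.

Lemma smoothN f : smooth f -> smooth (fun x => - f x).
Proof.
move=> sf; rewrite (_ : (fun x => _) = fun x => (-1) * f x).
  exact: smoothZ.
by apply/funext => x; rewrite mulN1r.
Qed.

Lemma smoothB f g : smooth f -> smooth g -> smooth (fun x => f x - g x).
Proof. by move=> sf sg; apply: smoothD => //; exact: smoothN. Qed.

Lemma derive_addf f g v : smooth f -> smooth g ->
  (fun x => 'D_v (fun y => f y + g y) x) = fun x => 'D_v f x + 'D_v g x.
Proof.
by move=> sf sg; apply/funext => x; apply: deriveD; exact: smooth_derivable.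
Qed.

Lemma derive_mulf f g v : smooth f -> smooth g ->
  (fun x => 'D_v (fun y => f y * g y) x) =
  fun x => 'D_v f x * g x + f x * 'D_v g x.
Proof.
move=> sf sg; apply/funext => x; rewrite (@deriveM _ _ f g); last 2 first.
  exact: smooth_derivable.
  exact: smooth_derivable.
by rewrite addrC /GRing.scale/= (mulrC (g x)).
Qed.

Lemma derive_scalef (c : R) f v : smooth f ->
  (fun x => 'D_v (fun y => c * f y) x) = fun x => c * 'D_v f x.
Proof.
move=> sf; apply: (etrans (derive_mulf v (smooth_cst c) sf)).
by apply/funext => x; rewrite derive_cst mul0r add0r.
Qed.

Lemma derive_oppf f v : smooth f ->
  (fun x => 'D_v (fun y => - f y) x) = fun x => - 'D_v f x.
Proof.
by move=> sf; apply/funext => x; apply: deriveN; exact: smooth_derivable.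
Qed.

Lemma derive_loceq f g v x : (\near x, f x = g x) -> 'D_v f x = 'D_v g x.
Proof.
move=> fg; have [->|v0] := eqVneq v 0; first by rewrite !derive0.
exact: near_eq_derive.
Qed.

Lemma derive_open_eq f g v (U : set V) : open U -> {in U, f =1 g} ->
  {in U, (fun x => 'D_v f x) =1 (fun x => 'D_v g x)}.
Proof.
move=> oU fg x; rewrite inE => Ux; apply: derive_loceq.
by apply: filterS (open_nbhs_nbhs (conj oU Ux)) => y Uy; apply: fg; rewrite inE.
Qed.

Lemma iter_derive_open_eq0 f vs (U : set V) : open U -> (forall x, U x -> f x = 0) ->
  forall x, U x -> iter_derive vs f x = 0.
Proof.
move=> oU f0; elim: vs => //= v vs IH x Ux.
have e : {in U, iter_derive vs f =1 cst 0} by move=> y; rewrite inE => /IH.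
by have := derive_open_eq v oU e; move=> ->; rewrite ?inE// derive_cst.
Qed.

End smooth_functions.

(** * Composition with affine maps *)

Section affine_change_of_variables.
Context {R : realType} {U V : normedModType R}.
Variables (A : U -> V) (L : U -> V).
Hypothesis dA : forall x, is_diff x A L.

Lemma derive_affine (f : V -> R) v x : differentiable f (A x) ->
  'D_v (f \o A) x = 'D_(L v) f (A x).
Proof.
move=> df; rewrite !deriveE//; last exact: differentiable_comp.
by rewrite diff_comp//= diff_val.
Qed.

(** Having the same differential [L] at all points makes [A] affine, so a derivative of [f \o A] is
    again a derivative of [f] composed with [A]. *)
Lemma smooth_affine (f : V -> R) : smooth f -> smooth (f \o A).
Proof.
move=> sf; apply: (@smooth_coind _ _ (fun h => exists2 f : V -> R, smooth f &
  h = f \o A)); last by exists f.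
move=> _ {f sf} [f sf ->]; split=> [x|v].
  by apply: differentiable_comp => //; exact: smooth_differentiable.
exists (fun x => 'D_(L v) f x); first exact: smooth_derive.
by apply/funext => x; rewrite derive_affine//; exact: smooth_differentiable.
Qed.

Lemma derive_affinef (f : V -> R) v : smooth f ->
  (fun x => 'D_v (f \o A) x) = (fun x => 'D_(L v) f x) \o A.
Proof.
by move=> sf; apply/funext => x; rewrite derive_affine//; exact: smooth_differentiable.
Qed.

End affine_change_of_variables.

Section affine_maps.
Context {R : realType}.

Lemma is_diff_shift (V : normedModType R) (c x : V) : is_diff x (fun y => c + y) id.
Proof.
by have := is_diffD (is_diff_cst c x) (is_diff_id x); rewrite add0r.
Qed.

Lemma is_diff_fst (p : R * R) : is_diff p fst fst.
Proof.
apply: DiffDef.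
  by apply: (@linear_differentiable _ _ _ (fst : {linear _ -> _})) => q; exact: cvg_fst.
by rewrite (@diff_lin _ _ _ (fst : {linear _ -> _})) // => q; exact: cvg_fst.
Qed.

Lemma is_diff_snd (p : R * R) : is_diff p snd snd.
Proof.
apply: DiffDef.
  by apply: (@linear_differentiable _ _ _ (snd : {linear _ -> _})) => q; exact: cvg_snd.
by rewrite (@diff_lin _ _ _ (snd : {linear _ -> _})) // => q; exact: cvg_snd.
Qed.

Lemma is_diff_affine1 (a b x : R) : is_diff x (fun y => a + b * y) (fun y => b * y).
Proof.
have := is_diffD (is_diff_cst a x) (is_diffZ b (is_diff_id x)).
by rewrite add0r.
Qed.

Lemma is_diff_affine_line (a b c d x : R) :
  is_diff x (fun y => (a + b * y, c + d * y)) (fun y => (b * y, d * y)).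
Proof. by apply: is_diff_pair; exact: is_diff_affine1. Qed.

Lemma is_diff_affine_fst (a b : R) (p : R * R) :
  is_diff p (fun q => a + b * q.1) (fun q => b * q.1).
Proof.
have := is_diffD (is_diff_cst a p) (is_diffZ b (is_diff_fst p)).
by rewrite add0r.
Qed.

Lemma is_diff_affine_snd (a b : R) (p : R * R) :
  is_diff p (fun q => a + b * q.2) (fun q => b * q.2).
Proof.
have := is_diffD (is_diff_cst a p) (is_diffZ b (is_diff_snd p)).
by rewrite add0r.
Qed.

Lemma is_derive_expRN (c t : R) :
  is_derive t (1 : R) (fun t : R => expR (- (c * t))) (- c * expR (- (c * t))).
Proof.
have dl : is_derive t (1 : R) (fun t : R => - (c * t)) (- c).
  have -> : (fun t : R => - (c * t)) = - (c *: id) by [].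
  by apply: is_derive_eq; rewrite [c *: _]mulr1.
have := @is_derive1_comp _ (@expR R) (fun t => - (c * t)) _ _ _ (is_derive_expR _) dl.
by rewrite mulrC.
Qed.

End affine_maps.

Section plane.
Context {R : realType}.
Local Notation plane := (R * R)%type.
Implicit Types (f : plane -> R) (u : R -> R) (p q : plane).

Lemma smooth_shift (V : normedModType R) (f : V -> R) (c : V) :
  smooth f -> smooth (fun x => f (c + x)).
Proof. exact: smooth_affine (is_diff_shift c) _. Qed.

Lemma derive_shiftf (V : normedModType R) (f : V -> R) (c : V) v :
  smooth f -> (fun x => 'D_v (fun y => f (c + y)) x) = fun x => 'D_v f (c + x).
Proof. exact: derive_affinef (is_diff_shift c) _ v. Qed.

Lemma derive_line (u : R -> R) v x : smooth u -> 'D_v u x = v * 'D_1 u x.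
Proof.
move=> su; rewrite !deriveE; [|exact: smooth_differentiable..].
by rewrite -[v in LHS]mulr1 linearZ.
Qed.

Lemma derive_plane f (v x : plane) : differentiable f x ->
  'D_v f x = v.1 * 'D_(dir_x R) f x + v.2 * 'D_(dir_t R) f x.
Proof.
move=> df; rewrite !deriveE//.
rewrite (_ : v = v.1 *: dir_x R + v.2 *: dir_t R); last first.
  by case: v => a b; congr pair => /=; rewrite /GRing.scale/= !(mulr0,mulr1,addr0,add0r).
rewrite linearD !linearZ /=; congr (_ + _).
  by rewrite /GRing.scale/= !(mulr0,mulr1,addr0).
by rewrite /GRing.scale/= !(mulr0,mulr1,add0r).
Qed.

End plane.

(** * Polynomial approximation of smooth functions with their derivatives *)

Ltac nonneg := repeat first [done | exact: ltW | exact: sqr_ge0 | apply: divr_ge0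
  | apply: mulr_ge0 | apply: exprn_ge0 | apply: addr_ge0 | exact: expR_ge0].

Section bernstein.
Context {R : realType}.
Implicit Types (phi psi : nat -> R) (x : R).

(* [bernstein n phi] evaluated at x is the expectation of [phi] under the
   binomial law with parameters n and x, by conditioning on the first trial. *)
Fixpoint bernstein (n : nat) phi : {poly R} :=
  if n is m.+1 then 'X * bernstein m (phi \o succn) + (1 - 'X) * bernstein m phi
  else (phi 0%N)%:P.

Lemma bernsteinS n phi x : (bernstein n.+1 phi).[x] =
  x * (bernstein n (phi \o succn)).[x] + (1 - x) * (bernstein n phi).[x].
Proof. by rewrite /= !hornerE. Qed.

Lemma le_bernstein n phi psi x : 0 <= x <= 1 ->
  (forall k, (k <= n)%N -> phi k <= psi k) ->
  (bernstein n phi).[x] <= (bernstein n psi).[x].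
Proof.
move=> /andP[x0 x1]; elim: n phi psi => [|n IH] phi psi le_phi.
  by rewrite /= !hornerE; exact: le_phi.
rewrite !bernsteinS; apply: lerD; apply: ler_wpM2l; rewrite ?subr_ge0//.
  by apply: IH => k kn; exact: le_phi.
by apply: IH => k kn; apply: le_phi; exact: leqW.
Qed.

Lemma bernstein_lin n phi psi (c : R) x :
  (bernstein n (fun k => phi k + c * psi k)).[x] =
  (bernstein n phi).[x] + c * (bernstein n psi).[x].
Proof.
elim: n phi psi => [|n IH] phi psi; first by rewrite /= !hornerE.
rewrite !bernsteinS /comp (IH (phi \o succn) (psi \o succn)) IH /comp.
by ring.
Qed.

Lemma bernstein_cst n (c x : R) : (bernstein n (fun=> c)).[x] = c.
Proof.
elim: n => [|n IH]; first by rewrite /= hornerE.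
by rewrite bernsteinS /comp IH; ring.
Qed.

(** Mean and variance of the binomial law in one formula; the free centre [a] lets the induction
    replace it by [a - 1] after a success. *)
Lemma bernstein_sqr n (a x : R) :
  (bernstein n (fun k => (k%:R - a) ^+ 2)).[x] =
  n%:R * x * (1 - x) + (n%:R * x - a) ^+ 2.
Proof.
elim: n a => [|n IH] a; first by rewrite /= hornerE; ring.
rewrite bernsteinS IH.
have -> : (fun k : nat => (k%:R - a) ^+ 2) \o succn =
          (fun k => (k%:R - (a - 1)) ^+ 2).
  by apply/funext => k /=; rewrite -natr1; ring.
by rewrite IH -natr1; ring.
Qed.

(** Bernstein's argument without separating near and far nodes: an error L |u| is at most the
    quadratic L (eta/2 + u^2/(2 eta)), whose expectation is known from the variance. *)
Lemma weierstrass_lipschitz (f : R -> R) (B L e : R) : 0 < B -> 0 < L -> 0 < e ->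
  (forall x y, 0 <= x <= B -> 0 <= y <= B -> `|f x - f y| <= L * `|x - y|) ->
  exists p : {poly R}, forall x, 0 <= x <= B -> `|f x - p.[x]| <= e.
Proof.
move=> B0 L0 e0 fL.
pose eta := e / L; have eta0 : 0 < eta by exact: divr_gt0.
have [n] : exists n : nat, B ^+ 2 / eta ^+ 2 < n%:R.
  exists (Num.bound (B ^+ 2 / eta ^+ 2)).
  by apply: archi_boundP; nonneg.
move=> nbig.
have n0 : 0 < n%:R :> R by apply: lt_trans nbig; rewrite divr_gt0// exprn_gt0.
pose phi k := f (B * k%:R / n%:R).
exists (bernstein n phi \Po (B^-1 *: 'X)) => x /andP[x0 xB].
rewrite horner_comp !hornerE; set y := B^-1 * x.
have y01 : 0 <= y <= 1.
  apply/andP; split; first by rewrite mulr_ge0// invr_ge0 ltW.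
  by rewrite /y mulrC ler_pdivrMr ?mul1r.
have xE : x = B * y by rewrite /y mulrA divff ?mul1r// gt_eqF.
(* The quadratic majorant in terms of the node index: eta = e / L makes its constant part e/2, and n
   > B^2/eta^2 makes the variance part at most e/2. *)
pose c := L / (2 * eta) * (B ^+ 2 / n%:R ^+ 2).
pose w (k : nat) := L * eta / 2 + c * (k%:R - n%:R * y) ^+ 2.
have wE : (bernstein n w).[y] <= e.
  rewrite (bernstein_lin n (fun=> _) (fun k => (k%:R - n%:R * y) ^+ 2)).
  rewrite bernstein_cst bernstein_sqr subrr expr0n addr0/=.
  have y4 : y * (1 - y) <= 1 by case/andP: y01 => *; nra.
  have -> : L * eta / 2 = e / 2 by rewrite /eta; field; rewrite gt_eqF.
  rewrite [leRHS]splitr lerD2l.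
  have -> : c * (n%:R * y * (1 - y)) = (y * (1 - y)) * (L / (2 * eta) * (B ^+ 2 / n%:R)).
    by rewrite /c; field; rewrite !gt_eqF.
  apply: le_trans (_ : L / (2 * eta) * (B ^+ 2 / n%:R) <= _).
    apply: ler_piMl => //.
    by nonneg.
  have : B ^+ 2 / n%:R <= eta ^+ 2.
    by rewrite ler_pdivrMr// mulrC -ler_pdivrMr ?exprn_gt0// ltW.
  move=> /(ler_wpM2l (x := L / (2 * eta))) -/(_ _)/le_trans; apply.
    by nonneg.
  by rewrite /eta le_eqVlt; apply/orP; left; apply/eqP; field; rewrite !gt_eqF.
have dist k : (k <= n)%N -> `|f x - phi k| <= w k.
  move=> kn; apply: le_trans (fL _ _ _ _) _.
  - by rewrite x0.
  - apply/andP; split; first by nonneg.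
    by rewrite ler_pdivrMr// ler_pM2l// ler_nat.
  set u := x - _.
  have -> : w k = L * (eta / 2 + u ^+ 2 / (2 * eta)).
    by rewrite /w /c /u xE; field; rewrite !gt_eqF.
  apply: ler_wpM2l; first exact: ltW.
  rewrite -(real_normK (num_real u)); set v := `|u|.
  have -> : eta / 2 + v ^+ 2 / (2 * eta) = v + (v - eta) ^+ 2 / (2 * eta).
    by field; rewrite gt_eqF.
  by rewrite lerDl; nonneg.
have up : (bernstein n phi).[y] <= f x + e.
  apply: le_trans (_ : (bernstein n (fun k => f x + 1 * w k)).[y] <= _).
    apply: le_bernstein => // k kn; have := dist k kn.
    by rewrite mul1r => /ler_normlP[]; lra.
  by rewrite (bernstein_lin _ (fun=> _)) bernstein_cst mul1r lerD2l.
have lo : f x - e <= (bernstein n phi).[y].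
  apply: le_trans (_ : (bernstein n (fun k => f x + (-1) * w k)).[y] <= _).
    by rewrite (bernstein_lin _ (fun=> _)) bernstein_cst mulN1r lerD2l lerN2.
  apply: le_bernstein => // k kn; have := dist k kn.
  by rewrite mulN1r => /ler_normlP[]; lra.
by rewrite ler_norml; apply/andP; split; move: up lo; lra.
Qed.

End bernstein.

Section smooth_approximation.
Context {R : realType}.

(** A smooth function of one variable is carried together with named successive derivatives, so that
    explicit formulas can replace iterated ['D_1]. *)
Definition jet (d : nat -> R -> R) := forall j (x : R), is_derive x (1 : R) (d j) (d j.+1 x).

Lemma jet_smooth (f : R -> R) : smooth f -> jet (fun j => iter_derive (nseq j (1 : R)) f).
Proof. by move=> sf j x; exact: smooth_is_derive (smooth_iter_derive _ sf). Qed.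

Lemma jet_continuous d j : jet d -> continuous (d j).
Proof.
by move=> jd x; apply: differentiable_continuous; apply/derivable1_diffP; have [] := jd j x.
Qed.

Lemma smooth_jet d j : jet d -> smooth (d j).
Proof.
move=> jd; apply: (@smooth_coind _ _ (fun h => exists (c : R) j, h = fun x => c * d j x)).
  move=> _ [c [{}j ->]]; split=> [x|v].
    apply: (@differentiableZ _ _ _ (d j)); apply/derivable1_diffP.
    by have [] := jd j x.
  exists (c * v), j.+1; apply/funext => x.
  have dj : differentiable (d j) x by apply/derivable1_diffP; have [] := jd j x.
  have dj1 : differentiable (fun x => c * d j x) x by exact: differentiableZ.
  rewrite deriveE// -[v in LHS]mulr1 linearZ/= -deriveE//.
  rewrite (_ : 'D_(1 : R) _ x = c * d j.+1 x); first by rewrite /GRing.scale/=; ring.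
  rewrite (@deriveZ _ _ _ (d j))//; last exact: diff_derivable.
  by have [_ ->] := jd j x.
by exists 1, j; apply/funext => x; rewrite mul1r.
Qed.

(** On the line every direction is a multiple of 1, and the multiples factor out. *)
Lemma iter_derive_jet d : jet d -> forall (vs : seq R) j x,
  iter_derive vs (d j) x = (\prod_(v <- vs) v) * d (j + size vs)%N x.
Proof.
move=> jd; elim/last_ind=> [|vs v IH] j x.
  by rewrite big_nil mul1r addn0.
rewrite iter_derive_rcons big_rcons size_rcons/=.
rewrite (_ : (fun x => _) = fun x => v * d j.+1 x); last first.
  apply/funext => y; rewrite derive_line; last exact: smooth_jet.
  by have [_ ->] := jd j y.
suff -> : iter_derive vs (fun y => v * d j.+1 y) = fun y => v * iter_derive vs (d j.+1) y.
  by rewrite IH addSnnS; ring.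
elim: {IH} vs => //= w vs ->.
by rewrite derive_scalef//; apply: smooth_iter_derive; exact: smooth_jet.
Qed.

Lemma bounded_segment (f : R -> R) a b : continuous f ->
  exists2 M : R, 0 < M & forall x, a <= x <= b -> `|f x| <= M.
Proof.
move=> cf; have [ab|ba] := leP a b; last first.
  exists 1 => // x /andP[ax xb]; have := le_trans ax xb.
  by rewrite leNgt ba.
have [c _ cmax] : exists2 c, c \in `[a, b] & forall t, t \in `[a, b] -> `|f t| <= `|f c|.
  apply: (@EVT_max R (fun x => `|f x|) a b ab).
  apply: continuous_subspaceT => x; apply: continuous_comp; first exact: cf.
  exact: norm_continuous.
exists (`|f c| + 1); first by rewrite ltr_wpDl.
by move=> x xab; apply: le_trans (cmax x _) _; rewrite ?in_itv// lerDl.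
Qed.

Lemma lipschitz_of_derive (f df : R -> R) a b M :
  (forall x : R, is_derive x (1 : R) f (df x)) ->
  (forall x, a <= x <= b -> `|df x| <= M) ->
  forall x y, a <= x <= b -> a <= y <= b -> `|f x - f y| <= M * `|x - y|.
Proof.
move=> fd dM.
suff lip x y : x <= y -> a <= x <= b -> a <= y <= b -> `|f y - f x| <= M * `|y - x|.
  move=> x y xab yab; have [xy|/ltW yx] := leP x y; last exact: lip.
  by rewrite distrC (distrC x); exact: lip.
move=> xy /andP[ax xb] /andP[ay yb].
have [c|c + ->] := @MVT_segment R f df x y xy (fun x _ => fd x).
  apply: continuous_subspaceT => z; apply: differentiable_continuous.
  by apply/derivable1_diffP; have [] := fd z.
rewrite in_itv/= => /andP[xc cy]; rewrite normrM ler_wpM2r//; apply: dM.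
by rewrite (le_trans ax xc) (le_trans cy yb).
Qed.

Definition poly_primitive (p : {poly R}) (c : R) : {poly R} :=
  \poly_(i < (size p).+1) (if i is k.+1 then p`_k / k.+1%:R else c).

Lemma deriv_primitive p c : (poly_primitive p c)^`() = p.
Proof.
apply/polyP => i; rewrite coef_deriv coef_poly ltnS.
case: ltnP => [ip|pi]; first by rewrite -[_ *+ _]mulr_natr divfK// pnatr_eq0.
by rewrite mul0rn nth_default.
Qed.

Lemma primitive0 p c : (poly_primitive p c).[0] = c.
Proof. by rewrite horner_coef0 coef_poly. Qed.

(** Induction on the number of derivatives: approximate [d j.+1], then take the primitive with the
    exact value at 0. Integration over [0, B] multiplies the error by at most B, whence the
    tolerance e / (1 + B). *)
Lemma weierstrass_jet d (B : R) : jet d -> 0 < B -> forall N j (e : R), 0 < e ->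
  exists p : {poly R}, forall i, (i <= N)%N -> forall x, 0 <= x <= B ->
    `|d (j + i)%N x - (p^`(i)).[x]| <= e.
Proof.
move=> jd B0; elim=> [|N IH] j e e0.
  have [M M0 dM] := @bounded_segment (d j.+1) 0 B (jet_continuous jd).
  have [p pP] := weierstrass_lipschitz B0 M0 e0 (lipschitz_of_derive (jd j) dM).
  by exists p => i; rewrite leqn0 => /eqP -> x; rewrite addn0 derivn0; exact: pP.
have e'0 : 0 < e / (1 + B) by rewrite divr_gt0// addr_gt0.
have [p pP] := IH j.+1 _ e'0.
have e'e : e / (1 + B) <= e.
  rewrite ler_pdivrMr ?addr_gt0//; apply: ler_peMr; first exact: ltW.
  by rewrite lerDl ltW.
exists (poly_primitive p (d j 0)) => -[_|i iN] x xB; last first.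
  rewrite derivSn deriv_primitive addnS -addSn.
  by apply: le_trans (pP i iN x xB) _.
rewrite addn0 derivn0; set q := poly_primitive _ _.
have dq (y : R) : is_derive y (1 : R) (fun y => d j y - q.[y]) (d j.+1 y - p.[y]).
  have := is_deriveB (jd j y) (is_derive_poly q y).
  by rewrite deriv_primitive.
have := @lipschitz_of_derive _ _ 0 B (e / (1 + B)) dq _ x 0 xB.
rewrite lexx ltW//= /q primitive0 !subrr !subr0 => /(_ _ isT) h.
apply: le_trans (h _) _ => [y yB|].
  by have := pP 0%N isT y yB; rewrite addn0 derivn0.
case/andP: xB => x0 xB; rewrite ger0_norm// mulrAC ler_pdivrMr ?addr_gt0//.
by rewrite ler_pM2l// (le_trans xB)// lerDr.
Qed.

End smooth_approximation.

(** * The memory kernel *)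

Section schwartz_functionals.
Context {R : realType} {V : normedModType R}.
Implicit Types (f g : V -> R) (T : tempered_distribution V).

Lemma Ref_real f : Ref (fun x => (f x)%:C) = f. Proof. by []. Qed.

Lemma Imf_real f : Imf (fun x => (f x)%:C) = cst 0. Proof. by []. Qed.

Lemma iter_derive_cst0 (vs : seq V) (x : V) : iter_derive vs (cst (0 : R) : V -> R) x = 0.
Proof. exact: (@iter_derive_open_eq0 _ _ (cst 0) vs setT openT). Qed.

Lemma iter_derive_lin (c : R) f g (vs : seq V) : smooth f -> smooth g ->
  iter_derive vs (fun x => c * f x + g x) =
  fun x => c * iter_derive vs f x + iter_derive vs g x.
Proof.
move=> sf sg; elim: vs => //= v vs ->.
rewrite derive_addf; [|apply: smoothZ|]; [|exact: smooth_iter_derive..].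
apply/funext => x; congr (_ + _).
by have := derive_scalef c v (smooth_iter_derive vs sf) => /(congr1 (@^~ x)).
Qed.

Lemma schwartz_real_lin (c : R) f g : schwartz_real f -> schwartz_real g ->
  schwartz_real (fun x => c * f x + g x).
Proof.
move=> [sf bf] [sg bg]; split=> [|k vs]; first by apply: smoothD => //; exact: smoothZ.
have [M fM] := bf k vs; have [N gN] := bg k vs; exists (`|c| * M + N) => x.
rewrite iter_derive_lin// (le_trans (ler_wpM2l _ (ler_normD _ _)))//; first nonneg.
rewrite mulrDr lerD// normrM mulrCA; exact: ler_wpM2l.
Qed.

Lemma schwartz_real0 : schwartz_real (cst 0 : V -> R).
Proof.
split=> [|k vs]; first exact: smooth_cst.
by exists 0 => x; rewrite iter_derive_cst0 normr0 mulr0.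
Qed.

Lemma schwartz_realC f : schwartz_real f -> schwartz (fun x => (f x)%:C).
Proof.
move=> sf; split; first by rewrite Ref_real.
rewrite Imf_real; split=> [|k vs]; first exact: smooth_cst.
by exists 0 => x; rewrite iter_derive_cst0 normr0 mulr0.
Qed.

Lemma td_real_linear T (c : R) f g : schwartz_real f -> schwartz_real g ->
  T (fun x => (c * f x + g x)%:C) =
  c%:C * T (fun x => (f x)%:C) + T (fun x => (g x)%:C).
Proof.
move=> sf sg; rewrite -td_linear; [|exact: schwartz_realC..].
by congr (T _); apply/funext => x; rewrite rmorphD rmorphM.
Qed.

Lemma td_real0 T : T (fun x => (0 : R)%:C) = 0.
Proof.
have := td_real_linear T (-1) schwartz_real0 schwartz_real0.
rewrite (_ : (fun x => _) = fun x : V => (0 : R)%:C); last first.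
  by apply/funext => x; rewrite /cst mulr0 addr0.
by rewrite rmorphN rmorph1 mulN1r addNr.
Qed.

Lemma td_real_scale T (c : R) f : schwartz_real f ->
  T (fun x => (c * f x)%:C) = c%:C * T (fun x => (f x)%:C).
Proof.
move=> sf; rewrite -[RHS]addr0 -(td_real0 T) -(td_real_linear _ _ sf schwartz_real0).
by congr (T _); apply/funext => x; rewrite addr0.
Qed.

Lemma td_real_bound T : exists (C : R) (N : nat), forall f M,
  schwartz_real f -> schwartz_bound N M f -> 0 <= M ->
  `|T (fun x => (f x)%:C)| <= (C * M)%:C.
Proof.
have [C [N TC]] := td_continuous T; exists C, N => f M sf fM M0.
apply: TC; rewrite ?Ref_real ?Imf_real//; first exact: schwartz_realC.
by move=> k vs _ _ _ x; rewrite iter_derive_cst0 normr0 mulr0.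
Qed.

End schwartz_functionals.

Section exponential_jets.
Context {R : realType}.
Variables (w d : nat -> R -> R).
Hypotheses (jw : jet w) (jd : jet d).

(* The n-th derivative of [w i t * exp (- m t) * d j (exp (- t))]. *)
Fixpoint exp_jet (n i m j : nat) (t : R) : R :=
  if n is n'.+1 then
    exp_jet n' i.+1 m j t - m%:R * exp_jet n' i m j t - exp_jet n' i m.+1 j.+1 t
  else w i t * expR (- (m%:R * t)) * d j (expR (- t)).

Lemma jet_exp_jet i m j : jet (fun n => exp_jet n i m j).
Proof.
move=> n; elim: n i m j => [|n IH] i m j t; last first.
  by apply: is_deriveB; apply: is_deriveB => //; exact: is_deriveZ.
have de1 : is_derive t (1 : R) (fun t : R => expR (- t)) (- expR (- t)).
  have := is_derive_expRN 1 t; rewrite mulN1r mul1r.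
  by rewrite (_ : (fun t : R => expR (- (1 * t))) = fun t => expR (- t))//;
    apply/funext => u; rewrite mul1r.
have dd := @is_derive1_comp _ (d j) (fun t => expR (- t)) _ _ _ (jd j _) de1.
apply: (@is_derive_eq _ _ _ _ _ _ _ _ (is_deriveM (is_deriveM (jw i t) (is_derive_expRN m%:R t)) dd)).
rewrite /= /GRing.scale/= /comp.
rewrite (_ : expR (- (m.+1%:R * t)) = expR (- (m%:R * t)) * expR (- t)).
  by rewrite (_ : (w i * _) t = w i t * expR (- (m%:R * t)))//; ring.
by rewrite -expRD; congr expR; rewrite -natr1; ring.
Qed.

End exponential_jets.

Lemma exp_jetD (R : realType) (w d1 d2 : nat -> R -> R) (c : R) n i m j t :
  exp_jet w (fun k y => c * d1 k y + d2 k y) n i m j t =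
  c * exp_jet w d1 n i m j t + exp_jet w d2 n i m j t.
Proof.
elim: n i m j => [|n IH] i m j /=; first by ring.
by rewrite !IH; ring.
Qed.

(** For t >= 0 the exponential series gives t^k <= k! exp t; on [b, 0] both factors are largest at
    b. *)
Lemma expr_mul_expR_bounded (R : realType) (k m : nat) (b : R) : b <= 0 -> (0 < m)%N ->
  exists2 C : R, 0 <= C & forall t, b <= t -> `|t| ^+ k * expR (- (m%:R * t)) <= C.
Proof.
move=> b0 m0; exists (k`!%:R + `|b| ^+ k * expR (- (m%:R * b))).
  by apply: addr_ge0 => //; nonneg.
move=> t bt; have [t0|/ltW t0] := leP 0 t; last first.
  rewrite -[leLHS]add0r lerD//; apply: ler_pM; nonneg.
    by rewrite lerXn2r ?nnegrE// !ler0_norm// lerN2.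
  by rewrite ler_expR lerN2; apply: ler_wpM2l; [exact: ler0n|].
rewrite -[leLHS]addr0 lerD//.
rewrite ger0_norm//; apply: le_trans (_ : t ^+ k * expR (- t) <= _).
  apply: ler_wpM2l; first exact: exprn_ge0.
  by rewrite ler_expR lerN2 ler_peMl// ler1n.
rewrite expRN ler_pdivrMr ?expR_gt0//.
case: k => [|k]; first by rewrite expr0 fact0 mul1r; have := expR_ge1Dx t; lra.
have := expR_ge1Dxn k t0; rewrite -ler_pdivrMl ?ltr0n ?fact_gt0//.
by rewrite mulrC; lra.
Qed.

Section logarithmic_jet.
Context {R : realType}.
Variable g : nat -> R -> R.
Hypothesis jg : jet g.
Variable T : R.
Hypothesis g0 : forall j t, T <= t -> g j t = 0.

(* The n-th derivative of [y^-m * g j (- ln y)], extended by 0 to y <= 0. *)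
Fixpoint log_jet (n m j : nat) (y : R) : R :=
  if n is n'.+1 then - (m%:R * log_jet n' m.+1 j y) - log_jet n' m.+1 j.+1 y
  else if 0 < y then y^-1 ^+ m * g j (- ln y) else 0.

Lemma log_jet0 n m j y : y <= expR (- T) -> log_jet n m j y = 0.
Proof.
move=> yT; elim: n m j => [|n IH] m j /=; last by rewrite !IH !(mulr0, oppr0, addr0).
case: ifPn => // y0; rewrite g0 ?mulr0// lerNr.
by rewrite -(expRK (- T)) ler_ln// posrE ?expR_gt0.
Qed.

(** Below exp (- T) the function is 0 in a neighbourhood; elsewhere y > 0 and the formula is
    differentiated. The vanishing of [g] for large t is what removes the singularity at y = 0. *)
Lemma jet_log_jet m j : jet (fun n => log_jet n m j).
Proof.
move=> n; elim: n m j => [|n IH] m j y; last first.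
  by apply: is_deriveB; apply: is_deriveN; apply: is_deriveZ.
have [yT|Ty] := ltP y (expR (- T)).
  rewrite log_jet0 ?ltW//.
  apply: (near_eq_is_derive (f := cst 0)) => //.
  by apply: filterS (lt_nbhsl yT) => z /= /ltW zT; rewrite -[RHS]/(log_jet 0 m j z) log_jet0.
have y0 : 0 < y by apply: lt_le_trans Ty; exact: expR_gt0.
pose h (z : R) := z^-1 ^+ m * g j (- ln z).
apply: (near_eq_is_derive (f := h)) => //.
  by apply: filterS (lt_nbhsr y0) => z /= z0; rewrite z0.
have dinv : is_derive y (1 : R) (fun z : R => z^-1) (- y ^- 2).
  have yn0 : y != 0 by rewrite gt_eqF.
  apply: DeriveDef; first exact: (@derivableV _ _ id).
  by rewrite (@deriveV _ _ id)// derive_id [LHS]mulr1.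
have dX := is_deriveX m dinv.
have dN : is_derive y (1 : R) (fun z : R => - ln z) (- y^-1).
  by apply: is_deriveN; exact: is_derive1_ln.
have dg := @is_derive1_comp _ (g j) (fun z => - ln z) _ _ _ (jg j (- ln y)) dN.
have := is_deriveM dX dg; rewrite exprfctE mulrfctE => /is_derive_eq; apply.
rewrite /= y0 /GRing.scale/= -exprVn.
by case: (m) => [|m'] /=; rewrite ?exprS; ring.
Qed.

End logarithmic_jet.

(** * Evaluation of K on g - tau g' *)

Section inverse_laplace_kernel.
Context {R : realType}.
Variables (tau : R) (chi : R -> R) (K : tempered_distribution R).
Hypotheses (tau_gt0 : 0 < tau) (chi_cutoff : cutoff chi).
Hypothesis K_invL : is_inverse_laplace chi K
                (fun s : R[i] => (1 + s) / (1 + tau%:C * s)).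

Let w j : R -> R := iter_derive (nseq j (1 : R)) chi.

Let jw : jet w.
Proof. by apply: jet_smooth; case: chi_cutoff. Qed.

(** Left of b all derivatives of [chi] vanish, right of - a it is the constant 1, and [b, 0] is
    compact. The value [chi] takes at 0 forces b <= 0. *)
Let w_bounded : exists2 b : R, b <= 0 &
  (forall i t, t < b -> w i t = 0) /\
  forall i, exists2 M : R, 0 <= M & forall t, `|w i t| <= M.
Proof.
have [schi [a a0 chi1] [b chi0]] := chi_cutoff.
have w0 i t : t < b -> w i t = 0.
  by apply: (@iter_derive_open_eq0 _ _ _ _ [set t : R | t < b]) => //; exact: open_lt.
have w1 i t : - a < t -> w i.+1 t = 0.
  rewrite /w -addn1 nseqD cats1 iter_derive_rcons.
  apply: (@iter_derive_open_eq0 _ _ _ _ [set t : R | - a < t]) => [|u /= au]; first exact: open_gt.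
  have /derive_loceq -> : \near u, chi u = cst (1 : R) u.
    by apply: filterS (lt_nbhsr au) => z; exact: chi1.
  by rewrite derive_cst.
have b0 : b <= 0.
  rewrite leNgt; apply/negP => b0; have := chi0 0 b0.
  by rewrite chi1 ?oppr_lt0// => /eqP; rewrite oner_eq0.
exists b => //; split=> // i.
have [M M0 wM] := @bounded_segment _ (w i) b 0 (jet_continuous jw).
exists (M + 1); first by apply: addr_ge0 => //; exact: ltW.
move=> t; have [tb|bt] := ltP t b; first by rewrite w0// normr0 addr_ge0// ltW.
have [t0|t0] := leP t 0; first by rewrite (le_trans (wM _ _)) ?bt// lerDl.
have at_ : - a < t by apply: lt_trans t0; rewrite oppr_lt0.
case: i {wM} => [|i]; last by rewrite w1// normr0 addr_ge0// ltW.
by rewrite /w/= chi1// normr1 lerDr ltW.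
Qed.

(* The seminorms of [w i t * exp (- m t) * r (exp (- t))] are controlled by
   those of r on the range of [exp (- t)] on the support of [chi]. *)
Let exp_jet_bound : exists2 B : R, 1 <= B & forall k n i m, (0 < m)%N ->
  exists2 C : R, 0 <= C & forall d, jet d -> forall j (e : R), 0 <= e ->
    (forall (l : nat) (y : R), (l <= n)%N -> 0 <= y <= B -> `|d (j + l)%N y| <= e) ->
    forall t, `|t| ^+ k * `|exp_jet w d n i m j t| <= C * e.
Proof.
have [b b0 [w0 wM]] := w_bounded.
exists (expR (- b)); first by rewrite -expR0 ler_expR oppr_ge0.
move=> k; elim=> [|n IH] i m m0.
  have [M M0 {}wM] := wM i.
  have [C C0 CP] := expr_mul_expR_bounded k b0 m0.
  exists (C * M); first exact: mulr_ge0.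
  move=> d jd j e e0 de t /=.
  have [tb|bt] := ltP t b.
    by rewrite w0// !mul0r normr0 mulr0; nonneg.
  rewrite !normrM (ger0_norm (expR_ge0 _)).
  have -> : `|t| ^+ k * (`|w i t| * expR (- (m%:R * t)) * `|d j (expR (- t))|) =
    `|t| ^+ k * expR (- (m%:R * t)) * `|w i t| * `|d j (expR (- t))| by ring.
  apply: ler_pM; nonneg; first by apply: ler_pM; nonneg; exact: CP.
  have := de 0%N (expR (- t)); rewrite addn0; apply => //.
  by rewrite expR_ge0 ler_expR lerN2.
have [C1 C10 C1P] := IH i.+1 m m0; have [C2 C20 C2P] := IH i m m0.
have [C3 C30 C3P] := IH i m.+1 (ltn0Sn _).
exists (C1 + m%:R * C2 + C3); first by nonneg.
move=> d jd j e e0 de t /=.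
rewrite !mulrDl; apply: le_trans (_ : `|t| ^+ k * (`|exp_jet w d n i.+1 m j t| +
    `|m%:R * exp_jet w d n i m j t| + `|exp_jet w d n i m.+1 j.+1 t|) <= _).
  apply: ler_wpM2l; first by nonneg.
  by apply: le_trans (ler_normB _ _) _; rewrite lerD2r ler_normB.
rewrite !mulrDr; apply: lerD; first apply: lerD.
- by apply: C1P => // l y ln; apply: de; exact: leqW.
- rewrite normrM ger0_norm// mulrCA -mulrA ler_wpM2l//.
  by apply: C2P => // l y ln; apply: de; exact: leqW.
- by apply: C3P => // l y ln yB; rewrite addSnnS; apply: de.
Qed.

Let jet_bounded d j n (B : R) : jet d -> exists2 e : R, 0 <= e &
  forall (l : nat) (y : R), (l <= n)%N -> 0 <= y <= B -> `|d (j + l)%N y| <= e.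
Proof.
move=> jd; elim: n => [|n [e e0 de]].
  have [M M0 dM] := @bounded_segment _ (d j) 0 B (jet_continuous jd).
  exists M => [|l y]; first exact: ltW.
  by rewrite leqn0 => /eqP ->; rewrite addn0; exact: dM.
have [M M0 dM] := @bounded_segment _ (d (j + n.+1)%N) 0 B (jet_continuous jd).
exists (e + M) => [|l y]; first by apply: addr_ge0 => //; exact: ltW.
rewrite leq_eqVlt => /orP[/eqP -> /dM|ln yB].
  by move/le_trans; apply; rewrite lerDr.
by apply: le_trans (de l y ln yB) _; rewrite lerDl ltW.
Qed.

Let schwartz_exp_jet d i m j : jet d -> (0 < m)%N ->
  schwartz_real (exp_jet w d 0 i m j).
Proof.
move=> jd m0; have je := jet_exp_jet jw jd i m j.
split=> [|k vs]; first exact: (smooth_jet 0 je).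
have [B B1 BP] := exp_jet_bound.
have [C C0 CP] := BP k (size vs) i m m0.
have [e e0 de] := @jet_bounded d j (size vs) B jd.
exists (`|\prod_(v <- vs) v| * (C * e)) => t.
rewrite (iter_derive_jet je) normrM mulrCA; apply: ler_wpM2l => //.
exact: CP.
Qed.

(** Adding the constants over all orders up to N gives one that serves every seminorm of
    [schwartz_bound]; directions of norm at most 1 only shrink the product extracted by
    [iter_derive_jet]. *)
Let exp_jet_seminorm : exists2 B : R, 1 <= B & forall N i m, (0 < m)%N ->
  exists2 C : R, 0 <= C & forall d, jet d -> forall j (e : R), 0 <= e ->
    (forall (l : nat) (y : R), (l <= N)%N -> 0 <= y <= B -> `|d (j + l)%N y| <= e) ->
    schwartz_bound N (C * e) (exp_jet w d 0 i m j).
Proof.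
have [B B1 BP] := exp_jet_bound; exists B => // N i m m0.
have /choice[C CP] : forall kn : nat * nat, exists C : R, 0 <= C /\
    forall d, jet d -> forall j (e : R), 0 <= e ->
    (forall (l : nat) (y : R), (l <= kn.2)%N -> 0 <= y <= B -> `|d (j + l)%N y| <= e) ->
    forall t, `|t| ^+ kn.1 * `|exp_jet w d kn.2 i m j t| <= C * e.
  by move=> [k n]; have [C C0 CP] := BP k n i m m0; exists C.
exists (\sum_(k < N.+1) \sum_(n < N.+1) C (val k, val n)).
  by apply: sumr_ge0 => k _; apply: sumr_ge0 => n _; have [] := CP (val k, val n).
move=> d jd j e e0 de k vs kN vsN vs1 t.
have C0 kn : 0 <= C kn by have [] := CP kn.
rewrite (iter_derive_jet (jet_exp_jet jw jd i m j)) normrM mulrCA.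
have p1 : `|\prod_(v <- vs) v| <= 1.
  elim: vs vs1 {vsN} => [|v vs IH] vs1; first by rewrite big_nil normr1.
  rewrite big_cons normrM mulr_ile1//; first by apply: vs1; rewrite mem_head.
  by apply: IH => u uvs; apply: vs1; rewrite inE uvs orbT.
apply: le_trans (ler_piMl _ p1) _; first by nonneg.
have [_ /(_ d jd j e e0) CkP] := CP (k, size vs).
apply: le_trans (CkP _ t) _ => [l y /= ln|]; first exact/de/(leq_trans ln).
apply: ler_wpM2r => //.
rewrite (bigD1 (Ordinal (kN : (k < N.+1)%N)))//= (bigD1 (Ordinal (vsN : (size vs < N.+1)%N)))//=.
rewrite -addrA lerDl addr_ge0//; first exact: sumr_ge0.
by apply: sumr_ge0 => k' _; exact: sumr_ge0.
Qed.

Let Kr (f : R -> R) : R[i] := K (fun t => (f t)%:C).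

Let Kr_lin (c : R) f g : schwartz_real f -> schwartz_real g ->
  Kr (fun x => c * f x + g x) = c%:C * Kr f + Kr g.
Proof. exact: td_real_linear. Qed.

Let Kr_exp m : (0 < m)%N ->
  (1 + tau * m%:R)%:C * Kr (fun t => chi t * expR (- (m%:R * t))) = (1 + m%:R)%:C.
Proof.
move=> m0; have [_ /(_ m%:R%:C)] := K_invL.
rewrite /= ltr0n m0 => /(_ isT).
rewrite /laplace (_ : (fun t => _) = fun t => (chi t * expR (- (m%:R * t)))%:C).
  rewrite -/(Kr _) => ->; rewrite !rmorphD !rmorph1 rmorphM/= mulrC divfK//.
  rewrite -rmorphM -[1]/(1%:C) -rmorphD fmorph_eq0 gt_eqF// ltr_pwDl//.
  by apply: mulr_ge0 => //; exact: ltW.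
apply/funext => t; rewrite /expC -rmorphM/= oppr0 cos0 sin0 mulr1 mulr0.
by rewrite rmorphM.
Qed.

(* With g = exp (- t) r (exp (- t)), this is the left-hand side of
   [K (chi (g - tau g')) = g 0 - g' 0]. *)
Let Theta d := Kr (fun t => (1 + tau) * exp_jet w d 0 0 1 0 t + tau * exp_jet w d 0 0 2 1 t).

Let schwartz_Theta d : jet d ->
  schwartz_real (fun t => (1 + tau) * exp_jet w d 0 0 1 0 t + tau * exp_jet w d 0 0 2 1 t).
Proof.
move=> jd; apply: schwartz_real_lin; first exact: schwartz_exp_jet.
have := schwartz_real_lin tau (@schwartz_exp_jet d 0 2 1 jd isT) schwartz_real0.
by congr schwartz_real; apply/funext => t; rewrite addr0.
Qed.

Let Theta_lin d1 d2 (c : R) : jet d1 -> jet d2 ->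
  Theta (fun k y => c * d1 k y + d2 k y) = c%:C * Theta d1 + Theta d2.
Proof.
move=> j1 j2; rewrite /Theta -Kr_lin; [|exact: schwartz_Theta..].
by congr Kr; apply/funext => t; rewrite !exp_jetD; ring.
Qed.

(** The finite order of [K] becomes control by finitely many derivatives of r on [0, B]. One order
    more than that of [K] is counted, since the second half of [Theta] already contains r'. *)
Let Theta_bound : exists (B C : R) (N : nat), [/\ 1 <= B, 0 <= C &
  forall d, jet d -> forall e : R, 0 <= e ->
    (forall (l : nat) (y : R), (l <= N)%N -> 0 <= y <= B -> `|d l y| <= e) ->
    `|Theta d| <= (C * e)%:C].
Proof.
have [B B1 BP] := exp_jet_seminorm; have [C [N TC]] := td_real_bound K.
have [C1 C10 C1P] := BP N 0%N 1%N isT; have [C2 C20 C2P] := BP N 0%N 2%N isT.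
have bnd d (jd : jet d) (e : R) (e0 : 0 <= e) (de : forall (l : nat) (y : R),
    (l <= N.+1)%N -> 0 <= y <= B -> `|d l y| <= e) :
    `|Theta d| <= ((1 + tau) * (C * (C1 * e)) + tau * (C * (C2 * e)))%:C.
  have s1 := @schwartz_exp_jet d 0 1 0 jd isT.
  have s2 := @schwartz_exp_jet d 0 2 1 jd isT.
  have -> : Theta d = (1 + tau)%:C * Kr (exp_jet w d 0 0 1 0) +
                      tau%:C * Kr (exp_jet w d 0 0 2 1).
    have s2' : schwartz_real (fun t => tau * exp_jet w d 0 0 2 1 t).
      have := schwartz_real_lin tau s2 schwartz_real0.
      by congr schwartz_real; apply/funext => t; rewrite addr0.
    have Kt : Kr (fun t => tau * exp_jet w d 0 0 2 1 t) = tau%:C * Kr (exp_jet w d 0 0 2 1).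
      exact: td_real_scale.
    by rewrite -Kt; exact: td_real_linear.
  rewrite [leRHS]rmorphD; apply: le_trans (ler_normD _ _) _.
  have nC (c : R) : 0 <= c -> `|c%:C| = c%:C :> R[i].
    by move=> c0; rewrite ger0_norm// ler0c.
  have t0 : 0 <= 1 + tau by apply: addr_ge0 => //; exact: ltW.
  apply: lerD; rewrite normrM nC// ?[leRHS]rmorphM; try exact: ltW;
    apply: ler_wpM2l; rewrite ?ler0c//; try exact: ltW.
    by apply: TC => //; [apply: C1P => // l y /leqW; exact: de|nonneg].
  by apply: TC => //; [apply: C2P => // l y ln; apply: de|nonneg].
have C'0 : 0 <= (1 + tau) * (`|C| * C1) + tau * (`|C| * C2) by nonneg.
exists B, ((1 + tau) * (`|C| * C1) + tau * (`|C| * C2)), N.+1; split=> //.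
move=> d jd e e0 de; apply: le_trans (bnd d jd e e0 de) _.
rewrite lecR.
have -> : ((1 + tau) * (`|C| * C1) + tau * (`|C| * C2)) * e =
  (1 + tau) * (`|C| * (C1 * e)) + tau * (`|C| * (C2 * e)) by ring.
apply: lerD; apply: ler_wpM2l; nonneg.
  by apply: ler_wpM2r; [nonneg|exact: ler_norm].
by apply: ler_wpM2r; [nonneg|exact: ler_norm].
Qed.

Let jet_poly (p : {poly R}) : jet (fun n y => (p^`(n)).[y]).
Proof. by move=> n x; rewrite derivnS; exact: is_derive_poly. Qed.

(** Here g = exp (- (k + 1) t), so g - tau g' is 1 + tau (k + 1) times g, and the transform at s = k
    + 1 leaves 1 + (k + 1). *)
Let Theta_monomial k : Theta (fun n y => (('X^k : {poly R})^`(n)).[y]) = (k.+2%:R)%:C.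
Proof.
have sE : schwartz_real (fun t : R => chi t * expR (- (k.+1%:R * t))).
  have := @schwartz_exp_jet _ 0 k.+1 0 (jet_poly 1) isT.
  by congr schwartz_real; apply/funext => t; rewrite /exp_jet; cbv beta iota; rewrite derivn0 hornerC mulr1.
transitivity (Kr (fun t => (1 + tau * k.+1%:R) * (chi t * expR (- (k.+1%:R * t))))).
  congr Kr; apply/funext => t; rewrite /exp_jet; cbv beta iota; rewrite derivn0 derivn1 derivXn hornerMn !hornerXn.
  rewrite /w/= mul1r.
  have -> : expR (- (k.+1%:R * t)) = expR (- t) * expR (- t) ^+ k.
    by rewrite -exprS -expRM_natl mulrN.
  case: k {sE} => [|k]; first by rewrite /= mulr0n expr0; ring.
  have -> : expR (- (2 * t)) = expR (- t) * expR (- t).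
    by rewrite -expRD; congr expR; ring.
  by rewrite /= -mulr_natr !exprS -!natr1; ring.
rewrite /Kr td_real_scale//; apply: etrans (Kr_exp (ltn0Sn k)) _.
by congr (_%:C); rewrite -!natr1; ring.
Qed.

Let Theta_poly (p : {poly R}) :
  Theta (fun n y => (p^`(n)).[y]) = (2 * p.[1] + p^`().[1])%:C.
Proof.
have step (c : R) (q r : {poly R}) :
    Theta (fun n y => (q^`(n)).[y]) = (2 * q.[1] + q^`().[1])%:C ->
    Theta (fun n y => (r^`(n)).[y]) = (2 * r.[1] + r^`().[1])%:C ->
    Theta (fun n y => ((c *: q + r)^`(n)).[y]) =
    (2 * (c *: q + r).[1] + (c *: q + r)^`().[1])%:C.
  move=> Pq Pr; rewrite (_ : (fun n y => _) =
      fun n y => c * (q^`(n)).[y] + (r^`(n)).[y]); last first.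
    by apply/funext => n; apply/funext => y; rewrite derivnD derivnZ !hornerE.
  rewrite Theta_lin; [|exact: jet_poly..].
  rewrite Pq Pr derivD derivZ !hornerD !hornerZ !rmorphD !rmorphM !rmorphD.
  by ring.
have mono k : Theta (fun n y => (('X^k : {poly R})^`(n)).[y]) =
    (2 * ('X^k : {poly R}).[1] + ('X^k : {poly R})^`().[1])%:C.
  rewrite Theta_monomial derivXn hornerMn !hornerXn !expr1n mulr1 -natrD.
  by congr (_%:C).
rewrite -[p]coefK poly_def; elim: (size p) => [|n IH].
  (* The zero polynomial is written as - 1 + 1 so that [step] covers it as well. *)
  rewrite big_ord0 -(_ : (-1) *: 'X^0 + 'X^0 = 0 :> {poly R}); last first.
    by rewrite scaleN1r addNr.
  by apply: step; exact: mono.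
by rewrite big_ord_recr/= addrC; apply: step.
Qed.

(** Both sides are continuous for uniform convergence of finitely many derivatives on [0, B], where
    polynomials are dense; the point 1 lies there since B >= 1. The 3 in C + 3 pays for the
    evaluation of the right-hand side. *)
Let ThetaE d : jet d -> Theta d = (2 * d 0%N 1 + d 1%N 1)%:C.
Proof.
move=> jd; have [B [C [N [B1 C0 TB]]]] := Theta_bound.
apply/eqP; rewrite -subr_eq0 -normr_le0.
suff small (e : R) : 0 < e -> `|Theta d - (2 * d 0%N 1 + d 1%N 1)%:C| <= ((C + 3) * e)%:C.
  have [x x0 xE] : exists2 x : R, 0 <= x &
      `|Theta d - (2 * d 0%N 1 + d 1%N 1)%:C| = x%:C.
    rewrite /Num.norm/=; case: (_ - _) => a b /=.
    by exists (Num.sqrt (a ^+ 2 + b ^+ 2)) => //; exact: sqrtr_ge0.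
  rewrite xE in small *; rewrite (_ : 0 = 0%:C)// lecR.
  apply/ler_addgt0Pr => e e0; rewrite add0r.
  have C3 : 0 < C + 3 by rewrite ltr_wpDl.
  have := small (e / (C + 3)); rewrite divr_gt0// => /(_ isT).
  by rewrite lecR mulrC divfK// gt_eqF.
move=> e0; have B0 : 0 < B by exact: lt_le_trans ltr01 B1.
have [p pP] := weierstrass_jet jd B0 N.+1 0 e0.
have e0' := ltW e0; have jp := jet_poly p.
have jdp : jet (fun n y => (-1) * (p^`(n)).[y] + d n y).
  by move=> n x; apply: is_deriveD => //; exact: is_deriveZ.
have TdE : Theta (fun n y => (-1) * (p^`(n)).[y] + d n y) = Theta d - (2 * p.[1] + p^`().[1])%:C.
  by rewrite Theta_lin// Theta_poly rmorphN rmorph1 mulN1r addrC.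
have nC (x : R) : `|x%:C| = `|x|%:C :> R[i] by rewrite normc_def /= expr0n addr0 sqrtr_sqr.
have -> : Theta d - (2 * d 0%N 1 + d 1%N 1)%:C =
    Theta (fun n y => (-1) * (p^`(n)).[y] + d n y) +
    (2 * (p.[1] - d 0%N 1) + (p^`().[1] - d 1%N 1))%:C.
  by rewrite TdE -addrA -rmorphN -rmorphN -rmorphD; congr (_ + _%:C); ring.
apply: le_trans (ler_normD _ _) _; rewrite [(C + 3) * e]mulrDl [leRHS]rmorphD lerD//.
  apply: TB => // l y lN yB; rewrite mulN1r addrC.
  by have := pP l (leqW lN) y yB; rewrite add0n.
rewrite nC lecR; apply: le_trans (ler_normD _ _) _.
have := pP 0%N isT 1; rewrite B1 ler01 => /(_ isT); rewrite add0n derivn0 distrC => p0.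
have := pP 1%N isT 1; rewrite B1 ler01 => /(_ isT); rewrite add0n derivn1 distrC => p1.
by rewrite normrM ger0_norm//; move: p0 p1; lra.
Qed.

(** With s = - d/dt, the denominator 1 + tau s of the transform has been moved onto [g]; what is
    left of [K] is the numerator (1 + s) g at 0, without memory. *)
Lemma inverse_laplace_kernelE (g : R -> R) T : smooth g -> (forall t, T <= t -> g t = 0) ->
  K (fun u => (chi u * (g u - tau * 'D_1 g u))%:C) = (g 0 - 'D_1 g 0)%:C.
Proof.
move=> sg gT; pose gj j := iter_derive (nseq j (1 : R)) g.
have jg : jet gj by exact: jet_smooth.
have gj0 j t : T + 1 <= t -> gj j t = 0.
  move=> Tt; apply: (@iter_derive_open_eq0 _ _ _ _ [set t : R | T < t]) => /=.
  - exact: open_gt.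
  - by move=> u /ltW; exact: gT.
  - by apply: lt_le_trans Tt; rewrite ltrDl.
(* This is r(y) = g (- ln y) / y, so that g = exp (- t) r (exp (- t)). The threshold T + 1 comes
   from the derivatives being shown to vanish on the open half-line beyond T. *)
pose d n := log_jet gj n 1 0; have jd : jet d by exact: jet_log_jet jg _ gj0 _ _.
have gE t : g t = expR (- t) * d 0%N (expR (- t)).
  rewrite /d/= expR_gt0 expRK opprK expr1 mulrA divff ?mul1r//.
  by rewrite gt_eqF// expR_gt0.
(* With the cutoff replaced by the constant 1, [exp_jet] is [g] itself, and its jet property yields
   the formula for the derivative of [g]. *)
pose one := fun n : nat => cst (n == 0%N)%:R : R -> R.
have jone : jet one by move=> n x; exact: is_derive_cst.
have := jet_exp_jet jone jd 0 1 0 0.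
rewrite (_ : exp_jet one d 0 0 1 0 = g); last first.
  by apply/funext => t /=; rewrite !mul1r gE.
move=> gD.
have DgE t : 'D_1 g t = - (expR (- t) * d 0%N (expR (- t))) -
    expR (- (2 * t)) * d 1%N (expR (- t)).
  by have [_ ->] := gD t; rewrite /exp_jet /one /cst /= mul1r; ring.
apply: etrans (_ : Theta d = _).
  congr (K _); apply/funext => u; congr (_%:C).
  by rewrite DgE gE /exp_jet /w /= mul1r; ring.
rewrite (ThetaE jd); congr (_%:C).
by rewrite DgE gE mulr0 oppr0 expR0; ring.
Qed.

End inverse_laplace_kernel.

(** * Coefficients of the expansion behind the wave front *)

Section formal_series.
Context {R : comRingType}.
Implicit Types (f g h : nat -> R).

Definition conv f g n := \sum_(j < n.+1) f j * g (n - j)%N.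

Definition series_shift f n := if n is n'.+1 then f n' else 0.

Let trunc N f : {poly R} := \poly_(i < N) f i.

(** Up to a given order the Cauchy product is a product of polynomials, from which commutativity and
    associativity are inherited. *)
Let convE N f g n : (n < N)%N -> conv f g n = (trunc N f * trunc N g)`_n.
Proof.
move=> nN; rewrite coefM; apply: eq_bigr => j _.
by rewrite !coef_poly (leq_ltn_trans (leq_ord j) nN) (leq_ltn_trans (leq_subr _ _) nN).
Qed.

Lemma convC f g : conv f g = conv g f.
Proof. by apply/funext => n; rewrite !(convE _ _ (ltnSn n)) mulrC. Qed.

Lemma convA f g h : conv f (conv g h) = conv (conv f g) h.
Proof.
apply/funext => n.
transitivity ((trunc n.+1 f * (trunc n.+1 g * trunc n.+1 h))`_n).
  rewrite coefM; apply: eq_bigr => j _.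
  rewrite coef_poly ltn_ord; congr (_ * _).
  by apply: convE; rewrite ltnS leq_subr.
rewrite mulrA coefM; apply: eq_bigr => j _.
by rewrite coef_poly ltnS leq_subr -convE.
Qed.

Lemma convDr f g h : conv f (fun n => g n + h n) = fun n => conv f g n + conv f h n.
Proof.
by apply/funext => n; rewrite /conv -big_split; apply: eq_bigr => j _; rewrite mulrDr.
Qed.

Lemma conv_shift f g : conv f (series_shift g) = series_shift (conv f g).
Proof.
apply/funext => -[|n]; rewrite /conv /=.
  by rewrite big_ord_recr big_ord0 /= mulr0 addr0.
rewrite big_ord_recr/= subnn/= mulr0 addr0; apply: eq_bigr => j _.
by rewrite subSn// -ltnS.
Qed.

Lemma convZr f (c : R) g : conv f (fun n => c * g n) = fun n => c * conv f g n.
Proof.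
by apply/funext => n; rewrite /conv mulr_sumr; apply: eq_bigr => j _; rewrite mulrCA.
Qed.

Lemma convDl f g h : conv (fun n => f n + g n) h = fun n => conv f h n + conv g h n.
Proof. by rewrite convC convDr; apply/funext => n; rewrite !(convC h). Qed.

Lemma shift_conv f g : conv (series_shift f) g = series_shift (conv f g).
Proof. by rewrite convC conv_shift (convC g). Qed.

Lemma conv1 f : conv f (fun n => (n == 0%N)%:R) = f.
Proof.
apply/funext => n; rewrite /conv big_ord_recr/= subnn eqxx mulr1 big1 ?add0r// => j _.
by rewrite subn_eq0 leqNgt ltn_ord mulr0.
Qed.

End formal_series.

(** * Square root of a formal power series *)

Section square_root_series.
Context {R : realFieldType}.
Variable e : nat -> R.

Let next (f : nat -> R) n := (e n.+1 - \sum_(j < n) f j.+1 * f (n - j)%N) / 2.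

(** Course-of-values recursion: stage n keeps the coefficients 0, ..., n as a function, because
    [next] needs all the earlier ones. *)
Fixpoint prefix n : nat -> R :=
  if n is n'.+1 then fun k => if k == n'.+1 then next (prefix n') n' else prefix n' k
  else fun k => (k == 0%N)%:R.

(* The square root, with constant coefficient 1, of the series with
   coefficients [e], provided e 0 = 1. *)
Definition sqrt_series n := prefix n n.

Let prefixE n k : (k <= n)%N -> prefix n k = sqrt_series k.
Proof.
elim: n => [|n IH]; first by rewrite leqn0 => /eqP ->.
rewrite leq_eqVlt => /orP[/eqP -> //|kn] /=.
by rewrite ltn_eqF//; exact: IH.
Qed.

Lemma sqrt_series0 : sqrt_series 0 = 1.
Proof. by []. Qed.

Lemma sqrt_seriesS n : sqrt_series n.+1 =
  (e n.+1 - \sum_(j < n) sqrt_series j.+1 * sqrt_series (n - j)%N) / 2.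
Proof.
rewrite {1}/sqrt_series /= eqxx /next; congr ((_ - _) / 2).
apply: eq_bigr => j _; by rewrite !prefixE// ?leq_subr.
Qed.

Lemma conv_sqrt_series : e 0%N = 1 -> conv sqrt_series sqrt_series = e.
Proof.
move=> e0; apply/funext => -[|n]; rewrite /conv.
  by rewrite big_ord_recr big_ord0 /= sqrt_series0 e0; ring.
rewrite big_ord_recl big_ord_recr/= subn0 subnn sqrt_series0.
rewrite (eq_bigr (fun j : 'I_n => sqrt_series j.+1 * sqrt_series (n - j)%N)); last first.
  by move=> j _; rewrite /bump /= add1n subSS.
by rewrite /bump/= add1n sqrt_seriesS; field.
Qed.

(** For a polynomial p with non-negative coefficients, a partial sum of the coefficients of p^2 is
    at most the full sum, which is p(1)^2. *)
Let sum_conv_le (x : nat -> R) M : (forall i, 0 <= x i) ->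
  \sum_(m < M) conv x x m <= (\sum_(i < M) x i) ^+ 2.
Proof.
move=> x0; pose p := \poly_(i < M) x i.
have -> : \sum_(i < M) x i = p.[1].
  rewrite (horner_coef_wide _ (size_poly _ _)); apply: eq_bigr => i _.
  by rewrite expr1n mulr1 coef_poly ltn_ord.
have pp0 i : 0 <= (p * p)`_i.
  by rewrite coefM sumr_ge0// => j _; apply: mulr_ge0; rewrite coef_poly; case: ifP.
rewrite expr2 -hornerM (@horner_coef_wide _ (M + size (p * p))); last exact: leq_addl.
rewrite big_split_ord/=.
rewrite (eq_bigr (fun i : 'I_M => (p * p)`_i * 1 ^+ i)) => [|i _].
  by rewrite lerDl; apply: sumr_ge0 => i _; rewrite expr1n mulr1.
rewrite expr1n mulr1 coefM; apply: eq_bigr => j _.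
rewrite !coef_poly (leq_ltn_trans (leq_ord j) (ltn_ord i)).
by rewrite (leq_ltn_trans (leq_subr _ _) (ltn_ord i)).
Qed.

(** Write the root as 1 + x. From 2 x = (e - 1) - x^2 the partial sums D_N of |x| weighted at radius
    rho satisfy 2 D_(N+1) <= 1 + D_N^2, so they stay below 1 by induction, and with them each single
    term. *)
Lemma sqrt_series_bound (rho : R) : 0 < rho ->
  (forall N, \sum_(n < N) `|e n.+1| * rho ^+ n.+1 <= 1) ->
  forall n, `|sqrt_series n| <= rho^-1 ^+ n.
Proof.
move=> rho0 erho; pose x n := `|sqrt_series n.+1| * rho ^+ n.+1.
have x0 n : 0 <= x n by rewrite /x; apply: mulr_ge0 => //; apply: exprn_ge0; exact: ltW.
have xS n : 2 * x n <= `|e n.+1| * rho ^+ n.+1 + series_shift (conv x x) n.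
  rewrite /x sqrt_seriesS normrM [`|2^-1|]ger0_norm; last by rewrite invr_ge0.
  rewrite mulrAC mulrCA divff ?pnatr_eq0// mulr1.
  apply: le_trans (ler_wpM2r (exprn_ge0 _ (ltW rho0)) (ler_normB _ _)) _.
  rewrite mulrDl lerD2l.
  apply: le_trans (ler_wpM2r (exprn_ge0 _ (ltW rho0)) (ler_norm_sum _ _ _)) _.
  case: n => [|n]; first by rewrite big_ord0 mul0r.
  rewrite mulr_suml /= /conv; apply: ler_sum => j _.
  rewrite normrM subSn; last by rewrite -ltnS.
  rewrite le_eqVlt; apply/orP; left; apply/eqP.
  have -> : rho ^+ n.+2 = rho ^+ j.+1 * rho ^+ (n - j).+1.
    rewrite -exprD; congr (_ ^+ _); rewrite addSn addnS subnKC// -ltnS.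
    exact: ltn_ord.
  by rewrite /x; ring.
have D1 N : \sum_(n < N) x n <= 1.
  elim: N => [|N IH]; first by rewrite big_ord0.
  have : 2 * \sum_(n < N.+1) x n <= 1 + 1.
    rewrite mulr_sumr; apply: le_trans (_ : \sum_(n < N.+1) (`|e n.+1| * rho ^+ n.+1 + series_shift (conv x x) n) <= _).
      by apply: ler_sum => n _; exact: xS.
    rewrite big_split/=; apply: lerD; first exact: erho.
    rewrite big_ord_recl/= add0r; apply: le_trans (sum_conv_le N x0) _.
    by rewrite expr_le1// sumr_ge0.
  by lra.
case=> [|n]; first by rewrite sqrt_series0 normr1.
rewrite exprVn -[leRHS]mul1r ler_pdivlMr ?exprn_gt0//.
apply: le_trans (D1 n.+1); rewrite big_ord_recr/= lerDr.
exact: sumr_ge0.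
Qed.

End square_root_series.

Section zener_coefficients.
Context {R : realType}.
Variable tau : R.
Hypotheses (tau_gt0 : 0 < tau) (tau_lt1 : tau < 1).

(* The coefficients of (1 + z / tau) / (1 + z), where z stands for 1 / s; its
   square root is the factor sqrt ((1 + tau s) / (1 + s)) / sqrt tau. *)
Definition zener_ratio n : R := if n is n'.+1 then (tau^-1 - 1) * (-1) ^+ n' else 1.

Definition zener_sqrt := sqrt_series zener_ratio.

(** The series m of the splitting sqrt ratio = 1 + z m(z): beyond the pure delay, the exponent is -
    sigma x m(1/s). *)
Definition zener_memory n := zener_sqrt n.+1.

Lemma zener_ratio_rec n : zener_ratio n.+1 + zener_ratio n =
  (n == 0%N)%:R / tau.
Proof. by case: n => [|n] /=; rewrite ?expr0 ?exprS ?mul1r ?mul0r; ring. Qed.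

Lemma conv_zener_sqrt : conv zener_sqrt zener_sqrt = zener_ratio.
Proof. exact: conv_sqrt_series. Qed.

Let alpha0 : 0 < tau^-1 - 1.
Proof. by rewrite subr_gt0 invf_gt1. Qed.

(** The radius is tau: the weighted coefficients (1/tau - 1) tau^(n+1) add up to 1 - tau^N, below
    1. *)
Lemma zener_sqrt_bound n : `|zener_sqrt n| <= tau^-1 ^+ n.
Proof.
apply: sqrt_series_bound => // N.
suff -> : \sum_(n < N) `|zener_ratio n.+1| * tau ^+ n.+1 = 1 - tau ^+ N.
  by rewrite lerBlDr lerDl exprn_ge0// ltW.
elim: N => [|N IH]; first by rewrite big_ord0 expr0 subrr.
rewrite big_ord_recr/= IH normrM normrX normrN1 expr1n mulr1 gtr0_norm// exprS.
by field; rewrite gt_eqF.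
Qed.

Let sigma : R := Num.sqrt tau.

(** Coefficients of sqrt ratio times (m - m_0)^k: the sum stops before j = n, which leaves out m_0;
    that constant goes into the exponential factor of [zener_coef]. As (m - m_0)^k has order at
    least k, only k <= n contribute to z^n. *)
Fixpoint zener_exp_coef k n : R :=
  if k is k'.+1 then \sum_(j < n) zener_exp_coef k' j * zener_memory (n - j)
  else zener_sqrt n.

(* The coefficient of [s^-n] in
   sqrt tau^-1 s^-1 sqrt ((1 + tau s) / (1 + s)) exp (- x s (sqrt ((1 + tau s) / (1 + s)) - sqrt tau)). *)
Definition zener_coef n (x : R) : R :=
  expR (- (sigma * zener_memory 0 * x)) *
  \sum_(k < n.+1) (- sigma * x) ^+ k / k`!%:R * zener_exp_coef k n.

(** A derivative in x brings down a factor - sigma m, so [zener_coef1] and [zener_coef2] are the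
    first two derivatives of [zener_coef] up to powers of - sigma. *)
Definition zener_coef1 n x := conv (fun j => zener_coef j x) zener_memory n.

Definition zener_coef2 n x := conv (fun j => zener_coef1 j x) zener_memory n.

Lemma zener_coef0 n : zener_coef n 0 = zener_sqrt n.
Proof.
rewrite /zener_coef mulr0 oppr0 expR0 mul1r big_ord_recl/= expr0 divr1 mul1r.
by rewrite big1 ?addr0// => k _; rewrite mulr0 exprS !mul0r.
Qed.

Lemma zener_coef0E x : zener_coef 0 x = expR (- (sigma * zener_memory 0 * x)).
Proof. by rewrite /zener_coef big_ord_recl big_ord0 /= expr0 divr1 addr0 !mulr1. Qed.

Lemma zener_memory0 : zener_memory 0 = (tau^-1 - 1) / 2.
Proof.
by rewrite /zener_memory /zener_sqrt sqrt_seriesS big_ord0 /= expr0 mulr1 subr0.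
Qed.

Let zener_exp_coef_small k n : (n < k)%N -> zener_exp_coef k n = 0.
Proof.
elim: k n => // k IH n nk /=; rewrite big1// => j _.
by rewrite IH ?mul0r//; apply: leq_trans (ltn_ord j) _.
Qed.

Let zener_poly n : {poly R} :=
  \sum_(k < n.+1) (zener_exp_coef k n / k`!%:R * (- sigma) ^+ k) *: 'X^k.

Let zener_polyE n y : (zener_poly n).[y] =
  \sum_(k < n.+1) (- sigma * y) ^+ k / k`!%:R * zener_exp_coef k n.
Proof.
by rewrite horner_sum; apply: eq_bigr => k _; rewrite hornerZ hornerXn exprMn; ring.
Qed.

Let zener_coefE n x : zener_coef n x =
  expR (- (sigma * zener_memory 0 * x)) * (zener_poly n).[x].
Proof. by rewrite zener_polyE. Qed.

(** The polynomial part contributes multiplication by m - m_0 only; the missing m_0 will come from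
    differentiating the exponential. *)
Let deriv_zener_poly n y : (zener_poly n)^`().[y] =
  - sigma * \sum_(j < n) (zener_poly j).[y] * zener_memory (n - j).
Proof.
rewrite raddf_sum/= horner_sum big_ord_recl/= derivZ derivXn mulr0n scaler0 horner0 add0r.
rewrite (eq_bigr (fun k : 'I_n => \sum_(j < n) - sigma * ((- sigma * y) ^+ k / k`!%:R *
    zener_exp_coef k j * zener_memory (n - j)))) => [|k _]; last first.
  rewrite derivZ derivXn hornerZ hornerMn hornerXn /bump/= add1n.
  have k0 : k`!%:R != 0 :> R by rewrite pnatr_eq0 -lt0n fact_gt0.
  have k1 : k.+1%:R != 0 :> R by rewrite pnatr_eq0.
  rewrite -!mulr_sumr; set Z := \sum_(j < n) _.
  have -> : \sum_(j < n) (- sigma * y) ^+ k / k`!%:R * zener_exp_coef k j * zener_memory (n - j)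
      = (- sigma * y) ^+ k / k`!%:R * Z.
    by rewrite mulr_sumr; apply: eq_bigr => j _; rewrite mulrA.
  by rewrite factS natrM exprMn exprS -mulr_natr; field; rewrite k0 nat1r k1.
rewrite exchange_big mulr_sumr; apply: eq_bigr => j _.
rewrite zener_polyE -mulr_sumr -mulr_suml; congr (_ * (_ * _)).
rewrite (big_ord_widen _ (fun k => (- sigma * y) ^+ k / k`!%:R * zener_exp_coef k j) (ltn_ord j)).
rewrite [LHS](bigID (fun k : 'I_n => (k < j.+1)%N))/= [X in _ + X]big1 ?addr0// => k.
by rewrite -leqNgt => jk; rewrite zener_exp_coef_small ?mulr0.
Qed.

Lemma is_derive_zener_coef n (x : R) :
  is_derive x (1 : R) (zener_coef n) (- sigma * zener_coef1 n x).
Proof.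
pose b := sigma * zener_memory 0.
have -> : zener_coef n = (fun y => expR (- (b * y))) * horner (zener_poly n).
  by apply/funext => y; rewrite zener_coefE.
apply: is_derive_eq (is_deriveM (is_derive_expRN b x) (is_derive_poly (zener_poly n) x)) _.
rewrite /GRing.scale/= deriv_zener_poly /zener_coef1 /conv big_ord_recr/= subnn.
rewrite [in RHS](eq_bigr (fun j : 'I_n => expR (- (b * x)) *
    ((zener_poly j).[x] * zener_memory (n - j)))) => [|j _]; last first.
  by rewrite zener_coefE -/b mulrA.
rewrite -mulr_sumr zener_coefE -/b /b /comp.
by ring.
Qed.

Lemma is_derive_zener_coef1 n (x : R) :
  is_derive x (1 : R) (zener_coef1 n) (- sigma * zener_coef2 n x).
Proof.
have -> : zener_coef1 n = \sum_(j < n.+1) (zener_memory (n - j) *: zener_coef j).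
  apply/funext => y; rewrite fct_sumE; apply: eq_bigr => j _.
  by rewrite mulrC.
apply: is_derive_eq (is_derive_sum (fun j : 'I_n.+1 => is_deriveZ (zener_memory (n - j))
  (is_derive_zener_coef j x))) _.
rewrite /zener_coef2 /conv mulr_sumr; apply: eq_bigr => j _.
by rewrite /GRing.scale/=; ring.
Qed.

Let conv_bound (f g : nat -> R) (A B P : R) : 0 <= A -> 0 <= B -> 0 <= P ->
  (forall n, `|f n| <= A * P ^+ n) -> (forall n, `|g n| <= B * P ^+ n) ->
  forall n, `|conv f g n| <= A * B * (2 * P) ^+ n.
Proof.
move=> A0 B0 P0 fA gB n; apply: le_trans (ler_norm_sum _ _ _) _.
apply: le_trans (_ : \sum_(j < n.+1) A * B * P ^+ n <= _).
  apply: ler_sum => j _; rewrite normrM.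
  apply: le_trans (ler_pM _ _ (fA j) (gB (n - j)%N)) _ => //.
  have -> : P ^+ n = P ^+ j * P ^+ (n - j) by rewrite -exprD subnKC// -ltnS.
  by rewrite le_eqVlt; apply/orP; left; apply/eqP; ring.
rewrite sumr_const card_ord -[leLHS]mulr_natl exprMn mulrCA.
apply: ler_wpM2l; first exact: mulr_ge0.
apply: ler_wpM2r; first exact: exprn_ge0.
by rewrite -natrX ler_nat; exact: ltn_expl.
Qed.

(** Geometric growth, uniform for x in [0, L], is enough: the kernel pairs these coefficients with
    r^n/n!. *)
Lemma zener_coef_bound (L : R) : 0 <= L -> exists A P : R, [/\ 0 <= A, 1 <= P &
  forall n x, 0 <= x <= L -> [/\ `|zener_coef n x| <= A * P ^+ n,
    `|zener_coef1 n x| <= A * P ^+ n & `|zener_coef2 n x| <= A * P ^+ n]].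
Proof.
move=> L0; pose r := tau^-1.
have r1 : 1 < r by rewrite invf_gt1.
have r0 : 0 <= r by apply: ltW; exact: lt_trans r1.
have mb n : `|zener_memory n| <= r * r ^+ n by rewrite -exprS zener_sqrt_bound.
have Zb k n : `|zener_exp_coef k n| <= r ^+ k * (2 * r) ^+ n.
  elim: k n => [|k IH] n.
    rewrite expr0 mul1r exprMn; apply: le_trans (zener_sqrt_bound n) _.
    by rewrite ler_peMl ?exprn_ge0// -natrX ler1n expn_gt0.
  apply: le_trans (ler_norm_sum _ _ _) _.
  apply: le_trans (_ : \sum_(j < n) r ^+ k.+1 * r ^+ n * 2 ^+ j <= _).
    apply: ler_sum => j _; rewrite normrM.
    apply: le_trans (ler_pM _ _ (IH j) (mb (n - j)%N)) _ => //.
    have -> : r ^+ n = r ^+ j * r ^+ (n - j) by rewrite -exprD subnKC// ltnW.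
    by rewrite exprMn exprS le_eqVlt; apply/orP; left; apply/eqP; ring.
  rewrite -mulr_sumr exprMn -mulrA ler_wpM2l ?exprn_ge0// mulrC ler_wpM2r ?exprn_ge0//.
  elim: n => [|n IHn]; first by rewrite big_ord0 expr0.
  by rewrite big_ord_recr/= exprS; move: IHn; lra.
have s0 : 0 <= sigma by exact: sqrtr_ge0.
have m0 : 0 <= zener_memory 0 by rewrite zener_memory0 divr_ge0// ltW.
(* As Z >= 1 and Z >= sigma x r, the power Z^n dominates (sigma x r)^k / k! for every k <= n. *)
pose Z := 1 + sigma * L * r.
have Z1 : 1 <= Z by rewrite lerDl; apply: mulr_ge0 => //; apply: mulr_ge0.
have Z0 : 0 <= Z by exact: le_trans Z1.
have b0 n x : 0 <= x <= L -> `|zener_coef n x| <= 1 * (4 * r * Z) ^+ n.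
  move=> /andP[x0 xL]; rewrite normrM ger0_norm ?expR_ge0//.
  apply: ler_pM; rewrite ?expR_ge0//.
    by rewrite -expR0 ler_expR oppr_le0; apply: mulr_ge0 => //; exact: mulr_ge0.
  apply: le_trans (ler_norm_sum _ _ _) _.
  apply: le_trans (_ : \sum_(k < n.+1) Z ^+ n * (2 * r) ^+ n <= _).
    apply: ler_sum => k _; rewrite normrM.
    apply: le_trans (ler_pM _ _ (lexx _) (Zb k n)) _ => //.
    rewrite mulrA ler_wpM2r ?exprn_ge0 ?mulr_ge0//.
    rewrite normrM normrX normrM normrN (ger0_norm s0) (ger0_norm x0).
    rewrite mulrAC -exprMn [`|_^-1|]ger0_norm ?invr_ge0//.
    apply: le_trans (_ : (sigma * x * r) ^+ k <= _).
      rewrite ler_piMr ?exprn_ge0 ?mulr_ge0// invf_le1 ?ltr0n ?fact_gt0//.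
      by rewrite ler1n fact_gt0.
    apply: le_trans (_ : Z ^+ k <= _).
      apply: lerXn2r; rewrite ?nnegrE ?mulr_ge0// /Z.
      apply: le_trans (_ : sigma * L * r <= _); last by rewrite lerDr.
      by rewrite ler_wpM2r// ler_wpM2l.
    by apply: ler_weXn2l => //; rewrite -ltnS.
  rewrite sumr_const card_ord -[leLHS]mulr_natl.
  have -> : (4 * r * Z) ^+ n = 2 ^+ n * (Z ^+ n * (2 * r) ^+ n).
    by rewrite -!exprMn; congr (_ ^+ _); ring.
  rewrite ler_wpM2r ?mulr_ge0 ?exprn_ge0 ?mulr_ge0//.
  by rewrite -natrX ler_nat; exact: ltn_expl.
pose P := 4 * r * Z; have P0 : 0 <= P by rewrite !mulr_ge0.
have rP : r <= P by rewrite /P; nra.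
have mP n : `|zener_memory n| <= r * P ^+ n.
  apply: le_trans (mb n) _; rewrite ler_wpM2l// lerXn2r ?nnegrE//.
have m2P n : `|zener_memory n| <= r * (2 * P) ^+ n.
  apply: le_trans (mP n) _; rewrite ler_wpM2l// lerXn2r ?nnegrE ?mulr_ge0//.
  by rewrite ler_peMl// ler1n.
have b1 n x : 0 <= x <= L -> `|zener_coef1 n x| <= 1 * r * (2 * P) ^+ n.
  by move=> xL; apply: conv_bound => // k; exact: b0.
have b2 n x : 0 <= x <= L -> `|zener_coef2 n x| <= 1 * r * r * (2 * (2 * P)) ^+ n.
  move=> xL; apply: conv_bound; rewrite ?mulr_ge0// => k; exact: b1.
exists (r * r), (4 * P); split; first exact: mulr_ge0.
  by rewrite /P; nra.
have wk (c A Q : R) n : c <= A * Q ^+ n -> 0 <= A <= r * r -> 0 <= Q <= 4 * P ->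
    c <= r * r * (4 * P) ^+ n.
  move=> cA /andP[A0 Ar] /andP[Q0 QP]; apply: le_trans cA _.
  by apply: ler_pM; rewrite ?exprn_ge0// lerXn2r ?nnegrE// (le_trans Q0).
move=> n x xL; split; [apply: wk (b0 n x xL) _ _|apply: wk (b1 n x xL) _ _|
  apply: wk (b2 n x xL) _ _]; apply/andP; split; rewrite /P; nra.
Qed.

End zener_coefficients.

(** * Identities between the coefficient series *)

Section zener_coefficient_identities.
Context {R : realType}.
Variable tau : R.
Hypotheses (tau_gt0 : 0 < tau) (tau_lt1 : tau < 1).
Implicit Types (J : nat -> R) (x : R).
Let sigma : R := Num.sqrt tau.
Let q := zener_coef tau.
Let q1 := zener_coef1 tau.
Let q2 := zener_coef2 tau.

Let zener_sqrtE : zener_sqrt tau =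
  fun n => (n == 0%N)%:R + series_shift (zener_memory tau) n.
Proof. by apply/funext => -[|n]; rewrite /= ?addr0 ?add0r. Qed.

(** The ratio is (1 + z m)^2, and [q1], [q2] are the series of q m and q m^2. *)
Let conv_ratio x : conv (q^~ x) (zener_ratio tau) =
  fun n => q n x + 2 * series_shift (q1^~ x) n + series_shift (series_shift (q2^~ x)) n.
Proof.
have qa : conv (q^~ x) (zener_sqrt tau) = fun n => q n x + series_shift (q1^~ x) n.
  by rewrite zener_sqrtE convDr conv1 conv_shift.
rewrite -conv_zener_sqrt convA qa zener_sqrtE convDr conv1 conv_shift.
have -> : conv (fun n => q n x + series_shift (q1^~ x) n) (zener_memory tau) =
    fun n => q1 n x + series_shift (q2^~ x) n by rewrite convDl shift_conv.
by apply/funext => -[|n] /=; ring.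
Qed.

Let D x n := q n x + 2 * series_shift (q1^~ x) n + series_shift (series_shift (q2^~ x)) n.

(** Multiplication by 1 + z clears the denominator of the ratio: (1 + z) ratio = 1 + z / tau. *)
Let D_rec x n : D x n.+1 + D x n = q n.+1 x + q n x / tau.
Proof.
have rE : (fun n => zener_ratio tau n + series_shift (zener_ratio tau) n) =
    fun n => (n == 0%N)%:R + tau^-1 * series_shift (fun n => (n == 0%N)%:R) n.
  apply/funext => -[|m]; first by rewrite /=; ring.
  by rewrite [series_shift (zener_ratio tau) _]/(zener_ratio tau m) zener_ratio_rec add0r mulrC.
have := congr1 (conv (q^~ x)) rE.
rewrite !convDr convZr !conv_shift conv1 conv_ratio => /(congr1 (fun f => f n.+1)).
by rewrite [tau^-1 * _]mulrC.
Qed.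

(* The telescoped form of [(1 + z) (q + 2 z q1 + z^2 q2) = (1 + z / tau) q],
   paired with a sequence J (where [J n] stands for the n-th iterated integral
   of a function), with the boundary terms left by the truncation. *)
Lemma zener_coef_telescope J x N :
  \sum_(n < N.+2) (tau * (q n x * (J n.+1 + J n.+2) + 2 * q1 n x * (J n.+2 + J n.+3)
    + q2 n x * (J n.+3 + J n.+4)) - q n x * (tau * J n.+1 + J n.+2)) =
  tau * ((q N.+1 x + 2 * q1 N x + series_shift (q2^~ x) N) * J N.+3
    + (2 * q1 N.+1 x + q2 N x) * (J N.+3 + J N.+4) + q2 N.+1 x * (J N.+4 + J N.+4.+1))
  - q N.+1 x * J N.+3.
Proof.
have rel k : q k x = tau * (D x k.+1 + D x k - q k.+1 x).
  by rewrite D_rec; field; rewrite gt_eqF.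
apply/eqP; rewrite -subr_eq0; apply/eqP; elim: N => [|N IH].
  have := rel 0%N; rewrite /D !big_ord_recr big_ord0 /= => r0.
  transitivity (J 2%N * (tau * (q 1%N x + 2 * q1 0%N x + 0 + (q 0%N x + 2 * 0 + 0) -
    q 1%N x) - q 0%N x)); first by ring.
  by rewrite -r0 subrr mulr0.
have := rel N.+1; rewrite /D big_ord_recr => r0; move: IH.
rewrite [series_shift (q1^~ x) N.+2]/(q1 N.+1 x) [series_shift (series_shift _) N.+2]/(q2 N x) in r0.
rewrite [series_shift (q1^~ x) N.+1]/(q1 N x) [series_shift (series_shift _) N.+1]/(series_shift (q2^~ x) N) in r0.
rewrite [series_shift (q2^~ x) N.+1]/(q2 N x); set s := series_shift (q2^~ x) N in r0 *.
move=> /eqP; rewrite subr_eq0 => /eqP ->.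
transitivity (J N.+3 * (tau * (q N.+2 x + 2 * q1 N.+1 x + q2 N x +
  (q N.+1 x + 2 * q1 N x + s) - q N.+2 x) - q N.+1 x)); first (rewrite /= -/(q2 N x); ring).
by rewrite -r0 subrr mulr0.
Qed.

Lemma zener_coef_ratio n : q n 0 + series_shift (q1^~ 0) n = zener_ratio tau n.
Proof.
transitivity (conv (zener_sqrt tau) (zener_sqrt tau) n); last by rewrite conv_zener_sqrt.
have qa : q^~ 0 = zener_sqrt tau by apply/funext => k; exact: zener_coef0.
by rewrite {2}zener_sqrtE convDr conv1 conv_shift -qa.
Qed.

(** At x = 0 the series q + z q1 is the ratio itself, so the factor 1 + z leaves 1 + z / tau: these
    are the terms in [J 0] and [J 1], the others being boundary terms of the truncation. *)
Lemma zener_sqrt_telescope J N :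
  \sum_(n < N.+2) (q n 0 * (J n + J n.+1) + q1 n 0 * (J n.+1 + J n.+2)) =
  J 0%N + J 1%N / tau + zener_ratio tau N.+1 * J N.+2 + q1 N.+1 0 * (J N.+2 + J N.+3).
Proof.
have q0 := zener_coef_ratio.
have q00 : q 0%N 0 = 1 by exact: zener_coef0.
have qS n : q n.+1 0 = zener_ratio tau n.+1 - q1 n 0 by rewrite -(q0 n.+1) addrK.
elim: N => [|N IH].
  by rewrite !big_ord_recr big_ord0 /= q00 qS /= expr0; ring.
rewrite big_ord_recr IH [nat_of_ord ord_max]/= qS.
have -> : zener_ratio tau N.+2 = - zener_ratio tau N.+1.
  by have := zener_ratio_rec tau N.+1; rewrite mul0r; lra.
transitivity (J 0%N + J 1%N / tau + zener_ratio tau N.+1 * J N.+2 +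
  q1 N.+1 0 * (J N.+2 + J N.+3) + ((- zener_ratio tau N.+1 - q1 N.+1 0) *
  (J N.+2 + J N.+3) + q1 N.+2 0 * (J N.+3 + J N.+4))); first by [].
by ring.
Qed.

End zener_coefficient_identities.

(** * Integral functionals on the plane *)

Section box_functionals.
Context {R : realType}.
Local Notation plane := (R * R)%type.
Implicit Types (f phi : plane -> R) (p q v h : plane) (T : (plane -> R) -> R).

Lemma plane_normE p (M : R) : (`|p| <= M) = (`|p.1| <= M) && (`|p.2| <= M).
Proof. by rewrite prod_normE ge_max. Qed.

Lemma continuous_lin (X : topologicalType) (c : R) (u w : X -> R) :
  continuous u -> continuous w -> continuous (fun x => c * u x + w x).
Proof.
by move=> cf cg x; apply: cvgD; [apply: cvgM; [exact: cvg_cst|exact: cf]|exact: cg].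
Qed.

Lemma compact_box (L : R) : compact [set p : plane | `|p| <= L].
Proof.
rewrite (_ : [set p : plane | _] = `[- L, L] `*` `[- L, L]).
  by apply: compact_setX; exact: segment_compact.
by apply/seteqP; split=> p /=; rewrite plane_normE !in_itv/= !ler_norml => /andP.
Qed.

Lemma bounded_box f (L : R) : continuous f ->
  exists2 M : R, 0 <= M & forall p, `|p| <= L -> `|f p| <= M.
Proof.
move=> cf; have [L0|L0] := ltP L 0.
  exists 0 => // p pL; have := le_lt_trans pL L0.
  by rewrite ltNge normr_ge0.
have [c _ cmax] : exists2 c, c \in [set p : plane | `|p| <= L] &
    forall p, p \in [set p : plane | `|p| <= L] -> `|f p| <= `|f c|.
  apply: (@compact_EVT_max _ _ (fun p => `|f p|)).
  - by exists 0; rewrite /= normr0.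
  - exact: compact_box.
  - apply: continuous_subspaceT => p; apply: continuous_comp; first exact: cf.
    exact: norm_continuous.
by exists `|f c| => // p pL; apply: cmax; rewrite inE.
Qed.

(** The mean value theorem is applied twice on the segment from p to p + h; the second derivative
    along h expands into the four second partial derivatives, bounded on the box of radius L + 1. *)
Lemma taylor2_bound phi (L : R) : smooth phi -> exists2 M : R, 0 <= M &
  forall p h, `|p| <= L -> `|h| <= 1 ->
    `|phi (p + h) - phi p - 'D_h phi p| <= M * `|h| ^+ 2.
Proof.
move=> sphi.
pose d2 u v p := 'D_u (fun p => 'D_v phi p) p.
have cd2 u v : continuous (d2 u v).
  by apply: smooth_continuous; do 2!apply: smooth_derive.
have [Mxx Mxx0 xxP] := bounded_box (L + 1) (cd2 (dir_x R) (dir_x R)).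
have [Mxt Mxt0 xtP] := bounded_box (L + 1) (cd2 (dir_x R) (dir_t R)).
have [Mtx Mtx0 txP] := bounded_box (L + 1) (cd2 (dir_t R) (dir_x R)).
have [Mtt Mtt0 ttP] := bounded_box (L + 1) (cd2 (dir_t R) (dir_t R)).
exists (Mxx + Mxt + Mtx + Mtt); first by nonneg.
move=> p h pL h1.
have d2E z : d2 h h z = h.1 * (h.1 * d2 (dir_x R) (dir_x R) z + h.2 * d2 (dir_x R) (dir_t R) z)
    + h.2 * (h.1 * d2 (dir_t R) (dir_x R) z + h.2 * d2 (dir_t R) (dir_t R) z).
  have e : (fun p => 'D_h phi p) = fun p => h.1 * 'D_(dir_x R) phi p + h.2 * 'D_(dir_t R) phi p.
    by apply/funext => y; apply: derive_plane; exact: smooth_differentiable.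
  have sx := smooth_derive (dir_x R) sphi; have st := smooth_derive (dir_t R) sphi.
  have es u : (fun z => d2 u h z) = fun z => h.1 * d2 u (dir_x R) z + h.2 * d2 u (dir_t R) z.
    rewrite /d2 e derive_addf; [|exact: smoothZ..].
    apply/funext => y; congr (_ + _).
      exact: (congr1 (@^~ y) (derive_scalef h.1 u sx)).
    exact: (congr1 (@^~ y) (derive_scalef h.2 u st)).
  rewrite [LHS]derive_plane; last by apply: smooth_differentiable; exact: smooth_derive.
  by rewrite -!/(d2 _ h _) !(congr1 (fun f => f z) (es _)).
have d2M z : `|z| <= L + 1 -> `|d2 h h z| <= (Mxx + Mxt + Mtx + Mtt) * `|h| ^+ 2.
  move=> zL; rewrite d2E.
  have n1 : `|h.1| <= `|h| by rewrite prod_normE le_max lexx.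
  have n2 : `|h.2| <= `|h| by rewrite prod_normE le_max lexx orbT.
  have bnd (a b c M : R) : `|a| <= `|h| -> `|b| <= `|h| -> `|c| <= M -> `|a * (b * c)| <= M * `|h| ^+ 2.
    move=> ah bh cM; rewrite !normrM mulrA mulrC expr2.
    by apply: ler_pM => //; exact: ler_pM.
  rewrite !mulrDr !mulrDl addrA.
  do 3 (apply: le_trans (ler_normD _ _) _; apply: lerD; last by apply: bnd => //; auto).
  by apply: bnd => //; auto.
have cvx (t : R) : 0 <= t <= 1 -> `|p + t *: h| <= L + 1.
  move=> /andP[t0 t1]; apply: le_trans (ler_normD _ _) _; apply: lerD => //.
  by rewrite normrZ ger0_norm// mulr_ile1.
pose A (t : R) := (p.1 + h.1 * t, p.2 + h.2 * t).
have dA (t : R) : is_diff t A (fun y => (h.1 * y, h.2 * y)) by exact: is_diff_affine_line.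
have AE t : A t = p + t *: h by rewrite [RHS]surjective_pairing /A !(mulrC _ t).
have dA1 : (h.1 * 1, h.2 * 1) = h by rewrite !mulr1; case: (h).
have d1 (psi : plane -> R) t : smooth psi -> is_derive t (1 : R) (psi \o A) ('D_h psi (A t)).
  move=> spsi; have := smooth_is_derive t (1 : R) (smooth_affine dA spsi).
  by rewrite (derive_affine dA) ?dA1//; exact: smooth_differentiable.
have c1 (psi : plane -> R) : smooth psi -> {within `[0, 1], continuous (psi \o A)}.
  move=> spsi; apply: continuous_subspaceT; apply: smooth_continuous.
  exact: (smooth_affine dA).
have [c /andP[c0 c1'] phiE] := @MVT R (phi \o A) (fun t => 'D_h phi (A t)) 0 1 ltr01
  (fun t _ => d1 phi t sphi) (c1 phi sphi).
rewrite !bnd_simp in c0 c1'.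
have sh := smooth_derive h sphi.
have [e /andP[e0 ec] dphiE] := @MVT R _ (fun t => d2 h h (A t)) 0 c c0
  (fun t _ => d1 _ t sh) (continuous_subspaceT (smooth_continuous (smooth_affine dA sh))).
rewrite !bnd_simp in e0 ec.
have A0 : A 0 = p by rewrite AE scale0r addr0.
have A1 : A 1 = p + h by rewrite AE scale1r.
move: phiE dphiE; rewrite /= A0 A1 subr0 mulr1 subr0 => -> ->.
rewrite normrM; apply: le_trans (_ : `|d2 h h (A e)| * 1 <= _).
  by apply: ler_wpM2l => //; rewrite ger0_norm ltW.
rewrite mulr1; apply: d2M; rewrite AE; apply: cvx.
by rewrite (ltW e0) ltW// (lt_trans ec).
Qed.

(** Integration against a bounded density on the box, reduced to linearity and a bound by the
    supremum over the box. Vertical integrals and the pairing with the kernel are both of this kind,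
    so differentiation under the integral is proved once. *)
Definition box_functional (L : R) T :=
  (forall (c : R) f g, continuous f -> continuous g ->
     T (fun p => c * f p + g p) = c * T f + T g) /\
  exists2 C : R, 0 <= C & forall f (M : R), continuous f ->
     (forall p, `|p| <= L -> `|f p| <= M) -> `|T f| <= C * M.

Lemma box_functional0 L T : box_functional L T -> T (cst 0) = 0.
Proof.
move=> [Tlin _]; have c0 : continuous (cst 0 : plane -> R) by exact: cst_continuous.
have := Tlin (-1) _ _ c0 c0; rewrite mulN1r addNr => e; rewrite -[RHS]e.
by congr T; apply/funext => q; rewrite /cst mulr0 addr0.
Qed.

Section convolution.
Variables (L : R) (T : (plane -> R) -> R) (phi : plane -> R).
Hypotheses (TL : box_functional L T) (sphi : smooth phi).

(** The second-order Taylor remainder is uniform over the box, so [T] sends it to O(|h|^2); the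
    linear part that remains is the differential. *)
Let conv_is_diff f p : smooth f ->
  differentiable (fun p => T (fun q => f (p + q))) p /\
  forall v, 'D_v (fun p => T (fun q => f (p + q))) p = T (fun q => 'D_v f (p + q)).
Proof.
move=> sf; have [Tlin [C C0 TC]] := TL.
pose g p := T (fun q => f (p + q)).
pose l (h : plane) := h.1 * T (fun q => 'D_(dir_x R) f (p + q)) +
                      h.2 * T (fun q => 'D_(dir_t R) f (p + q)).
have cs u v : continuous (fun q => 'D_v f (u + q)).
  by apply: smooth_continuous; exact: (smooth_shift u (smooth_derive v sf)).
have lE h : l h = T (fun q => 'D_h f (p + q)).
  have -> : (fun q => 'D_h f (p + q)) = fun q => h.1 * 'D_(dir_x R) f (p + q) +
      (h.2 * 'D_(dir_t R) f (p + q) + cst 0 q).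
    by apply/funext => q; rewrite derive_plane ?addr0//; exact: smooth_differentiable.
  have c0 : continuous (cst 0 : plane -> R) by exact: cst_continuous.
  rewrite Tlin//; last exact: continuous_lin.
  by rewrite Tlin// (box_functional0 TL) addr0.
have llin : linear l.
  move=> a u v; rewrite /l (_ : (a *: u + v).1 = a * u.1 + v.1)//.
  by rewrite (_ : (a *: u + v).2 = a * u.2 + v.2)// /GRing.scale/=; ring.
pose lM := GRing.isLinear.Build _ _ _ _ _ llin.
pose ll : {linear plane -> R} := HB.pack l lM.
have lc : continuous ll.
  suff : continuous l by [].
  move=> h; apply: cvgD; (apply: cvgM; last exact: cvg_cst); [exact: cvg_fst|exact: cvg_snd].
have [M M0 MP] := taylor2_bound (`|p| + L) sf.
have n0 (e : R) : 0 < e -> nbhs (0 : plane) [set h | `|h| <= e].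
  by move=> e0; exact: (@nbhs0_le R plane e e0).
have lo : (g : plane -> R^o) \o shift p = cst (g p) + (ll : plane -> R^o) +o_ (0 : plane) id.
  apply/eqaddoP => _/posnumP[eps].
  have CM1 : 0 < C * M + 1 by apply: ltr_wpDl => //; exact: mulr_ge0.
  have de : 0 < eps%:num / (C * M + 1) by rewrite divr_gt0.
  near=> h.
  have h1 : `|h| <= 1.
    by near: h; exact: n0.
  have he : C * M * `|h| <= eps%:num.
    have : `|h| <= eps%:num / (C * M + 1).
      by near: h; exact: n0.
    by rewrite ler_pdivlMr//; have := normr_ge0 h; lra.
  rewrite /= -[leLHS]/(`|g (h + p) - (g p + l h)|).
  have rE : (fun q => f (p + q + h) - f (p + q) - 'D_h f (p + q)) =
      (fun q => (-1) * 'D_h f (p + q) + ((-1) * f (p + q) + f (h + p + q))).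
    by apply/funext => q; rewrite (_ : p + q + h = h + p + q);
      [ring|rewrite addrC addrA].
  have cf u : continuous (fun q => f (u + q)).
    exact: (smooth_continuous (smooth_shift u sf)).
  have clin := @continuous_lin _ (-1) _ _ (cf p) (cf (h + p)).
  have -> : g (h + p) - (g p + l h) =
      T (fun q => f (p + q + h) - f (p + q) - 'D_h f (p + q)).
    by rewrite lE /g rE !Tlin//; ring.
  apply: le_trans (TC _ (M * `|h| ^+ 2) _ _) _.
  - by rewrite rE; exact: continuous_lin (cs p h) clin.
  - move=> q qL; apply: MP => //; apply: le_trans (ler_normD _ _) _.
    by rewrite lerD2l.
  - by rewrite expr2 !mulrA -(mulrA C M) ler_wpM2r// mulrA.
have dE : 'd g p = ll :> (plane -> R) by exact: diff_unique.
have dg : differentiable g p by apply/diff_locallyP; rewrite dE.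
by split=> // v; rewrite deriveE// dE -lE.
Unshelve. all: by end_near. Qed.

Lemma derive_box_conv v : (fun p => 'D_v (fun p => T (fun q => phi (p + q))) p) =
  fun p => T (fun q => 'D_v phi (p + q)).
Proof. by apply/funext => p; have [_ ->] := conv_is_diff p sphi. Qed.

Lemma smooth_box_conv : smooth (fun p => T (fun q => phi (p + q))).
Proof.
apply: (@smooth_coind _ _ (fun g => exists2 f, smooth f & g = fun p => T (fun q => f (p + q))));
  last by exists phi.
move=> _ [f sf ->]; split=> [p|v]; first by have [] := conv_is_diff p sf.
exists (fun p => 'D_v f p); first exact: smooth_derive.
by apply/funext => p; have [_ ->] := conv_is_diff p sf.
Qed.

End convolution.

End box_functionals.

(** * Measurability of open sets and continuous functions on the plane *)

Section measurability.
Context {R : realType}.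
Local Notation mR := (measurableTypeR R).
Local Notation plane := (R * R)%type.
Implicit Types (A : set plane) (p q : plane).

Let rational_box (i : rat * rat * nat) : set plane :=
  [set p | `|p.1 - ratr i.1.1| < i.2.+1%:R^-1] `&` [set p | `|p.2 - ratr i.1.2| < i.2.+1%:R^-1].

(** The sigma-algebra is the product one; an open set belongs to it as a countable union of boxes
    with rational centres and radii 1/(n + 1). *)
Lemma measurable_open_plane A : open A -> measurable (A : set (mR * mR)).
Proof.
move=> oA.
have m1 (a r : R) : measurable ([set x | `|x - a| < r] : set mR).
  rewrite (_ : [set x | _] = `]a - r, a + r[%classic); first exact: measurable_itv.
  by apply/seteqP; split=> x /=; rewrite in_itv/= ltr_distl.
have mbox i : measurable (rational_box i : set (mR * mR)).
  rewrite (_ : rational_box i = [set x | `|x - ratr i.1.1| < i.2.+1%:R^-1] `*`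
    [set x | `|x - ratr i.1.2| < i.2.+1%:R^-1])//.
  exact: measurableX.
pose F i := if asbool (rational_box i `<=` A) then rational_box i else set0.
have -> : A = \bigcup_i F i.
  apply/seteqP; split=> [p Ap|p [i _]]; last first.
    by rewrite /F; case: ifPn => [/asboolP|_ []]; exact.
  have /nbhs_ballP[e /= e0 eA] : nbhs p A by exact: open_nbhs_nbhs.
  have e20 : 0 < e / 2 by rewrite divr_gt0.
  have [n ne] : exists n : nat, n.+1%:R^-1 < e / 2.
    exists (Num.bound (e / 2)^-1); rewrite invf_plt ?posrE ?ltr0n//.
    apply: lt_trans (archi_boundP _) _; first by rewrite invr_ge0 ltW.
    by rewrite ltr_nat.
  have n0 : 0 < n.+1%:R^-1 :> R by rewrite invr_gt0 ltr0n.
  have near_rat (x : R) : exists a : rat, `|x - ratr a| < n.+1%:R^-1.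
    have [a /andP[xa ax]] : exists a : rat, ratr a \in `]x - n.+1%:R^-1, x + n.+1%:R^-1[.
      by apply: rat_in_itvoo; rewrite ltrBlDr -addrA ltrDl addr_gt0.
    by exists a; rewrite distrC ltr_distl; move: xa ax; rewrite !bnd_simp => -> ->.
  have [a pa] := near_rat p.1; have [b pb] := near_rat p.2.
  exists (a, b, n) => //; rewrite /F asboolT//.
  move=> q /= [qa qb]; apply: eA; rewrite -ball_normE/= prod_normE gt_max.
  have aux (x y z : R) : `|x - z| < n.+1%:R^-1 -> `|y - z| < n.+1%:R^-1 -> `|x - y| < e.
    move=> xz yz; rewrite -(subrKA z); apply: le_lt_trans (ler_normD _ _) _.
    by rewrite [ltRHS]splitr (distrC z); apply: ltrD; exact: lt_trans ne.
  by rewrite /= (aux _ _ _ pa qa) (aux _ _ _ pb qb).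
apply: countable_bigcupT_measurable => // i.
by rewrite /F; case: ifPn.
Qed.

Lemma measurable_continuous_plane (f : plane -> R) : continuous f ->
  measurable_fun setT (f : mR * mR -> R).
Proof.
move=> /continuousP cf; apply: (measurability _ (RGenOpens.measurableE R)).
move=> _ [_ [a [b ->] <-]]; rewrite setTI; apply: measurable_open_plane.
by apply: cf; exact: interval_open.
Qed.

Lemma measurable_closed_plane A : closed A -> measurable (A : set (mR * mR)).
Proof. by move/closed_openC/measurable_open_plane/measurableC; rewrite setCK. Qed.

Lemma lebesgue2_compact_fin A : compact A -> (lebesgue2 R A < +oo)%E.
Proof.
move=> cA; have [M [_ AM]] := compact_bounded cA.
have m0 := measurable_itv (R := R) `[- (`|M| + 1), `|M| + 1].
apply: (@le_lt_trans _ _ (lebesgue2 R (`[- (`|M| + 1), `|M| + 1] `*` `[- (`|M| + 1), `|M| + 1]))).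
  apply: le_measure; rewrite ?inE.
  - apply: measurable_closed_plane; apply: compact_closed cA.
    exact: norm_hausdorff.
  - exact: measurableX.
  - move=> p Ap; have : `|p| <= `|M| + 1.
      by apply: AM => //; rewrite (le_lt_trans (ler_norm _))// ltrDl.
    by rewrite plane_normE /= !in_itv/= !ler_norml => /andP[].
rewrite product_measure1E//= lebesgue_measure_itv/=.
by case: ifP => _; rewrite ?mule0 ?mul0e// -EFinB -EFinM ltry.
Qed.

Lemma integrable_compact_plane (f : plane -> R) A (M : R) : compact A ->
  measurable_fun A (f : mR * mR -> R) -> (forall p, A p -> `|f p| <= M) ->
  (lebesgue2 R).-integrable A (EFin \o f).
Proof.
move=> cA mf fM; apply: measurable_bounded_integrable => //.
- by apply: measurable_closed_plane; apply: compact_closed cA; exact: norm_hausdorff.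
- exact: lebesgue2_compact_fin.
- exists M; split; rewrite ?num_real// => x Mx p Ap.
  exact: le_trans (fM p Ap) (ltW Mx).
Qed.

End measurability.

Fact vertical_conv_key : unit. Proof. by []. Qed.

Section integral_functionals.
Context {R : realType}.
Local Notation plane := (R * R)%type.
Local Notation mR := (measurableTypeR R).
Local Notation mu := (@lebesgue_measure R).
Implicit Types (f phi : plane -> R) (p q v : plane) (L M : R).

Lemma normr_Rintegral_le d (X : measurableType d) (nu : {measure set X -> \bar R})
    (B : set X) (f : X -> R) M : measurable B -> (nu B < +oo)%E ->
  nu.-integrable B (EFin \o f) -> (forall x, B x -> `|f x| <= M) ->
  `|\int[nu]_(x in B) f x| <= M * fine (nu B).
Proof.
move=> mB nuB int fM; apply: le_trans (le_normr_Rintegral mB int) _.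
rewrite -Rintegral_cst//; apply: le_Rintegral => //.
  have := int => /integrable_norm.
  by congr (_.-integrable); apply/funext => x.
by apply: measurable_bounded_integrable => //; exact: bounded_cst.
Qed.

Lemma box_functional_integral d (X : measurableType d) (nu : {measure set X -> \bar R})
    (B : set X) (k : X -> R) (i : X -> plane) (L : R) :
  measurable B -> (nu B < +oo)%E -> measurable_fun B k ->
  (exists M : R, forall x, B x -> `|k x| <= M) ->
  (forall f, continuous f -> measurable_fun B (f \o i)) ->
  (forall x, B x -> `|i x| <= L) ->
  box_functional L (fun f => \int[nu]_(x in B) (k x * f (i x))).
Proof.
move=> mB nuB mk [M kM] mi iL.
have M0 x : B x -> 0 <= M by move=> Bx; exact: le_trans (kM x Bx).
have int f : continuous f -> nu.-integrable B (EFin \o (fun x => k x * f (i x))).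
  move=> cf; have [N N0 fN] := bounded_box L cf.
  apply: measurable_bounded_integrable => //.
    by apply: measurable_funM => //; exact: mi.
  exists (M * N); split; rewrite ?num_real// => y My x Bx.
  apply: le_trans (ltW My); rewrite normrM; apply: ler_pM => //; first exact: kM.
  by apply: fN; exact: iL.
split=> [c f g cf cg|].
  rewrite -RintegralZl//; last exact: int.
  rewrite -RintegralD//; last exact: int.
    by apply: eq_Rintegral => x _; ring.
  rewrite (_ : _ \o _ = EFin \o (fun x => k x * (c * f (i x)))); last first.
    by apply/funext => x /=; congr EFin; ring.
  apply: (int (fun p => c * f p)) => p.
  by apply: cvgM; [exact: cvg_cst|exact: cf].
exists (`|M| * fine (nu B)); first by rewrite mulr_ge0// fine_ge0.
move=> f N cf fN; rewrite mulrAC; apply: (normr_Rintegral_le mB nuB (int f cf)) => x Bx.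
rewrite normrM; apply: ler_pM => //; first exact: le_trans (kM x Bx) (ler_norm _).
by apply: fN; exact: iL.
Qed.

Lemma segment_finite (a b : R) : (mu `[a, b] < +oo)%E.
Proof. by rewrite lebesgue_measure_itv/=; case: ifP => _; rewrite -?EFinB ltry. Qed.

Lemma continuous_integrable (f : R -> R) a b : continuous f ->
  mu.-integrable `[a, b] (EFin \o f).
Proof.
move=> cf; apply: continuous_compact_integrable; first exact: segment_compact.
exact: continuous_subspaceT.
Qed.

Lemma Rintegral_bound (g : R -> R) L M : 0 <= L -> continuous g ->
  (forall u, 0 <= u <= L -> `|g u| <= M) -> `|\int[mu]_(u in `[0, L]) g u| <= L * M.
Proof.
move=> L0 cg gM.
have muL : fine (mu `[0, L]) = L.
  rewrite lebesgue_measure_itv/= lte_fin; case: ltP => [_|L0'].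
    by rewrite -EFinB /= subr0.
  by rewrite /=; apply/eqP; rewrite eq_le L0 L0'.
rewrite mulrC -[X in _ * X]muL; apply: normr_Rintegral_le => //.
- exact: segment_finite.
- exact: continuous_integrable.
Qed.

Lemma Rintegral_FTC (F f : R -> R) (a b : R) : a <= b -> continuous f ->
  (forall x : R, is_derive x (1 : R) F (f x)) ->
  \int[mu]_(x in `[a, b]) f x = F b - F a.
Proof.
rewrite le_eqVlt => /predU1P[<- cf dF|ab cf dF].
  by rewrite set_itv1 Rintegral_set1 subrr.
have cF : continuous F.
  by move=> x; apply: differentiable_continuous; apply/derivable1_diffP; have [] := dF x.
rewrite /Rintegral (@continuous_FTC2 _ _ F)//=.
- exact: continuous_subspaceT.
- split=> [x _||]; first by have [] := dF x.
    exact: cvg_at_right_filter (cF a).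
  exact: cvg_at_left_filter (cF b).
- by move=> x _; rewrite derive1E; have [] := dF x.
Qed.

(** By Cauchy's formula this is the kernel of the (n + 1)-fold iterated integral, which makes each
    iterated primitive a single integral. *)
Definition divided_power n (r : R) : R := r ^+ n / n`!%:R.

Lemma is_derive_divided_power n (r : R) :
  is_derive r (1 : R) (divided_power n.+1) (divided_power n r).
Proof.
have -> : divided_power n.+1 = horner ((n.+1`!%:R^-1 : R) *: 'X^(n.+1)).
  by apply/funext => y; rewrite hornerZ hornerXn mulrC.
apply: is_derive_eq; rewrite derivZ derivXn hornerZ hornerMn hornerXn /divided_power.
have k0 : n`!%:R != 0 :> R by rewrite pnatr_eq0 -lt0n fact_gt0.
have k1 : n.+1%:R != 0 :> R by rewrite pnatr_eq0.
by rewrite factS natrM -mulr_natr /=; field; rewrite k0 nat1r k1.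
Qed.

Lemma continuous_divided_power n : continuous (divided_power n).
Proof.
have -> : divided_power n = horner ((n`!%:R^-1 : R) *: 'X^n).
  by apply/funext => y; rewrite hornerZ hornerXn mulrC.
exact: continuous_horner.
Qed.

Lemma divided_power_ge0 n r : 0 <= r -> 0 <= divided_power n r.
Proof. by move=> r0; rewrite /divided_power divr_ge0// exprn_ge0. Qed.

Lemma divided_power_le n (r s : R) : 0 <= r <= s -> divided_power n r <= divided_power n s.
Proof.
move=> /andP[r0 rs]; rewrite ler_wpM2r ?invr_ge0// lerXn2r ?nnegrE//.
exact: le_trans rs.
Qed.

(** One term of the exponential series at 2 z; the factor 2^n is the origin of the errors C /
    2^N. *)
Lemma divided_power_bound n (z : R) : 0 <= z -> divided_power n z * 2 ^+ n <= expR (2 * z).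
Proof.
move=> z0; case: n => [|n].
  rewrite /divided_power !expr0 fact0 divr1 mulr1 -expR0 ler_expR.
  exact: mulr_ge0.
apply: le_trans (expR_ge1Dxn n (mulr_ge0 (ler0n R 2) z0)).
rewrite exprMn (_ : divided_power _ _ * _ = 2 ^+ n.+1 * z ^+ n.+1 / n.+1`!%:R).
  by rewrite lerDr.
by rewrite /divided_power mulrC mulrA.
Qed.

Definition vertical (r : R) : plane := (0, r).

Lemma continuous_vertical f p : continuous f -> continuous (fun r => f (p + vertical r)).
Proof.
move=> cf r; pose A (r : R) := (p.1 + 0 * r, p.2 + 1 * r).
have dA : differentiable A r by have [] := is_diff_affine_line p.1 0 p.2 1 r.
have AE : (fun r => f (p + vertical r)) = f \o A.
  by apply/funext => y; rewrite /A /= mul0r mul1r; congr f; rewrite [LHS]surjective_pairing.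
rewrite AE; apply: continuous_comp; last exact: cf.
exact: differentiable_continuous dA.
Qed.

Let vertical_functional (k : R -> R) L : continuous k ->
  box_functional `|L| (fun f => \int[mu]_(r in `[0, L]) (k r * f (vertical r))).
Proof.
move=> ck; apply: box_functional_integral => //.
- exact: segment_finite.
- by apply: measurable_funTS; exact: continuous_measurable_fun.
- have [M _ kM] := bounded_segment 0 L ck.
  by exists M => x; rewrite /= in_itv/=; exact: kM.
- move=> f cf; apply: measurable_funTS; apply: continuous_measurable_fun => r.
  have := @continuous_vertical f 0 cf r.
  by rewrite (_ : (fun r => _) = f \o vertical)//; apply/funext => y; rewrite add0r.
- move=> r; rewrite /= in_itv/= => /andP[r0 rL].
  by rewrite plane_normE normr0 normr_ge0 ler_norml (le_trans _ r0) ?oppr_le0//=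
    (le_trans rL) ?ler_norm.
Qed.

(* Integration over upward vertical segments of length L. On functions that
   vanish for large t, [primitive L n phi] is the n-th iterated integral
   [I^n phi], where [I phi (x, t)] is the integral of [phi (x, _)] over
   [t, +oo[. *)
Definition vertical_conv (k : R -> R) L f p : R :=
  locked_with vertical_conv_key (\int[mu]_(r in `[0, L]) (k r * f (p + vertical r))).

Lemma vertical_conv_unlock k L f : vertical_conv k L f =
  fun p => \int[mu]_(r in `[0, L]) (k r * f (p + vertical r)).
Proof. by apply/funext => p; rewrite /vertical_conv unlock. Qed.

Lemma vertical_convE k L phi : continuous k -> smooth phi ->
  smooth (vertical_conv k L phi) /\
  forall v, (fun p => 'D_v (vertical_conv k L phi) p) =
            vertical_conv k L (fun p => 'D_v phi p).
Proof.
move=> ck sphi; have TL := vertical_functional L ck.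
rewrite vertical_conv_unlock.
by split=> [|v]; [exact: smooth_box_conv TL sphi|
  rewrite vertical_conv_unlock; exact: derive_box_conv TL sphi v].
Qed.

Lemma vertical_conv_lin k L (c : R) f g p : continuous k -> smooth f -> smooth g ->
  vertical_conv k L (fun p => c * f p + g p) p =
  c * vertical_conv k L f p + vertical_conv k L g p.
Proof.
move=> ck sf sg; have [Tlin _] := vertical_functional L ck; rewrite !vertical_conv_unlock.
by apply: (Tlin c (fun q => f (p + q)) (fun q => g (p + q)));
  apply: smooth_continuous; exact: smooth_shift.
Qed.

Lemma is_derive_vertical phi p (r : R) : smooth phi ->
  is_derive r (1 : R) (fun r => phi (p + vertical r)) ('D_(dir_t R) phi (p + vertical r)).
Proof.
move=> sphi; pose A (r : R) := (p.1 + 0 * r, p.2 + 1 * r).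
have AE r' : A r' = p + vertical r' by rewrite /A mul0r mul1r [RHS]surjective_pairing.
have dA (t : R) : is_diff t A (fun y => (0 * y, 1 * y)) by exact: is_diff_affine_line.
have := smooth_is_derive r (1 : R) (smooth_affine dA sphi).
rewrite (derive_affine dA); last exact: smooth_differentiable.
rewrite AE mul0r mulr1 (_ : phi \o A = fun r => phi (p + vertical r))//.
by apply/funext => y /=; rewrite AE.
Qed.

Definition primitive L n phi :=
  if n is m.+1 then vertical_conv (divided_power m) L phi else phi.

Lemma smooth_primitive L n phi : smooth phi -> smooth (primitive L n phi).
Proof.
move=> sphi; case: n => // n.
by have [] := vertical_convE L (@continuous_divided_power n) sphi.
Qed.

Lemma derive_primitive L n phi v : smooth phi ->
  (fun p => 'D_v (primitive L n phi) p) = primitive L n (fun p => 'D_v phi p).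
Proof.
move=> sphi; case: n => // n.
by have [_ ->] := vertical_convE L (@continuous_divided_power n) sphi.
Qed.

Lemma primitive_lin L n (c : R) f g p : smooth f -> smooth g ->
  primitive L n (fun p => c * f p + g p) p = c * primitive L n f p + primitive L n g p.
Proof.
move=> sf sg; case: n => // n.
exact: (vertical_conv_lin _ _ _ (@continuous_divided_power n)).
Qed.

(** Integration by parts: [phi] vanishes at the upper end and the positive power of r at the lower
    one. For n = 0 the fundamental theorem alone leaves - phi p. *)
Lemma primitive_dt L n phi p : 0 <= L -> smooth phi -> phi (p + vertical L) = 0 ->
  primitive L n.+1 (fun q => 'D_(dir_t R) phi q) p = - primitive L n phi p.
Proof.
move=> L0 sphi phiL; have cD : continuous (fun r => 'D_(dir_t R) phi (p + vertical r)).
  by apply: (@continuous_vertical (fun q => 'D_(dir_t R) phi q));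
    apply: smooth_continuous; exact: smooth_derive.
have cphi : continuous (fun r => phi (p + vertical r)).
  by apply: continuous_vertical; exact: smooth_continuous.
case: n => [|n] /=; rewrite !vertical_conv_unlock.
  transitivity (\int[mu]_(r in `[0, L]) 'D_(dir_t R) phi (p + vertical r)).
    by apply: eq_Rintegral => r _; rewrite /divided_power expr0 fact0 divr1 mul1r.
  rewrite (Rintegral_FTC L0 cD (fun r => is_derive_vertical p r sphi)) phiL.
  by rewrite sub0r (_ : p + vertical 0 = p)//; exact: addr0.
pose F r := divided_power n.+1 r * phi (p + vertical r).
pose f r := divided_power n.+1 r * 'D_(dir_t R) phi (p + vertical r) +
            divided_power n r * phi (p + vertical r).
have cM (g h : R -> R) : continuous g -> continuous h -> continuous (fun r => g r * h r).
  by move=> cg ch r; apply: cvgM; [exact: cg|exact: ch].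
have cf1 := cM _ _ (@continuous_divided_power n.+1) cD.
have cf2 := cM _ _ (@continuous_divided_power n) cphi.
have cf : continuous f by move=> r; apply: cvgD; [exact: cf1|exact: cf2].
have dF (r : R) : is_derive r (1 : R) F (f r).
  apply: is_derive_eq (is_deriveM (is_derive_divided_power n r) (is_derive_vertical p r sphi)) _.
  by rewrite /GRing.scale/= /f (mulrC (phi _)).
have := Rintegral_FTC L0 cf dF; rewrite /F phiL mulr0 /divided_power expr0n mul0r mul0r subrr.
rewrite RintegralD//; [|exact: continuous_integrable cf1|exact: continuous_integrable cf2].
by move/eqP; rewrite addr_eq0 => /eqP.
Qed.

Lemma primitive_bound L n phi p M : 0 <= L -> smooth phi ->
  (forall r, 0 <= r <= L -> `|phi (p + vertical r)| <= M) ->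
  `|primitive L n.+1 phi p| <= M * L * divided_power n L.
Proof.
move=> L0 sphi phiM; rewrite /= vertical_conv_unlock.
have cphi : continuous (fun r => phi (p + vertical r)).
  by apply: continuous_vertical; exact: smooth_continuous.
have ci : continuous (fun r => divided_power n r * phi (p + vertical r)).
  by move=> r; apply: cvgM; [exact: continuous_divided_power|exact: cphi].
rewrite (_ : M * L * _ = L * (divided_power n L * M)); last by ring.
apply: Rintegral_bound => // r rL; rewrite normrM; apply: ler_pM => //; last exact: phiM.
rewrite ger0_norm ?divided_power_le//.
by apply: divided_power_ge0; case/andP: rL.
Qed.

End integral_functionals.

(** * The adjoint equation along a characteristic *)

Lemma continuous_sum_ord (R : realType) (X : topologicalType) (F : nat -> X -> R) N :
  (forall n, continuous (F n)) -> continuous (fun x => \sum_(n < N) F n x).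
Proof.
move=> cF; elim: N => [|N IH].
  rewrite (_ : (fun x => _) = cst 0); first exact: cst_continuous.
  by apply/funext => x; rewrite big_ord0.
rewrite (_ : (fun x => _) = fun x => \sum_(n < N) F n x + F N x); last first.
  by apply/funext => x; rewrite big_ord_recr.
by move=> x; apply: cvgD; [exact: IH|exact: cF].
Qed.

Fact partial_key : unit. Proof. by []. Qed.

(* Sealed, because unification would otherwise unfold derivatives of different
   functions into limits. *)
Definition partial_x (R : realType) (phi : R * R -> R) (p : R * R) : R :=
  locked_with partial_key ('D_(dir_x R) phi p).

Definition partial_s (R : realType) (phi : R * R -> R) (p : R * R) : R :=
  locked_with partial_key (- 'D_(dir_t R) phi p).

Lemma partial_xE (R : realType) (phi : R * R -> R) :
  partial_x phi = fun p => 'D_(dir_x R) phi p.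
Proof. by apply/funext => p; rewrite /partial_x unlock. Qed.

Lemma partial_sE (R : realType) (phi : R * R -> R) :
  partial_s phi = fun p => - 'D_(dir_t R) phi p.
Proof. by apply/funext => p; rewrite /partial_s unlock. Qed.

Section characteristic_identity.
Context {R : realType}.
Local Notation plane := (R * R)%type.
Local Notation mu := (@lebesgue_measure R).
Variable tau : R.
Hypotheses (tau_gt0 : 0 < tau) (tau_lt1 : tau < 1).
Implicit Types (f phi : plane -> R) (p q v : plane).
Let sigma : R := Num.sqrt tau.
Local Notation Dx := (@partial_x R).
Local Notation s := (@partial_s R).

Lemma open_upper_half_plane (l : R) : open [set q : plane | l < q.2].
Proof.
rewrite (_ : [set q : plane | _] = snd @^-1` [set x | l < x])//.
have csnd : continuous (snd : plane -> R) by move=> q; exact: cvg_snd.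
by move/continuousP : csnd; apply; exact: open_gt.
Qed.

Definition vanishes_above (l : R) phi := forall p, l < p.2 -> phi p = 0.

Lemma vanishes_above_derive l phi v : vanishes_above l phi ->
  vanishes_above l (fun p => 'D_v phi p).
Proof.
move=> phi0 p lp; have /derive_loceq -> : \near p, phi p = cst 0 p.
  have : open_nbhs p [set q : plane | l < q.2].
    by split=> //; exact: open_upper_half_plane.
  by move=> /open_nbhs_nbhs; apply: filterS => q /= lq; exact: phi0.
by rewrite derive_cst.
Qed.

(* The adjoint of the operator of the Zener equation, multiplied by
   [1 + tau s]; here [s] is [- d/dt]. *)
Definition zener_adjoint phi p :=
  s (s phi) p + tau * s (s (s phi)) p - Dx (Dx (fun q => phi q + s phi q)) p.

Lemma smooth_partial_x phi : smooth phi -> smooth (partial_x phi).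
Proof. by move=> sp; rewrite partial_xE; exact: smooth_derive. Qed.

Lemma smooth_partial_s phi : smooth phi -> smooth (partial_s phi).
Proof. by move=> sp; rewrite partial_sE; apply: smoothN; exact: smooth_derive. Qed.

Lemma smooth_zener_adjoint phi : smooth phi -> smooth (zener_adjoint phi).
Proof.
move=> s0; have s1 := smooth_partial_s s0; have s2 := smooth_partial_s s1.
have s3 := smooth_partial_s s2.
apply: (smoothB (smoothD s2 (smoothZ tau s3))).
by do 2!apply: smooth_partial_x; exact: smoothD.
Qed.

Lemma vanishes_above_partial_x l phi : vanishes_above l phi -> vanishes_above l (partial_x phi).
Proof. by move=> v; rewrite partial_xE; exact: vanishes_above_derive. Qed.

Lemma vanishes_above_partial_s l phi : vanishes_above l phi -> vanishes_above l (partial_s phi).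
Proof.
by move=> v p lp; rewrite partial_sE (vanishes_above_derive (dir_t R) v lp) oppr0.
Qed.

Lemma vanishes_above_zener_adjoint l phi :
  vanishes_above l phi -> vanishes_above l (zener_adjoint phi).
Proof.
move=> v0; have v1 := vanishes_above_partial_s v0; have v2 := vanishes_above_partial_s v1.
have v3 := vanishes_above_partial_s v2.
have vD : vanishes_above l (fun q => phi q + partial_s phi q).
  by move=> p lp; rewrite v0// v1// addr0.
move=> p lp; rewrite /zener_adjoint v2// v3//.
have -> := vanishes_above_partial_x (vanishes_above_partial_x vD) lp.
by rewrite mulr0 addr0 subr0.
Qed.

Variables (l L : R) (h : plane -> R).
Hypotheses (l0 : 0 <= l) (lL : l < L) (lsL : l < sigma * L).
Hypotheses (sh : smooth h) (h0 : vanishes_above l h).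

Let L0 : 0 <= L. Proof. by apply: ltW; exact: le_lt_trans lL. Qed.
Let P n phi := primitive L n phi.
Let w p := h p + s h p.
Let k := s (s (s h)).
(** Orders are counted from s^3 h, the highest one in the adjoint: I^n of s^2 h, s h and h is then
    [J] at n + 1, n + 2 and n + 3. *)
Let J n p := P n k p.

Let good phi := smooth phi /\ vanishes_above l phi.

Let good_s phi : good phi -> good (s phi).
Proof.
by move=> [sp vp]; split; [exact: smooth_partial_s|exact: vanishes_above_partial_s].
Qed.

Let good_Dx phi : good phi -> good (Dx phi).
Proof.
by move=> [sp vp]; split; [exact: smooth_partial_x|exact: vanishes_above_partial_x].
Qed.

Let good_h : good h. Proof. by []. Qed.

Let good_w : good w.
Proof.
have [s1 v1] := good_h; have [s2 v2] := good_s good_h.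
by split=> [|p lp]; [exact: smoothD|rewrite /w v1 ?v2 ?addr0].
Qed.

Let PD n phi psi p : smooth phi -> smooth psi ->
  P n (fun p => phi p + psi p) p = P n phi p + P n psi p.
Proof.
move=> s1 s2; rewrite -[P n phi p]mul1r -(primitive_lin L n 1 p s1 s2).
by congr (P n _ p); apply/funext => q; rewrite mul1r.
Qed.

Let PZ n (c : R) phi p : smooth phi -> P n (fun p => c * phi p) p = c * P n phi p.
Proof.
move=> s1; have s0 : smooth (cst 0 : plane -> R) by exact: smooth_cst.
have P0 : P n (cst 0) p = 0.
  have := primitive_lin L n (-1) p s0 s0; rewrite mulN1r addNr => e.
  by rewrite -[RHS]e; congr (P n _ p); apply/funext => q; rewrite /cst mulr0 addr0.
rewrite -[RHS]addr0 -P0 -(primitive_lin L n c p s1 s0).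
by congr (P n _ p); apply/funext => q; rewrite /cst addr0.
Qed.

(** Here I s = 1: a vertical segment of length L starting above l - L ends where [phi] vanishes. *)
Let Ps n phi p : good phi -> l - L < p.2 -> P n.+1 (s phi) p = P n phi p.
Proof.
move=> [sp vp] lp; rewrite partial_sE.
rewrite (_ : (fun q => _) = fun q => (-1) * 'D_(dir_t R) phi q); last first.
  by apply/funext => q; rewrite mulN1r.
rewrite (PZ n.+1 (-1) p (smooth_derive _ sp)) /P (primitive_dt n L0 sp).
  by rewrite mulN1r opprK.
by apply: vp; rewrite /= -ltrBlDr.
Qed.

Let Px n phi : smooth phi -> Dx (P n phi) = P n (Dx phi).
Proof. by move=> sp; rewrite !partial_xE; exact: derive_primitive. Qed.

Let Pt n phi : smooth phi -> (fun p => 'D_(dir_t R) (P n phi) p) = fun p => - P n (s phi) p.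
Proof.
move=> sp; rewrite [LHS](derive_primitive L n (dir_t R) sp) partial_sE.
apply/funext => p; rewrite (_ : (fun q => - _) = fun q => (-1) * 'D_(dir_t R) phi q).
  by rewrite (PZ n (-1) p (smooth_derive _ sp)) mulN1r opprK.
by apply/funext => q; rewrite mulN1r.
Qed.

(* Both sides are d/dx (I^n phi); this replaces the symmetry of second
   derivatives. *)
Let Pcomm n phi p : good phi -> l - L < p.2 -> P n.+1 (Dx (s phi)) p = P n.+1 (s (Dx phi)) p.
Proof.
move=> gp lp; have [sp _] := gp; have [ssp _] := good_s gp.
rewrite (Ps n (good_Dx gp) lp) -(Px n.+1 ssp) -(Px n sp) !partial_xE.
have oU : open [set q : plane | l - L < q.2] by exact: open_upper_half_plane.
have e : {in [set q : plane | l - L < q.2], P n.+1 (s phi) =1 P n phi}.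
  by move=> q; rewrite inE => lq; exact: Ps.
by have := derive_open_eq (dir_x R) oU e; apply; rewrite inE.
Qed.

Let P_h2 n p : l - L < p.2 -> P n (s (s h)) p = J n.+1 p.
Proof. by move=> lp; rewrite -Ps//; do 2!apply: good_s. Qed.

Let P_h1 n p : l - L < p.2 -> P n (s h) p = J n.+2 p.
Proof. by move=> lp; rewrite -Ps ?P_h2//; exact: good_s. Qed.

Let P_h n p : l - L < p.2 -> P n h p = J n.+3 p.
Proof. by move=> lp; rewrite -Ps ?P_h1. Qed.

Let P_adjoint n p : l - L < p.2 ->
  P n (zener_adjoint h) p = J n.+1 p + tau * J n p - P n (Dx (Dx w)) p.
Proof.
move=> lp; rewrite (_ : zener_adjoint h = fun p => s (s h) p + (tau * k p + (-1) * Dx (Dx w) p));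
  last by apply/funext => q; rewrite mulN1r addrA.
have g2 := good_s (good_s good_h); have [sk _] := good_s g2.
have [s2 _] := g2; have [sw _] := good_w.
have sD := smooth_partial_x (smooth_partial_x sw).
have sk' := smoothZ tau sk; have sD' := smoothZ (-1) sD.
rewrite (PD n p s2 (smoothD sk' sD')) (PD n p sk' sD').
by rewrite (P_h2 n lp) (PZ n tau p sk) (PZ n (-1) p sD) mulN1r addrA.
Qed.

Let P_w n p : l - L < p.2 -> P n w p = J n.+2 p + J n.+3 p.
Proof.
move=> lp; have [s1 _] := good_s good_h.
by rewrite (PD n p sh s1) (P_h n lp) (P_h1 n lp) addrC.
Qed.

Let P_sw n p : l - L < p.2 -> P n.+1 (s w) p = J n.+2 p + J n.+3 p.
Proof. by move=> lp; rewrite (Ps n good_w lp) (P_w n lp). Qed.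

Let P_ssw n p : l - L < p.2 -> P n.+1 (s (s w)) p = J n.+1 p + J n.+2 p.
Proof.
move=> lp; have [s1 v1] := good_s good_h; have [s2 v2] := good_s (good_s good_h).
have -> : s w = fun q => s h q + s (s h) q.
  apply/funext => q; rewrite ![s _ q](congr1 (fun f => f q) (partial_sE _)).
  by rewrite -opprD (congr1 (fun f => f q) (derive_addf _ sh s1)).
have g : good (fun q => s h q + s (s h) q).
  split; first exact: (smoothD s1 s2).
  by move=> q lq; rewrite (v1 _ lq) (v2 _ lq) addr0.
by rewrite (Ps n g lp) (PD n p s1 s2) (P_h1 n lp) (P_h2 n lp) addrC.
Qed.

Definition characteristic_sum N eps :=
  \int[mu]_(u in `[0, L]) (\sum_(n < N) (zener_coef tau n u *
    primitive L n.+1 (zener_adjoint h) (eps * u, sigma * u))).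

Section curve.
Variable eps : R.
Hypothesis eps2 : eps * eps = 1.
Let gam (u : R) : plane := (eps * u, sigma * u).
Let q := zener_coef tau.
Let q1 := zener_coef1 tau.
Let q2 := zener_coef2 tau.

Let lgam u : 0 <= u -> l - L < (gam u).2.
Proof.
move=> u0; rewrite /gam/=; apply: (@lt_le_trans _ _ 0); first by rewrite subr_lt0.
by rewrite mulr_ge0// sqrtr_ge0.
Qed.

Let d_gam phi (u : R) : smooth phi -> is_derive u (1 : R) (fun u => phi (gam u))
  (eps * 'D_(dir_x R) phi (gam u) + sigma * 'D_(dir_t R) phi (gam u)).
Proof.
move=> sphi; pose A (r : R) := (0 + eps * r, 0 + sigma * r).
have AE r : A r = gam r by rewrite /A !add0r.
have dA (t : R) : is_diff t A (fun y => (eps * y, sigma * y)) by exact: is_diff_affine_line.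
have := smooth_is_derive u (1 : R) (smooth_affine dA sphi).
rewrite (derive_affine dA); last exact: smooth_differentiable.
rewrite derive_plane ?AE; last exact: smooth_differentiable.
rewrite /= !mulr1 (_ : phi \o A = fun r => phi (gam r))//.
by apply/funext => y /=; rewrite AE.
Qed.

Let d_P n phi (u : R) : smooth phi -> is_derive u (1 : R) (fun u => P n phi (gam u))
  (eps * P n (Dx phi) (gam u) - sigma * P n (s phi) (gam u)).
Proof.
move=> sphi; have := d_gam u (smooth_primitive L n sphi).
by rewrite (congr1 (fun f => f (gam u)) (Pt n sphi)) mulrN -(Px n sphi) partial_xE.
Qed.

Let c_P n phi : smooth phi -> continuous (fun u => P n phi (gam u)).
Proof.
move=> sphi u; apply: differentiable_continuous; apply/derivable1_diffP.
by have [] := d_P n u sphi.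
Qed.

Let c_q n : continuous (q n).
Proof.
move=> u; apply: differentiable_continuous; apply/derivable1_diffP.
by have [] := is_derive_zener_coef tau n u.
Qed.

Let c_q1 n : continuous (q1 n).
Proof.
move=> u; apply: differentiable_continuous; apply/derivable1_diffP.
by have [] := is_derive_zener_coef1 tau n u.
Qed.

Let c_q2 n : continuous (q2 n).
Proof.
apply: (@continuous_sum_ord _ _ (fun j u => q1 j u * zener_memory tau (n - j))) => j u.
by apply: cvgM; [exact: c_q1|exact: cvg_cst].
Qed.

(** A potential for the integrand. Along [gam], d/du acts as eps Dx - sigma s, and (eps Dx - sigma
    s)(eps Dx + sigma s) = Dx^2 - tau s^2 is the wave operator with the speed of the front; the [q1]
    term accounts for the dependence of [q] on u. *)
Let Pi N u := \sum_(n < N) (q n u * (eps * P n.+1 (Dx w) (gam u) + sigma * P n.+1 (s w) (gam u))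
  + sigma * (q1 n u * P n.+1 w (gam u))).

Let dPi_term n u :=
  (q n u * (eps * (eps * P n.+1 (Dx (Dx w)) (gam u) - sigma * P n.+1 (s (Dx w)) (gam u))
     + sigma * (eps * P n.+1 (Dx (s w)) (gam u) - sigma * P n.+1 (s (s w)) (gam u)))
   - sigma * q1 n u * (eps * P n.+1 (Dx w) (gam u) + sigma * P n.+1 (s w) (gam u)))
  + sigma * (q1 n u * (eps * P n.+1 (Dx w) (gam u) - sigma * P n.+1 (s w) (gam u))
     - sigma * q2 n u * P n.+1 w (gam u)).

Let sw_ : smooth w. Proof. by have [] := good_w. Qed.
Let sDw : smooth (Dx w). Proof. exact: smooth_partial_x sw_. Qed.
Let ssw : smooth (s w). Proof. by have [] := good_s good_w. Qed.

Let d_Pi N (u : R) : is_derive u (1 : R) (Pi N) (\sum_(n < N) dPi_term n u).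
Proof.
pose F n u := q n u * (eps * P n.+1 (Dx w) (gam u) + sigma * P n.+1 (s w) (gam u))
  + sigma * (q1 n u * P n.+1 w (gam u)).
have -> : Pi N = \sum_(n < N) F n by rewrite fct_sumE.
apply: (@is_derive_sum _ _ _ N (fun n : 'I_N => F n) u 1 (fun n : 'I_N => dPi_term n u)) => n.
have a1 := is_deriveD (is_deriveZ eps (d_P n.+1 u sDw)) (is_deriveZ sigma (d_P n.+1 u ssw)).
have a2 := is_deriveM (is_derive_zener_coef tau n u) a1.
have a3 := is_deriveZ sigma (is_deriveM (is_derive_zener_coef1 tau n u) (d_P n.+1 u sw_)).
apply: is_derive_eq (is_deriveD a2 a3) _.
rewrite /GRing.scale/= /dPi_term.
have -> : (eps \*: (fun u0 : R => vertical_conv (divided_power n) L (Dx w) (gam u0)) +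
  sigma \*: (fun u0 : R => vertical_conv (divided_power n) L (s w) (gam u0))) u =
  eps * P n.+1 (Dx w) (gam u) + sigma * P n.+1 (s w) (gam u) by [].
have alg (Q Q1 Q2 A1 A2 A3 A4 B1 B2 W : R) :
  Q * (eps * (eps * A1 - sigma * A2) + sigma * (eps * A3 - sigma * A4)) +
  (eps * B1 + sigma * B2) * (- sigma * Q1) +
  sigma * (Q1 * (eps * B1 - sigma * B2) + W * (- sigma * Q2)) =
  Q * (eps * (eps * A1 - sigma * A2) + sigma * (eps * A3 - sigma * A4)) -
  sigma * Q1 * (eps * B1 + sigma * B2) +
  sigma * (Q1 * (eps * B1 - sigma * B2) - sigma * Q2 * W) by ring.
exact: alg.
Qed.

Let c_dPi N : continuous (fun u => \sum_(n < N) dPi_term n u).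
Proof.
apply: continuous_sum_ord => n.
have [sDDw ssDw] := (smooth_partial_x sDw, (good_s (good_Dx good_w)).1).
have [sDsw sssw] := (smooth_partial_x ssw, (good_s (good_s good_w)).1).
have gen (Q Q1 Q2 A B C D X T W : R -> R) : continuous Q -> continuous Q1 -> continuous Q2 ->
    continuous A -> continuous B -> continuous C -> continuous D -> continuous X -> continuous T ->
    continuous W -> continuous (fun u => (Q u * (eps * (eps * A u - sigma * B u) +
      sigma * (eps * C u - sigma * D u)) - sigma * Q1 u * (eps * X u + sigma * T u)) +
      sigma * (Q1 u * (eps * X u - sigma * T u) - sigma * Q2 u * W u)).
  move=> ? ? ? ? ? ? ? ? ? ? u.
  by repeat first [apply: cvgB | apply: cvgD | apply: cvgM | exact: cvg_cst
    | match goal with H : continuous _ |- _ => exact: (H u) end].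
exact: gen (@c_q n) (@c_q1 n) (@c_q2 n) (@c_P n.+1 _ sDDw) (@c_P n.+1 _ ssDw)
  (@c_P n.+1 _ sDsw) (@c_P n.+1 _ sssw) (@c_P n.+1 _ sDw) (@c_P n.+1 _ ssw) (@c_P n.+1 _ sw_).
Qed.

Let sigma2 : sigma * sigma = tau.
Proof. by rewrite -expr2 sqr_sqrtr// ltW. Qed.

(** Once the cross terms cancel by [Pcomm], the derivative is q Dx^2 W - tau (q s^2 + 2 q1 s + q2) W
    with W = I^(n+1) w. The first part is traded for the adjoint; the rest becomes the summand of
    [zener_coef_telescope]. *)
Let dPi_termE n u : 0 <= u -> dPi_term n u = - (q n u * P n.+1 (zener_adjoint h) (gam u)) -
  (tau * (q n u * (J n.+1 (gam u) + J n.+2 (gam u)) + 2 * q1 n u * (J n.+2 (gam u) + J n.+3 (gam u))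
    + q2 n u * (J n.+3 (gam u) + J n.+4 (gam u))) - q n u * (tau * J n.+1 (gam u) + J n.+2 (gam u))).
Proof.
move=> u0; have lu := lgam u0.
rewrite /dPi_term (Pcomm n good_w lu) (P_adjoint n.+1 lu) (P_w n.+1 lu) (P_sw n lu) (P_ssw n lu).
have alg (Q Q1 Q2 A B J1 J2 J3 J4 : R) :
  Q * (eps * (eps * A - sigma * B) + sigma * (eps * B - sigma * (J1 + J2))) -
  sigma * Q1 * (eps * P n.+1 (Dx w) (gam u) + sigma * (J2 + J3)) +
  sigma * (Q1 * (eps * P n.+1 (Dx w) (gam u) - sigma * (J2 + J3)) - sigma * Q2 * (J3 + J4)) =
  - (Q * (J2 + tau * J1 - A)) -
  (tau * (Q * (J1 + J2) + 2 * Q1 * (J2 + J3) + Q2 * (J3 + J4)) - Q * (tau * J1 + J2)).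
  move: (P n.+1 (Dx w) (gam u)) => D; rewrite -sigma2.
  transitivity (Q * (eps * eps * A - sigma * sigma * (J1 + J2))
    - sigma * sigma * (2 * Q1 * (J2 + J3) + Q2 * (J3 + J4))); first by ring.
  by rewrite eps2; ring.
exact: alg.
Qed.

Let normr_eps : `|eps| = 1.
Proof.
apply/eqP; rewrite -(@eqrXn2 _ 2)// expr1n expr2 -normrM eps2 normr1.
by [].
Qed.

Let sigma0 : 0 <= sigma. Proof. exact: sqrtr_ge0. Qed.

Let J_bound : exists2 M : R, 0 <= M &
  forall n u, 0 <= u <= L -> `|J n.+1 (gam u)| <= M * L * divided_power n L.
Proof.
have [sk _] := good_s (good_s (good_s good_h)).
have [M M0 kM] := bounded_box (L + sigma * L) (smooth_continuous sk).
exists M => // n u /andP[u0 uL]; apply: (primitive_bound n L0 sk) => r /andP[r0 rL].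
apply: kM; have sL : 0 <= sigma * L by exact: mulr_ge0.
have suL : sigma * u <= sigma * L by exact: ler_wpM2l.
have su : 0 <= sigma * u by exact: mulr_ge0.
rewrite plane_normE /gam /vertical /= addr0 normrM normr_eps mul1r ger0_norm// ger0_norm;
  last exact: addr_ge0.
by apply/andP; split; lra.
Qed.

(** [J m] is of size L^(m-1)/(m-1)!, which absorbs the growth Q^n of the coefficients: (Q
    L)^(m-1)/(m-1)! is at most exp (2 Q L) / 2^(m-1). *)
Lemma coef_primitive_bound : exists2 B : R, 0 <= B & forall N n m u, 0 <= u <= L ->
  (n <= N.+1)%N -> (N.+3 <= m)%N -> [/\ `|q n u * J m (gam u)| <= B / 2 ^+ N,
    `|q1 n u * J m (gam u)| <= B / 2 ^+ N & `|q2 n u * J m (gam u)| <= B / 2 ^+ N].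
Proof.
have [A [Q [A0 Q1 qb]]] := zener_coef_bound tau_gt0 tau_lt1 L0.
have [M M0 JM] := J_bound.
have Q0 : 0 <= Q by exact: le_trans Q1.
exists (A * M * L * expR (2 * (Q * L))); first by nonneg.
move=> N n [//|m] u uL nN Nm.
have b (c : R) : `|c| <= A * Q ^+ n ->
    `|c * J m.+1 (gam u)| <= A * M * L * expR (2 * (Q * L)) / 2 ^+ N.
  move=> cA; rewrite normrM; apply: le_trans (ler_pM _ _ cA (JM m u uL)) _ => //.
  apply: le_trans (_ : A * Q ^+ m * (M * L * divided_power m L) <= _).
    apply: ler_wpM2r; first by apply: mulr_ge0; [nonneg|exact: divided_power_ge0].
    apply: ler_wpM2l => //; apply: ler_weXn2l => //.
    by apply: leq_trans nN _; apply: ltnW; rewrite -ltnS.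
  have -> : A * Q ^+ m * (M * L * divided_power m L) =
      A * M * L * divided_power m (Q * L).
    by rewrite /divided_power exprMn; ring.
  rewrite -[leRHS]mulrA; apply: ler_wpM2l; first by nonneg.
  rewrite ler_pdivlMr ?exprn_gt0//; apply: le_trans (divided_power_bound m (mulr_ge0 Q0 L0)).
  apply: ler_wpM2l; first by apply: divided_power_ge0; exact: mulr_ge0.
  apply: ler_weXn2l; first by rewrite ler1n.
  by do 2!apply: ltnW; rewrite -ltnS.
by have [? ? ?] := qb n u uL; split; apply: b.
Qed.

Let tail_bound : exists2 B : R, 0 <= B & forall N u, 0 <= u <= L ->
  `|\sum_(n < N.+2) (q n u * P n.+1 (zener_adjoint h) (gam u)) +
    \sum_(n < N.+2) dPi_term n u| <= B / 2 ^+ N.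
Proof.
(* The boundary terms of the telescope carry weights of total 13, and tau < 1; 14 leaves room. *)
have [B B0 cJ] := coef_primitive_bound; exists (14 * B); first exact: mulr_ge0.
move=> N u uL; have u0 : 0 <= u by case/andP: uL.
rewrite -big_split/= (eq_bigr (fun n : 'I_N.+2 =>
  - (tau * (q n u * (J n.+1 (gam u) + J n.+2 (gam u)) + 2 * q1 n u * (J n.+2 (gam u) + J n.+3 (gam u))
    + q2 n u * (J n.+3 (gam u) + J n.+4 (gam u))) - q n u * (tau * J n.+1 (gam u) + J n.+2 (gam u)))));
  last by move=> n _; rewrite (dPi_termE n u0) addrA subrr add0r.
rewrite sumrN normrN (zener_coef_telescope tau_gt0 (fun n => J n (gam u)) u N).
have b3 n m (nN : (n <= N.+1)%N) (Nm : (N.+3 <= m)%N) := cJ N n m u uL nN Nm.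
have [x1 _ _] := b3 N.+1 N.+3 (leqnn _) (leqnn _).
have [_ x2 _] := b3 N N.+3 (leqnSn _) (leqnn _).
have x3 : `|series_shift (fun n => q2 n u) N * J N.+3 (gam u)| <= B / 2 ^+ N.
  case: {x1 x2} N b3 => [|N] b3; first by rewrite /= mul0r normr0 divr_ge0// exprn_ge0.
  by have [_ _ ] := b3 N N.+4 (leqW (leqnSn _)) (leqnn _).
have [_ x4 x8] := b3 N.+1 N.+3 (leqnn _) (leqnn _).
have [_ x5 x9] := b3 N.+1 N.+4 (leqnn _) (leqnSn _).
have [_ _ x6] := b3 N N.+3 (leqnSn _) (leqnn _).
have [_ _ x7] := b3 N N.+4 (leqnSn _) (leqnSn _).
have [_ _ x10] := b3 N.+1 N.+4.+1 (leqnn _) (leqW (leqnSn _)).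
have alg (b X1 X2 X3 X4 X5 X6 X7 X9 X10 : R) : `|X1| <= b -> `|X2| <= b -> `|X3| <= b ->
    `|X4| <= b -> `|X5| <= b -> `|X6| <= b -> `|X7| <= b -> `|X9| <= b -> `|X10| <= b ->
    `|tau * (X1 + 2 * X2 + X3 + (2 * (X4 + X5) + (X6 + X7)) + (X9 + X10)) - X1| <= 14 * b.
  rewrite !ler_norml => /andP[? ?] /andP[? ?] /andP[? ?] /andP[? ?] /andP[? ?] /andP[? ?]
    /andP[? ?] /andP[? ?] /andP[? ?].
  set Y := X1 + _ + _ + _ + _; have Yb : `|Y| <= 13 * b by rewrite /Y ler_norml; apply/andP; split; lra.
  have tY : `|tau * Y| <= 13 * b.
    rewrite normrM; apply: le_trans Yb; rewrite ger0_norm; last exact: ltW.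
    by apply: ler_piMl => //; exact: ltW.
  by move: tY; rewrite ler_norml => /andP[? ?]; apply/andP; split; lra.
rewrite -mulrA; have := alg _ _ _ _ _ _ _ _ _ _ x1 x2 x3 x4 x5 x6 x7 x9 x10.
apply: le_trans; rewrite le_eqVlt; apply/orP; left; apply/eqP; congr `| _ |.
rewrite /q /q1 /q2; move: (zener_coef tau N.+1 u) (zener_coef1 tau N u) (zener_coef1 tau N.+1 u)
  (zener_coef2 tau N u) (zener_coef2 tau N.+1 u) (series_shift _ N) => a1 a2 a3 a4 a5 a6.
move: (J N.+3 (gam u)) (J N.+4 (gam u)) (J N.+4.+1 (gam u)) => c1 c2 c3.
by ring.
Qed.

Let P_gam_L n phi : good phi -> P n.+1 phi (gam L) = 0.
Proof.
move=> [sp vp]; apply/eqP; rewrite -normr_le0.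
have z r : 0 <= r <= L -> `|phi (gam L + vertical r)| <= 0.
  move=> /andP[r0 _]; rewrite vp ?normr0//.
  by apply: lt_le_trans lsL _; rewrite /= lerDl.
by have := primitive_bound n L0 sp z; rewrite !mul0r.
Qed.

(** The fundamental theorem for [Pi] on [0, L]: at L it is 0, because [gam L] lies above the support
    of h, so only its value at the origin remains. *)
Lemma characteristic_side_bound : exists2 B : R, 0 <= B & forall N,
  `|characteristic_sum N.+2 eps - \sum_(n < N.+2) (q n 0 * (eps * P n.+1 (Dx w) 0 +
      sigma * P n.+1 (s w) 0) + sigma * (q1 n 0 * P n.+1 w 0))| <= B / 2 ^+ N.
Proof.
have [B B0 tB] := tail_bound; exists (L * B); first exact: mulr_ge0.
move=> N; have gam0 : gam 0 = 0 by rewrite /gam !mulr0.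
have -> : \sum_(n < N.+2) (q n 0 * (eps * P n.+1 (Dx w) 0 + sigma * P n.+1 (s w) 0) +
    sigma * (q1 n 0 * P n.+1 w 0)) = Pi N.+2 0 by rewrite /Pi gam0.
set X := fun u => \sum_(n < N.+2) (q n u * P n.+1 (zener_adjoint h) (gam u)).
rewrite -[characteristic_sum _ _]/(\int[mu]_(u in `[0, L]) X u).
have cX : continuous X.
  apply: (@continuous_sum_ord _ _ (fun n u => q n u * P n.+1 (zener_adjoint h) (gam u))) => n u.
  by apply: cvgM; [exact: c_q|exact: (@c_P n.+1 _ (smooth_zener_adjoint sh) u)].
have PiL : Pi N.+2 L = 0.
  apply: big1 => n _; rewrite (P_gam_L n (good_Dx good_w)) (P_gam_L n (good_s good_w)).
  by rewrite (P_gam_L n good_w) !(mulr0, addr0).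
have cd := @c_dPi N.+2.
have FTC := Rintegral_FTC L0 cd (d_Pi N.+2).
rewrite PiL sub0r in FTC; rewrite -[X in _ - X]opprK -FTC opprK.
rewrite -RintegralD//; [|exact: continuous_integrable cX|exact: continuous_integrable cd].
rewrite -mulrA; apply: Rintegral_bound L0 _ (tB N) => u.
by apply: cvgD; [exact: cX|exact: cd].
Qed.

End curve.

(** The factor sigma / 2 is dictated here: the two branches together give 2 sigma (J 2 + J 3 / tau)
    at the origin, and sigma / 2 turns this into tau s h + h. *)
Lemma characteristic_identity : exists2 B : R, 0 <= B & forall N,
  `|sigma / 2 * (characteristic_sum N.+2 1 + characteristic_sum N.+2 (-1)) -
    (h 0 - tau * 'D_(dir_t R) h 0)| <= B / 2 ^+ N.
Proof.
have e1 : (1 : R) * 1 = 1 by rewrite mulr1.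
have eN1 : (- 1 : R) * - 1 = 1 by rewrite mulrNN mulr1.
have [B1 B10 sb1] := characteristic_side_bound e1; have [B2 B20 sb2] := characteristic_side_bound eN1.
have [B3 B30 cJ] := coef_primitive_bound e1.
exists (B1 + B2 + 4 * B3); first by nonneg.
move=> N; have := sb1 N; have := sb2 N.
move: (characteristic_sum N.+2 1) (characteristic_sum N.+2 (-1)) => X1 X2.
set Y1 := \sum_(n < N.+2) _; set Y2 := \sum_(n < N.+2) _ => b2 b1.
have l0L : l - L < (0 : plane).2 by rewrite /= subr_lt0.
(* On adding the two branches the terms with a factor eps cancel and the others double. *)
have YE : Y1 + Y2 = 2 * sigma * (J 2 0 + J 3 0 / tau + zener_ratio tau N.+1 * J N.+4 0
    + zener_coef1 tau N.+1 0 * (J N.+4 0 + J N.+4.+1 0)).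
  rewrite -(zener_sqrt_telescope tau (fun n => J n.+2 0) N) mulr_sumr /Y1 /Y2 -big_split.
  apply: eq_bigr => n _; rewrite -[LHS]/(_ + _) (P_sw n l0L) (P_w n.+1 l0L).
  by move: (J n.+2 0) (J n.+3 0) (J n.+4 0) (P n.+1 (Dx w) 0) => j2 j3 j4 d; ring.
have h2E : - 'D_(dir_t R) h 0 = J 2 0.
  by rewrite -(P_h1 0 l0L) /P /= partial_sE.
have h3E : h 0 = J 3 0 by rewrite -(P_h 0 l0L).
have ss : sigma * sigma = tau by rewrite -expr2 sqr_sqrtr// ltW.
have s0 : 0 <= sigma by exact: sqrtr_ge0.
have s1 : sigma <= 1 by rewrite -sqrtr1 ler_wsqrtr// ltW.
have g1 : (1 * 0, sigma * 0) = 0 :> plane by rewrite !mulr0.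
have b3 n m (nN : (n <= N.+1)%N) (Nm : (N.+3 <= m)%N) := cJ N n m 0 (introT andP (conj (lexx 0) L0)) nN Nm.
have [c1 _ _] := b3 N.+1 N.+4 (leqnn _) (leqnSn _).
have [_ c2 _] := b3 N N.+4 (leqnSn _) (leqnSn _).
have [_ c3 _] := b3 N.+1 N.+4 (leqnn _) (leqnSn _).
have [_ c4 _] := b3 N.+1 N.+4.+1 (leqnn _) (leqW (leqnSn _)).
rewrite g1 in c1 c2 c3 c4.
have rE : zener_ratio tau N.+1 = zener_coef tau N.+1 0 + zener_coef1 tau N 0.
  by rewrite -(zener_coef_ratio tau N.+1).
rewrite rE in YE; move: YE b1 b2 c1 c2 c3 c4.
have -> : h 0 - tau * 'D_(dir_t R) h 0 = J 3 0 + tau * J 2 0.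
  by rewrite -mulrN h2E h3E.
move: (zener_coef tau N.+1 0) (zener_coef1 tau N 0) (zener_coef1 tau N.+1 0) => a1 a2 a3.
move: (J 2 0) (J 3 0) (J N.+4 0) (J N.+4.+1 0) => j2 j3 j4 j5.
have -> : (B1 + B2 + 4 * B3) / 2 ^+ N = B1 / 2 ^+ N + B2 / 2 ^+ N + 4 * (B3 / 2 ^+ N) by ring.
move: (B1 / 2 ^+ N) (B2 / 2 ^+ N) (B3 / 2 ^+ N) => d1 d2 d3.
move: Y1 Y2 => Y1 Y2 YE b1 b2 c1 c2 c3 c4.
have -> : sigma / 2 * (X1 + X2) - (j3 + tau * j2) = sigma / 2 * ((X1 - Y2) + (X2 - Y1))
    + tau * (a1 * j4 + a2 * j4 + a3 * j4 + a3 * j5).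
  have -> : sigma / 2 * (X1 + X2) = sigma / 2 * ((X1 - Y2) + (X2 - Y1)) + sigma / 2 * (Y1 + Y2) by ring.
  have t0 : tau != 0 by rewrite gt_eqF.
  rewrite YE; set Z := j2 + _ + _ + _.
  transitivity (sigma / 2 * ((X1 - Y2) + (X2 - Y1)) + (sigma * sigma * Z - (j3 + tau * j2))).
    by field.
  by rewrite ss /Z; field.
have small (x y d e : R) : `|x| <= d -> `|y| <= e -> `|sigma / 2 * (x + y)| <= d + e.
  move=> xd ye; rewrite normrM ger0_norm; last exact: divr_ge0.
  apply: le_trans (_ : 1 * `|x + y| <= _); last first.
    by rewrite mul1r; apply: le_trans (ler_normD _ _) _; exact: lerD.
  by apply: ler_wpM2r => //; move: s1; lra.
apply: le_trans (ler_normD _ _) _; apply: lerD; first exact: small.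
rewrite normrM gtr0_norm//; apply: le_trans (_ : 1 * (4 * d3) <= _); last first.
  by rewrite mul1r.
apply: ler_pM => //; first exact: ltW; first exact: ltW.
move: c1 c2 c3 c4; rewrite !ler_norml.
move=> /andP[? ?] /andP[? ?] /andP[? ?] /andP[? ?]; apply/andP; split; lra.
Qed.

End characteristic_identity.

(** * The kernel of the fundamental solution *)

Lemma dyadic_series (R : realType) (u : nat -> R) (C : R) : 0 <= C ->
  (forall n, `|u n| <= C / 2 ^+ n) -> forall N,
  `|limn (fun N => \sum_(n < N) u n) - \sum_(n < N) u n| <= C * 2 / 2 ^+ N.
Proof.
move=> C0 uC N; pose S N := \sum_(n < N) u n.
have dist M : (N <= M)%N -> `|S M - S N| <= C * 2 / 2 ^+ N - C * 2 / 2 ^+ M.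
  move=> NM; rewrite -(subnK NM) addnC; elim: (M - N)%N => [|k IH].
    by rewrite addn0 !subrr normr0.
  rewrite addnS {1}/S big_ord_recr/= -/(S _) addrAC.
  apply: le_trans (ler_normD _ _) _; apply: le_trans (lerD IH (uC (N + k)%N)) _.
  have -> : 2 ^+ (N + k).+1 = 2 * 2 ^+ (N + k) :> R by rewrite exprS.
  have p0 : 2 ^+ (N + k) != 0 :> R by rewrite expf_neq0.
  have -> : C * 2 / (2 * 2 ^+ (N + k)) = C / 2 ^+ (N + k) by field.
  have -> : C * 2 / 2 ^+ (N + k) = C / 2 ^+ (N + k) + C / 2 ^+ (N + k) by field.
  by lra.
have cS : cvgn S.
  have cg : cvgn (series (geometric C (2^-1 : R))).
    by apply: is_cvg_geometric_series; rewrite ger0_norm// invf_lt1// ltr1n.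
  have -> : S = series u by apply/funext => n; rewrite /S seriesEord.
  apply: normed_cvg; apply: series_le_cvg cg => n //=.
    by rewrite /geometric/= mulr_ge0// exprn_ge0.
  by rewrite /geometric/= exprVn.
have cN : (fun M => `|S M - S N|) @ \oo --> `|limn S - S N|.
  by apply: cvg_norm; apply: cvgB => //; exact: cvg_cst.
apply: (ler_cvg_to cN (cvg_cst _)); near=> M.
apply: le_trans (dist M _) _; last by rewrite gerBl divr_ge0 ?mulr_ge0 ?exprn_ge0.
by near: M; exact: nbhs_infty_ge.
Unshelve. all: by end_near. Qed.

Lemma dyadic_small (R : realType) (C e : R) : 0 < e -> exists N : nat, C / 2 ^+ N <= e.
Proof.
move=> e0; exists (Num.bound (`|C| / e)); set N := Num.bound _.
have : `|C| / e < N%:R by apply: archi_boundP; rewrite divr_ge0// ltW.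
rewrite ltr_pdivrMr// => /ltW CN; rewrite ler_pdivrMr ?exprn_gt0//.
apply: le_trans (le_trans (ler_norm C) CN) _; rewrite mulrC ler_pM2l// -natrX ler_nat.
by apply: ltnW; exact: ltn_expl.
Qed.

Lemma dyadic_eq0 (R : realType) (x C : R) : (forall N, `|x| <= C / 2 ^+ N) -> x = 0.
Proof.
move=> xC; apply/eqP; rewrite -normr_le0; apply/ler_addgt0Pr => e e0; rewrite add0r.
by have [N CN] := dyadic_small C e0; exact: le_trans (xC N) CN.
Qed.

Section zener_kernel.
Context {R : realType}.
Local Notation plane := (R * R)%type.
Local Notation mR := (measurableTypeR R).
Variable tau : R.
Hypotheses (tau_gt0 : 0 < tau) (tau_lt1 : tau < 1).
Implicit Types (p q : plane).
Let sigma : R := Num.sqrt tau.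

(* The positive part of the time elapsed since the wave front reached [p.1]. *)
Definition front_lag p : R :=
  (p.2 - Num.sqrt tau * `|p.1| + `|p.2 - Num.sqrt tau * `|p.1| |) / 2.

Definition zener_term n p : R := zener_coef tau n `|p.1| * divided_power n (front_lag p).

(** The series starts at n = 1: each term contains a positive power of the clipped lag, so it
    vanishes ahead of the front and is continuous across it without a Heaviside factor. *)
Definition zener_remainder p : R :=
  Num.sqrt tau / 2 * limn (fun N => \sum_(n < N) zener_term n.+1 p).

Definition zener_kernel p : R := zener_leading_term tau p + zener_remainder p.

(** The term n = 0 does not vanish ahead of the front, hence the explicit Heaviside factor. *)
Definition zener_partial N p : R :=
  Num.sqrt tau / 2 * heaviside (p.2 - Num.sqrt tau * `|p.1|) * \sum_(n < N) zener_term n p.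

Let sigma_ge0 : 0 <= sigma. Proof. exact: sqrtr_ge0. Qed.

Lemma front_lag_ge0 p : 0 <= front_lag p.
Proof.
rewrite /front_lag divr_ge0//; set x := p.2 - _.
by rewrite -[x + _]opprK oppr_ge0 opprD -[- x]opprK subr_le0; have := ler_norm (- x); rewrite normrN; lra.
Qed.

Lemma front_lag_pos p : 0 <= p.2 - sigma * `|p.1| -> front_lag p = p.2 - sigma * `|p.1|.
Proof.
move=> x0; rewrite /front_lag (ger0_norm x0).
have half (x : R) : (x + x) / 2 = x by field.
exact: half.
Qed.

Lemma front_lag_neg p : p.2 - sigma * `|p.1| <= 0 -> front_lag p = 0.
Proof. by move=> x0; rewrite /front_lag (ler0_norm x0) subrr mul0r. Qed.

Lemma front_lag_le p (L : R) : 0 <= L -> `|p| <= L -> front_lag p <= L.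
Proof.
move=> L0; rewrite plane_normE => /andP[_ p2].
have [x0|x0] := leP 0 (p.2 - sigma * `|p.1|).
  rewrite front_lag_pos// lerBlDr; apply: le_trans (ler_norm _) _; apply: le_trans p2 _.
  by rewrite lerDl; exact: mulr_ge0.
by rewrite front_lag_neg// ltW.
Qed.

Lemma zener_term_bound (L : R) : 0 <= L -> exists2 C : R, 0 <= C &
  forall n p, `|p| <= L -> `|zener_term n p| <= C / 2 ^+ n.
Proof.
move=> L0; have [A [Q [A0 Q1 qb]]] := zener_coef_bound tau_gt0 tau_lt1 L0.
have Q0 : 0 <= Q by exact: le_trans Q1.
exists (A * expR (2 * (Q * L))); first by nonneg.
move=> n p pL; have l0 := front_lag_ge0 p; have lL := front_lag_le L0 pL.
have p1 : 0 <= `|p.1| <= L by rewrite normr_ge0/=; move: pL; rewrite plane_normE => /andP[].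
have [b _ _] := qb n _ p1; have lag : 0 <= front_lag p <= L by apply/andP; split.
rewrite /zener_term normrM (ger0_norm (divided_power_ge0 n l0)).
apply: le_trans (ler_pM _ (divided_power_ge0 n l0) b (divided_power_le n lag)) _ => //.
have -> : A * Q ^+ n * divided_power n L = A * divided_power n (Q * L).
  by rewrite /divided_power exprMn; ring.
rewrite -mulrA; apply: ler_wpM2l => //.
by rewrite ler_pdivlMr ?exprn_gt0//; apply: divided_power_bound; exact: mulr_ge0.
Qed.

Lemma zener_remainder_approx (L : R) : 0 <= L -> exists2 C : R, 0 <= C &
  forall p, `|p| <= L -> forall N,
  `|zener_remainder p - sigma / 2 * \sum_(n < N) zener_term n.+1 p| <= C / 2 ^+ N.
Proof.
move=> L0; have [C C0 tC] := zener_term_bound L0.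
exists (sigma / 2 * (C * 2)); first by nonneg.
move=> p pL N; rewrite -mulrBr normrM ger0_norm; last by nonneg.
rewrite -mulrA; apply: ler_wpM2l; first by nonneg.
apply: (@dyadic_series R (fun n => zener_term n.+1 p) C C0 _ N) => n.
apply: le_trans (tC n.+1 p pL) _.
apply: ler_wpM2l => //; rewrite lef_pV2 ?posrE ?exprn_gt0//.
by apply: ler_weXn2l => //; rewrite ler1n.
Qed.

Lemma zener_remainder_eq0 p : p.2 - sigma * `|p.1| <= 0 -> zener_remainder p = 0.
Proof.
move=> x0; rewrite /zener_remainder (_ : (fun N => _) = cst 0).
  by rewrite lim_cst// mulr0.
apply/funext => N; rewrite big1// => n _.
by rewrite /zener_term front_lag_neg// /divided_power exprS !mul0r mulr0.
Qed.

Lemma continuous_front : continuous (fun p : plane => p.2 - Num.sqrt tau * `|p.1|).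
Proof.
move=> p; apply: cvgB; first exact: cvg_snd.
apply: cvgM; first exact: cvg_cst.
by apply: cvg_norm; exact: cvg_fst.
Qed.

Lemma continuous_front_lag : continuous front_lag.
Proof.
move=> p; apply: cvgM; last exact: cvg_cst.
by apply: cvgD; [exact: continuous_front|apply: cvg_norm; exact: continuous_front].
Qed.

Lemma continuous_zener_coef n : continuous (zener_coef tau n).
Proof.
move=> u; apply: differentiable_continuous; apply/derivable1_diffP.
by have [] := is_derive_zener_coef tau n u.
Qed.

Lemma continuous_zener_term n : continuous (zener_term n).
Proof.
move=> p; apply: cvgM.
  apply: (continuous_comp (f := fun p : plane => `|p.1|)); last exact: continuous_zener_coef.
  by apply: cvg_norm; exact: cvg_fst.
apply: continuous_comp; first exact: continuous_front_lag.
exact: continuous_divided_power.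
Qed.

Lemma continuous_zener_remainder : continuous zener_remainder.
Proof.
move=> p; have L0 : 0 <= `|p| + 1 by exact: addr_ge0.
have [C C0 EC] := zener_remainder_approx L0.
pose g N q := sigma / 2 * \sum_(n < N) zener_term n.+1 q.
have cg N : continuous (g N).
  move=> q; apply: cvgM; first exact: cvg_cst.
  apply: (@continuous_sum_ord _ _ (fun n => zener_term n.+1)) => n.
  exact: continuous_zener_term.
apply/cvgrPdist_le => e e0.
have e3 : 0 < e / 3 by rewrite divr_gt0.
have [N NC] := dyadic_small C e3.
near=> q.
have qL : `|q| <= `|p| + 1.
  have : `|q - p| <= 1.
    by near: q; move/cvgrPdist_le : (@cvg_id _ (nbhs p)) => /(_ 1 ltr01);
      apply: filterS => z; rewrite distrC.
  by move=> qp; rewrite -(subrK p q) addrC; apply: le_trans (ler_normD _ _) _; rewrite lerD2l.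
have gq : `|g N p - g N q| <= e / 3.
  by near: q; have /cvgrPdist_le := cg N p; exact.
have pL : `|p| <= `|p| + 1 by rewrite lerDl.
have a1 := le_trans (EC p pL N) NC; have a2 := le_trans (EC q qL N) NC.
move: a1 a2 gq; rewrite -/(g N p) -/(g N q) !ler_norml.
by move=> /andP[? ?] /andP[? ?] /andP[? ?]; apply/andP; split; lra.
Unshelve. all: by end_near. Qed.

End zener_kernel.

(** * Integrals over segments of the line *)

Section segment_integrals.
Context {R : realType}.
Local Notation mu := (@lebesgue_measure R).
Implicit Types (g : R -> R) (a b c L : R).

Lemma Rintegral_shift g a b c : a <= b -> continuous g ->
  \int[mu]_(r in `[a, b]) g (c + r) = \int[mu]_(r in `[c + a, c + b]) g r.
Proof.
move=> ab cg; have dF (x : R) : is_derive x (1 : R) (fun r : R => c + r) 1.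
  have := is_deriveD (is_derive_cst c x (1 : R)) (is_derive_id x (1 : R)).
  by rewrite add0r.
have D1 : derive1 (fun r : R => c + r) = cst 1.
  by apply/funext => z; rewrite derive1E derive_val.
have cF : continuous (fun r : R => c + r).
  by move=> x; apply: cvgD; [exact: cvg_cst|exact: cvg_id].
rewrite /Rintegral [in RHS](@integration_by_substitution_increasing R (fun r => c + r))//.
- congr fine; apply: eq_integral => x _; rewrite D1 /=.
  by rewrite -[(_ * _)%R x]/(g (c + x) * 1) mulr1.
- by move=> x y _ _ xy; rewrite ltrD2l.
- by rewrite D1 => x _; exact: cvg_cst.
- by rewrite D1; exact: is_cvg_cst.
- by rewrite D1; exact: is_cvg_cst.
- split=> [x _||]; first by have [] := dF x.
    exact: cvg_at_right_filter (cF a).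
  exact: cvg_at_left_filter (cF b).
- exact: continuous_subspaceT.
Qed.

(* Both sides are integrals of [g] over [c, L]. *)
Lemma Rintegral_heaviside g c L : 0 <= c -> 0 <= L -> continuous g ->
  (forall y, L <= y -> g y = 0) ->
  \int[mu]_(y in `[0, L]) (heaviside (y - c) * g y) = \int[mu]_(r in `[0, L]) g (c + r).
Proof.
move=> c0 L0 cg g0; rewrite Rintegral_mkcond [RHS]Rintegral_mkcond.
have [cL|Lc] := leP c L; last first.
  transitivity (\int[mu]_x (0 : R)); [|symmetry]; apply: eq_Rintegral => r _; rewrite patchE;
    case: ifPn => //; rewrite inE/= in_itv/= => /andP[r0 rL].
    by rewrite /heaviside leNgt subr_lt0 (le_lt_trans rL Lc)/= mul0r.
  by rewrite g0//; apply: le_trans (ltW Lc) _; rewrite lerDl.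
transitivity (\int[mu]_(r in `[c, L]) g r).
  rewrite [RHS]Rintegral_mkcond; apply: eq_Rintegral => y _; rewrite !patchE !mem_setE !in_itv/=.
  rewrite /heaviside subr_ge0; have [cy|yc] := leP c y; rewrite /=; last by rewrite mul0r if_same.
  by rewrite (le_trans c0 cy) mul1r.
transitivity (\int[mu]_(r in `[0, L - c]) g (c + r)).
  by rewrite Rintegral_shift ?subr_ge0// addr0 addrC subrK.
rewrite [LHS]Rintegral_mkcond; apply: eq_Rintegral => y _; rewrite !patchE !mem_setE !in_itv/=.
case: (leP 0 y) => //= y0; rewrite lerBrDr addrC; case: (leP y L) => yL; case: (leP (c + y) L) => //= cyL.
  by rewrite g0// ltW.
by move: cyL; rewrite leNgt (lt_le_trans yL)// lerDr.
Qed.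

Lemma Rintegral_symmetric g L : 0 <= L -> continuous g ->
  \int[mu]_(x in `[- L, L]) g x = \int[mu]_(u in `[0, L]) g u + \int[mu]_(u in `[0, L]) g (- u).
Proof.
move=> L0 cg; have NL0 : - L <= 0 by rewrite oppr_le0.
have i1 := continuous_integrable (- L) L cg.
have i2 : mu.-integrable `]0, L] (EFin \o g).
  apply: (integrableS _ _ _ (continuous_integrable 0 L cg)) => //.
  by apply: subset_itvr; rewrite bnd_simp.
have := @Rintegral_itvB R g (BLeft (- L)) (BRight L) 0 i1.
rewrite !bnd_simp => /(_ NL0 L0)/eqP; rewrite subr_eq => /eqP ->.
rewrite (Rintegral_itv_obnd_cbnd i2); congr (_ + _).
rewrite /Rintegral -[X in `[_, X]]oppr0 (@integration_by_substitution_oppr R g 0 L)//.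
exact: continuous_subspaceT.
Qed.

Lemma Rintegral_sum_continuous N (F : nat -> R -> R) a b : (forall n, continuous (F n)) ->
  \int[mu]_(x in `[a, b]) (\sum_(n < N) F n x) = \sum_(n < N) \int[mu]_(x in `[a, b]) F n x.
Proof.
move=> cF; elim: N => [|N IH].
  rewrite big_ord0; under eq_Rintegral do rewrite big_ord0.
  by rewrite Rintegral_cst ?mul0r//; exact: measurable_itv.
rewrite big_ord_recr/= -IH -RintegralD//; [|exact: continuous_integrable (continuous_sum_ord cF)
  |exact: continuous_integrable].
by apply: eq_Rintegral => x _; rewrite big_ord_recr.
Qed.

End segment_integrals.

Section kernel_functional.
Context {R : realType}.
Local Notation plane := (R * R)%type.
Local Notation mR := (measurableTypeR R).
Local Notation mu := (@lebesgue_measure R).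
Variable tau : R.
Hypotheses (tau_gt0 : 0 < tau) (tau_lt1 : tau < 1).
Implicit Types (p q : plane) (phi h : plane -> R) (l L : R).
Let sigma : R := Num.sqrt tau.
Let sigma_ge0 : 0 <= sigma. Proof. exact: sqrtr_ge0. Qed.

Lemma zener_kernel_out p : p.2 - sigma * `|p.1| < 0 -> zener_kernel tau p = 0.
Proof.
move=> x0; rewrite /zener_kernel zener_remainder_eq0 ?ltW// addr0 /zener_leading_term.
by rewrite /heaviside (leNgt 0 (_ - _)) x0 mulr0.
Qed.

Lemma zener_kernel_approx L : 0 <= L -> exists2 C : R, 0 <= C &
  forall p, `|p| <= L -> forall N,
  `|zener_kernel tau p - zener_partial tau N.+1 p| <= C / 2 ^+ N.
Proof.
move=> L0; have [C C0 EC] := zener_remainder_approx tau_gt0 tau_lt1 L0.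
exists C => // p pL N; have [x0|x0] := ltP (p.2 - sigma * `|p.1|) 0.
  rewrite zener_kernel_out// /zener_partial /heaviside -/sigma (leNgt 0 (_ - _)) x0 /= mulr0 mul0r subrr normr0.
  by rewrite divr_ge0// exprn_ge0.
suff -> : zener_kernel tau p - zener_partial tau N.+1 p = zener_remainder tau p
    - sigma / 2 * \sum_(n < N) zener_term tau n.+1 p by exact: EC.
(* The term n = 0 is the leading term itself, because [zener_memory 0] is (1/tau - 1)/2. *)
rewrite /zener_kernel /zener_partial /zener_leading_term /heaviside -/sigma x0 !mulr1 big_ord_recl.
rewrite /zener_term /= zener_coef0E zener_memory0 {1}/divided_power expr0 fact0 divr1 mulr1.
rewrite (_ : sigma / 2 * (tau^-1 - 1) * `|p.1| = sigma * ((tau^-1 - 1) / 2) * `|p.1|); last by ring.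
by set X := \sum_(i < N) _; move: X => X; ring.
Qed.

Lemma measurable_heaviside_front :
  measurable_fun setT ((fun p => heaviside (p.2 - sigma * `|p.1|)) : mR * mR -> R).
Proof.
have -> : (fun p : plane => heaviside (p.2 - sigma * `|p.1|)) =
    \1_[set p : plane | 0 <= p.2 - sigma * `|p.1|].
  apply/funext => p; rewrite /heaviside indicE.
  by case: ifPn => x0; [rewrite mem_set|rewrite memNset//; exact/negP].
apply: measurable_indic; apply: measurable_closed_plane.
have cl := proj1 (continuous_closedP (fun p : plane => p.2 - Num.sqrt tau * `|p.1|))
  (@continuous_front R tau).
have := cl _ (@closed_ge R 0). exact.
Qed.

Lemma measurable_zener_partial N : measurable_fun setT (zener_partial tau N : mR * mR -> R).
Proof.
apply: measurable_funM.
  by apply: measurable_funM => //; exact: measurable_heaviside_front.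
apply: measurable_continuous_plane; apply: continuous_sum_ord => n.
exact: continuous_zener_term.
Qed.

Lemma measurable_zener_kernel : measurable_fun setT (zener_kernel tau : mR * mR -> R).
Proof.
apply: measurable_funD; last first.
  by apply: measurable_continuous_plane; exact: continuous_zener_remainder.
apply: measurable_funM; last exact: measurable_heaviside_front.
apply: measurable_continuous_plane => p.
apply: cvgM; first exact: cvg_cst.
apply: continuous_comp; last exact: continuous_expR.
apply: cvgN; apply: cvgM; first exact: cvg_cst.
by apply: cvg_norm; exact: cvg_fst.
Qed.

Lemma heaviside_bound (x : R) : `|heaviside x| <= 1.
Proof. by rewrite /heaviside; case: ifP; rewrite ?normr1// normr0. Qed.

Lemma zener_partial_bound N L : exists M : R, forall p, `|p| <= L -> `|zener_partial tau N p| <= M.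
Proof.
have cs : continuous (fun p => \sum_(n < N) zener_term tau n p).
  by apply: continuous_sum_ord => n; exact: continuous_zener_term.
have [M M0 sM] := bounded_box L cs.
exists (sigma / 2 * 1 * M) => p pL; rewrite /zener_partial !normrM.
apply: ler_pM => //; last exact: sM.
apply: ler_pM; rewrite ?heaviside_bound//.
by rewrite ger0_norm ?divr_ge0// ger0_norm.
Qed.

Lemma zener_kernel_bound L : 0 <= L ->
  exists M : R, forall p, `|p| <= L -> `|zener_kernel tau p| <= M.
Proof.
move=> L0; have [C C0 kC] := zener_kernel_approx L0; have [M pM] := zener_partial_bound 1 L.
exists (C + M) => p pL; have := kC p pL 0%N; rewrite expr0 divr1 => d.
rewrite -(subrK (zener_partial tau 1 p) (zener_kernel tau p)).
by apply: le_trans (ler_normD _ _) _; apply: lerD => //; exact: pM.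
Qed.

Definition upper_box L : set (mR * mR) := `[- L, L]%classic `*` `[0, L]%classic.

Definition kernel_functional L phi :=
  \int[lebesgue2 R]_(p in upper_box L) (zener_kernel tau p * phi p).

Lemma upper_box_norm L p : upper_box L p -> `|p| <= L.
Proof.
rewrite /upper_box plane_normE /= !in_itv/= !ler_norml => -[-> /andP[p0 pL]].
by rewrite pL andbT /=; apply: (le_trans _ p0); rewrite oppr_le0; exact: le_trans p0 pL.
Qed.

Lemma measurable_upper_box L : measurable (upper_box L).
Proof. by apply: measurableX; exact: measurable_itv. Qed.

Lemma upper_box_finite L : (lebesgue2 R (upper_box L) < +oo)%E.
Proof.
rewrite product_measure1E//= !lebesgue_measure_itv/=.
by do 2 case: ifP => _; rewrite ?mule0 ?mul0e// -?EFinB -?EFinM ltry.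
Qed.

Lemma box_functional_kernel L : 0 <= L -> box_functional L (kernel_functional L).
Proof.
move=> L0; have [M kM] := zener_kernel_bound L0.
apply: (@box_functional_integral R _ _ (lebesgue2 R) (upper_box L) (zener_kernel tau) id L).
- exact: measurable_upper_box.
- exact: upper_box_finite.
- by apply: measurable_funTS; exact: measurable_zener_kernel.
- by exists M => p /upper_box_norm; exact: kM.
- by move=> f cf; apply: measurable_funTS; exact: measurable_continuous_plane.
- exact: upper_box_norm.
Qed.

End kernel_functional.

(** * From the plane integral to the two characteristics *)

Section fubini.
Context {R : realType}.
Local Notation plane := (R * R)%type.
Local Notation mR := (measurableTypeR R).
Local Notation mu := (@lebesgue_measure R).
Variable tau : R.
Hypotheses (tau_gt0 : 0 < tau) (tau_lt1 : tau < 1).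
Implicit Types (p q : plane) (phi h : plane -> R) (l L : R).
Let sigma : R := Num.sqrt tau.
Let sigma_ge0 : 0 <= sigma. Proof. exact: sqrtr_ge0. Qed.

Lemma integrable_upper_box (f : plane -> R) L : measurable_fun setT (f : mR * mR -> R) ->
  (exists M : R, forall p, `|p| <= L -> `|f p| <= M) ->
  (lebesgue2 R).-integrable (upper_box L) (EFin \o f).
Proof.
move=> mf [M fM]; apply: measurable_bounded_integrable.
- exact: measurable_upper_box.
- exact: upper_box_finite.
- exact: measurable_funTS.
- by exists M; split; rewrite ?num_real// => y My p /upper_box_norm pL;
    exact: le_trans (fM p pL) (ltW My).
Qed.

Lemma Rintegral_upper_box_bound (f : plane -> R) L (M : R) :
  measurable_fun setT (f : mR * mR -> R) -> (forall p, `|p| <= L -> `|f p| <= M) ->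
  `|\int[lebesgue2 R]_(p in upper_box L) f p| <= M * fine (lebesgue2 R (upper_box L)).
Proof.
move=> mf fM; apply: normr_Rintegral_le.
- exact: measurable_upper_box.
- exact: upper_box_finite.
- by apply: integrable_upper_box => //; exists M.
- by move=> p /upper_box_norm; exact: fM.
Qed.

Lemma Rintegral_upper_box (f : plane -> R) L : measurable_fun setT (f : mR * mR -> R) ->
  (exists M : R, forall p, `|p| <= L -> `|f p| <= M) ->
  \int[lebesgue2 R]_(p in upper_box L) f p =
  \int[mu]_(x in `[- L, L]) \int[mu]_(y in `[0, L]) f (x, y).
Proof.
move=> mf fb; have intf := integrable_upper_box mf fb; have [M fM] := fb.
have intf' : (lebesgue2 R).-integrable setT ((EFin \o f) \_ (upper_box L)).
  by rewrite -integrable_mkcond//; exact: measurable_upper_box.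
rewrite {1}/Rintegral integral_mkcond -(integral12_prod_meas1 intf') /fubini_F.
rewrite [RHS]/Rintegral [in RHS]integral_mkcond; congr fine.
apply: eq_integral => x _; rewrite !patchE.
case: ifPn => xL; last first.
  rewrite integral0_eq// => y _; rewrite patchE; case: ifPn => //.
  by rewrite inE => -[] /mem_set; rewrite (negbTE xL).
have -> : (\int[mu]_y ((EFin \o f) \_ (upper_box L)) (x, y) =
    \int[mu]_(y in `[0%R, L]) (f (x, y))%:E)%E.
  rewrite [RHS]integral_mkcond; apply: eq_integral => y _; rewrite !patchE.
  have -> : ((x, y) \in upper_box L) = (y \in `[0, L]%classic).
    apply/idP/idP; first by rewrite inE => -[_ /mem_set].
    by rewrite !inE => yL; split=> //; exact: set_mem xL.
  by [].
rewrite /= /Rintegral fineK//.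
apply: integrable_fin_num => //.
apply: measurable_bounded_integrable => //; first exact: segment_finite.
  apply: measurable_funTS; exact: (measurableT_comp mf (measurable_pair1 _)).
exists M; split; rewrite ?num_real// => z Mz y yL.
by apply: le_trans (fM _ _) (ltW Mz); apply: upper_box_norm; split=> //; exact: set_mem xL.
Qed.

Section base_identity.
Variables (l L : R) (phi : plane -> R) (N : nat).
Hypotheses (L0 : 0 <= L) (lL : l < L) (sphi : smooth phi) (phi0 : vanishes_above l phi).

Let G (x : R) : R := \sum_(n < N) (zener_coef tau n `|x| * primitive L n.+1 phi (x, sigma * `|x|)).

Let cM (f g : R -> R) : continuous f -> continuous g -> continuous (fun y => f y * g y).
Proof. by move=> cf cg y; apply: cvgM; [exact: cf|exact: cg]. Qed.

Let c_column x y : continuous (fun r => phi (x, y + r)).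
Proof.
have := @continuous_vertical R phi (x, y) (smooth_continuous sphi).
rewrite (_ : (fun r : R => phi (x, y + r)) = fun r => phi ((x, y) + vertical r))//.
by apply/funext => r; rewrite /vertical /= (_ : (x, y) + (0, r) = (x + 0, y + r))// addr0.
Qed.

(** The Heaviside factor starts the integral at c = sigma |x|; with y = c + r the lag becomes r, and
    r^n/n! produces the primitives of [phi] at the point of the characteristic above x. *)
Let column_integral x :
  \int[mu]_(y in `[0, L]) (zener_partial tau N (x, y) * phi (x, y)) = sigma / 2 * G x.
Proof.
pose c := sigma * `|x|; have c0 : 0 <= c by exact: mulr_ge0.
pose F n r := zener_coef tau n `|x| * (divided_power n r * phi (x, c + r)).
have cF n : continuous (F n).
  apply: (cM (f := cst _) (g := fun r => _ * _)); first exact: cst_continuous.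
  by apply: cM; [exact: continuous_divided_power|exact: c_column].
pose g y := sigma / 2 * \sum_(n < N) F n (y - c).
have cg : continuous g.
  apply: (cM (f := cst _)); first exact: cst_continuous.
  move=> y; apply: (continuous_comp (f := fun y => y - c) (g := fun y => \sum_(n < N) F n y)).
    by apply: cvgB; [exact: cvg_id|exact: cvg_cst].
  exact: (continuous_sum_ord cF).
have g0 y : L <= y -> g y = 0.
  move=> Ly; rewrite /g big1 ?mulr0// => n _.
  by rewrite /F (addrC c) subrK phi0 ?mulr0//=; exact: lt_le_trans Ly.
transitivity (\int[mu]_(y in `[0, L]) (heaviside (y - c) * g y)).
  apply: eq_Rintegral => y _; rewrite /zener_partial /= -/sigma -/c.
  rewrite /heaviside; case: ifPn => yc; last by rewrite mulr0 !mul0r.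
  rewrite mulr1 mul1r /g -[LHS]mulrA mulr_suml; congr (_ * _); apply: eq_bigr => n _.
  by rewrite /F /zener_term front_lag_pos//= -/sigma -/c (addrC c) subrK mulrA.
rewrite (Rintegral_heaviside c0 L0 cg g0).
transitivity (\int[mu]_(r in `[0, L]) (sigma / 2 * \sum_(n < N) F n r)).
  by apply: eq_Rintegral => r _; rewrite /g (addrC c) addrK.
rewrite RintegralZl//; last exact: continuous_integrable (continuous_sum_ord cF).
rewrite (Rintegral_sum_continuous N 0 L cF); congr (_ * _); apply: eq_bigr => n _.
rewrite /F RintegralZl//; last first.
  by apply: continuous_integrable; apply: cM; [exact: continuous_divided_power|exact: c_column].
congr (_ * _); rewrite /= vertical_conv_unlock; apply: eq_Rintegral => r _.
by congr (_ * phi _); rewrite /vertical -/c (_ : (x, c) + (0, r) = (x + 0, c + r))// addr0.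
Qed.

Let cG : continuous G.
Proof.
apply: (@continuous_sum_ord _ _ (fun n x => zener_coef tau n `|x| *
  primitive L n.+1 phi (x, sigma * `|x|))) => n.
apply: cM => x.
  apply: (continuous_comp (f := fun x : R => `|x|) (g := zener_coef tau n)).
    exact: norm_continuous.
  exact: continuous_zener_coef.
apply: (continuous_comp (f := fun x : R => (x, sigma * `|x|)) (g := primitive L n.+1 phi)).
  have cn : (fun x : R => sigma * `|x|) @ x --> sigma * `|x|.
    by apply: cvgM; [exact: cvg_cst|exact: norm_continuous].
  exact: (cvg_pair (@cvg_id _ (nbhs x)) cn).
exact: (smooth_continuous (smooth_primitive L n.+1 sphi)).
Qed.

Lemma zener_partial_integral :
  \int[lebesgue2 R]_(p in upper_box L) (zener_partial tau N p * phi p) = sigma / 2 *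
   (\int[mu]_(u in `[0, L]) (\sum_(n < N) (zener_coef tau n u * primitive L n.+1 phi (1 * u, sigma * u)))
  + \int[mu]_(u in `[0, L]) (\sum_(n < N) (zener_coef tau n u * primitive L n.+1 phi (-1 * u, sigma * u)))).
Proof.
have [M pM] := zener_partial_bound tau N L.
have [M' M'0 phiM] := bounded_box L (smooth_continuous sphi).
rewrite Rintegral_upper_box.
- rewrite (_ : \int[mu]_(x in `[- L, L]) _ = \int[mu]_(x in `[- L, L]) (sigma / 2 * G x)); last first.
    by apply: eq_Rintegral => x _; exact: column_integral.
  rewrite RintegralZl//; last exact: continuous_integrable.
  have e1 : \int[mu]_(u in `[0, L]) G u = \int[mu]_(u in `[0, L])
      (\sum_(n < N) (zener_coef tau n u * primitive L n.+1 phi (1 * u, sigma * u))).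
    apply: eq_Rintegral => u; rewrite inE/= in_itv/= => /andP[u0 _].
    by rewrite /G (ger0_norm u0) mul1r.
  have e2 : \int[mu]_(u in `[0, L]) G (- u) = \int[mu]_(u in `[0, L])
      (\sum_(n < N) (zener_coef tau n u * primitive L n.+1 phi (-1 * u, sigma * u))).
    apply: eq_Rintegral => u; rewrite inE/= in_itv/= => /andP[u0 _].
    by rewrite /G normrN (ger0_norm u0) mulN1r.
  by rewrite -e1 -e2 (Rintegral_symmetric L0 cG).
- apply: measurable_funM; first exact: measurable_zener_partial.
  by apply: measurable_continuous_plane; exact: smooth_continuous.
- by exists (M * M') => p pL; rewrite normrM; apply: ler_pM => //; [exact: pM|exact: phiM].
Qed.

End base_identity.

(** Replacing the kernel by its truncation and the truncated identity on the characteristics both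
    cost O(2^-N), while the two sides do not depend on N. *)
Lemma kernel_functional_adjoint l L h : 0 <= l -> l < L -> l < sigma * L ->
  smooth h -> vanishes_above l h ->
  kernel_functional tau L (zener_adjoint tau h) = h 0 - tau * 'D_(dir_t R) h 0.
Proof.
move=> l0 lL lsL sh vh; have L0 : 0 <= L by apply: ltW; exact: le_lt_trans lL.
have [B B0 hB] := characteristic_identity tau_gt0 tau_lt1 l0 lL lsL sh vh.
have [C C0 kC] := zener_kernel_approx tau_gt0 tau_lt1 L0.
have [M M0 aM] := bounded_box L (smooth_continuous (smooth_zener_adjoint tau sh)).
set a := zener_adjoint tau h in aM *.
have mpart N : measurable_fun setT ((fun p => zener_partial tau N p * a p) : mR * mR -> R).
  apply: measurable_funM; first exact: measurable_zener_partial.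
  by apply: measurable_continuous_plane; apply: smooth_continuous; exact: smooth_zener_adjoint.
have mker : measurable_fun setT ((fun p => zener_kernel tau p * a p) : mR * mR -> R).
  apply: measurable_funM; first exact: measurable_zener_kernel.
  by apply: measurable_continuous_plane; apply: smooth_continuous; exact: smooth_zener_adjoint.
have bmul (k : plane -> R) : (exists K : R, forall p, `|p| <= L -> `|k p| <= K) ->
    exists K : R, forall p, `|p| <= L -> `|k p * a p| <= K.
  move=> [K kK]; exists (K * M) => p pL; rewrite normrM.
  by apply: ler_pM => //; [exact: kK|exact: aM].
have iker := integrable_upper_box mker (bmul _ (zener_kernel_bound tau_gt0 tau_lt1 L0)).
have ipart N := integrable_upper_box (mpart N) (bmul _ (zener_partial_bound tau N L)).
set V := fine (lebesgue2 R (upper_box L)); have V0 : 0 <= V by exact: fine_ge0.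
apply/eqP; rewrite -subr_eq0; apply/eqP.
apply: (@dyadic_eq0 R _ (C * M * V + B)) => N.
have va := vanishes_above_zener_adjoint tau vh; have sa := smooth_zener_adjoint tau sh.
have := hB N; have := zener_partial_integral N.+2 L0 lL sa va.
rewrite -/a -[X in _ = _ * X]/(characteristic_sum tau L h N.+2 1 + characteristic_sum tau L h N.+2 (-1)) => <-.
set Y := h 0 - _; set Z := \int[_]_(p in _) _ => bZ.
have bk : `|kernel_functional tau L a - Z| <= C / 2 ^+ N * M * V.
  rewrite /kernel_functional /Z -RintegralB//; last exact: measurable_upper_box.
  apply: Rintegral_upper_box_bound.
    by apply: measurable_funB; [exact: mker|exact: mpart].
  move=> p pL; rewrite -mulrBl normrM; apply: ler_pM => //; last exact: aM.
  apply: le_trans (kC p pL N.+1) _; apply: ler_wpM2l => //.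
  by rewrite lef_pV2 ?posrE ?exprn_gt0//; apply: ler_weXn2l => //; rewrite ler1n.
rewrite -(subrKA Z); apply: le_trans (ler_normD _ _) _; apply: le_trans (lerD bk bZ) _.
by rewrite le_eqVlt; apply/orP; left; apply/eqP; ring.
Qed.

End fubini.

(** * Functions of bounded support as test functions *)

Section bounded_supports.
Context {R : realType}.
Local Notation plane := (R * R)%type.
Implicit Types (f g phi : plane -> R) (p q v : plane).

Definition bounded_support f := exists M : R, forall p, M < `|p| -> f p = 0.

Lemma open_far (M : R) : open [set p : plane | M < `|p|].
Proof.
have oP := proj1 (continuousP _) (@norm_continuous R plane).
by have := oP _ (@open_gt R M).
Qed.

Lemma bounded_support_lin (c : R) f g : bounded_support f -> bounded_support g ->
  bounded_support (fun p => c * f p + g p).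
Proof.
move=> [M fM] [N gN]; exists (Num.max M N) => p; rewrite gt_max => /andP[Mp Np].
by rewrite fM// gN// mulr0 addr0.
Qed.

Lemma bounded_support_mul f g : bounded_support f -> bounded_support (fun p => g p * f p).
Proof. by move=> [M fM]; exists M => p Mp; rewrite fM// mulr0. Qed.

Lemma bounded_support_derive v f : bounded_support f -> bounded_support (fun p => 'D_v f p).
Proof.
move=> [M fM]; exists M => p Mp.
have e : {in [set p : plane | M < `|p|], f =1 cst 0} by move=> q; rewrite inE; exact: fM.
have := derive_open_eq v (@open_far M) e; move=> ->; last by rewrite inE.
by rewrite derive_cst.
Qed.

Lemma bounded_support_partial_x f : bounded_support f -> bounded_support (partial_x f).
Proof. by rewrite partial_xE; exact: bounded_support_derive. Qed.

Lemma bounded_support_partial_s f : bounded_support f -> bounded_support (partial_s f).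
Proof.
move=> /(bounded_support_derive (dir_t R))/(bounded_support_mul (cst (-1))).
by rewrite partial_sE; under [X in bounded_support X]eq_fun do rewrite /cst mulN1r.
Qed.

Lemma bounded_support_schwartz f : smooth f -> bounded_support f -> schwartz_real f.
Proof.
move=> sf [M fM]; split=> // k vs.
have [N N0 fN] := bounded_box M (smooth_continuous (smooth_iter_derive vs sf)).
exists (`|M| ^+ k * N) => p; have [pM|Mp] := leP `|p| M.
  apply: ler_pM => //; last exact: fN.
  by apply: lerXn2r; rewrite ?nnegrE//; exact: le_trans (ler_norm M).
rewrite (iter_derive_open_eq0 vs (@open_far M) fM Mp) normr0 mulr0.
by rewrite mulr_ge0// exprn_ge0.
Qed.

Lemma compact_bounded_support (V : Type) (f : plane -> V) (z : V -> bool) :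
  compact (closure [set p | z (f p)]) -> exists M : R, forall p, M < `|p| -> z (f p) = false.
Proof.
move=> /compact_bounded[M [_ cM]]; exists (M + 1) => p Mp; apply: contraTF (Mp) => fp.
rewrite -leNgt; apply: (cM (M + 1)); first by rewrite ltrDl.
exact: subset_closure.
Qed.

Lemma bounded_support_test_function (U : set plane) f (A : set plane) :
  smooth f -> bounded_support f -> closed A -> A `<=` U -> (forall p, ~ A p -> f p = 0) ->
  test_function U (fun p => (f p)%:C).
Proof.
move=> sf [M fM] cA AU f0; have supp : closure [set p | (f p)%:C != 0] `<=` A.
  rewrite [X in _ `<=` X](proj1 (closure_id A) cA); apply: closureS => p /=.
  by move=> fp; apply: contrapT => /f0 fp0; move: fp; rewrite fp0 eqxx.
split.
- by rewrite Ref_real.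
- by rewrite Imf_real; exact: smooth_cst.
- apply: (subclosed_compact (@closed_closure _ _) (@compact_box R M)).
  have cB : closed [set p : plane | `|p| <= M].
    exact: compact_closed (@norm_hausdorff R plane) (@compact_box R M).
  rewrite [X in _ `<=` X](proj1 (closure_id _) cB); apply: closureS => p /=.
  by move=> fp; rewrite leNgt; apply/negP => /fM fp0; move: fp; rewrite fp0 eqxx.
- exact: subset_trans AU.
Qed.

Lemma deriveC_real v f : deriveC v (fun p => (f p)%:C) = fun p => ('D_v f p)%:C.
Proof. by apply/funext => p; rewrite /deriveC Ref_real Imf_real derive_cst. Qed.

End bounded_supports.

(** * Identification of the fundamental solution *)

Section partial_derivatives.
Context {R : realType}.
Local Notation plane := (R * R)%type.
Local Notation Dx := (@partial_x R).
Local Notation s := (@partial_s R).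
Implicit Types (f g phi : plane -> R) (p q : plane).

Lemma partial_ssE f : smooth f ->
  s (s f) = fun p => 'D_(dir_t R) (fun q => 'D_(dir_t R) f q) p.
Proof.
move=> sf; rewrite (partial_sE (s f)) (partial_sE f).
have e := derive_oppf (dir_t R) (smooth_derive (dir_t R) sf).
by apply/funext => p; rewrite (congr1 (fun f => f p) e) opprK.
Qed.

Lemma partial_x_shift f p : smooth f -> Dx (fun q => f (p + q)) = fun q => Dx f (p + q).
Proof.
move=> sf; rewrite (partial_xE (fun q => f (p + q))) (derive_shiftf p (dir_x R) sf).
by apply/funext => q; rewrite (congr1 (fun f => f (p + q)) (partial_xE f)).
Qed.

Lemma partial_s_shift f p : smooth f -> s (fun q => f (p + q)) = fun q => s f (p + q).
Proof.
move=> sf; rewrite !partial_sE; apply/funext => q.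
by rewrite (congr1 (fun f => f q) (derive_shiftf p (dir_t R) sf)).
Qed.

Lemma partial_s_lin (c : R) f g : smooth f -> smooth g ->
  s (fun q => f q + c * g q) = fun q => s f q + c * s g q.
Proof.
move=> sf sg; rewrite !partial_sE; apply/funext => q.
rewrite (congr1 (fun f => f q) (derive_addf (dir_t R) sf (smoothZ c sg))).
by rewrite (congr1 (fun f => f q) (derive_scalef c (dir_t R) sg)) opprD mulrN.
Qed.

Let adjoint_eq (tau x y z x' y' z' : R) : x = x' -> y = y' -> z = z' ->
  x + tau * y - z = x' + tau * y' - z'.
Proof. by move=> -> -> ->. Qed.

Section locality.
Variable U : set plane.
Hypothesis oU : open U.

Lemma partial_x_local f g : {in U, f =1 g} -> {in U, Dx f =1 Dx g}.
Proof. by move=> fg; rewrite !partial_xE; exact: derive_open_eq. Qed.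

Lemma partial_s_local f g : {in U, f =1 g} -> {in U, s f =1 s g}.
Proof.
move=> fg q qU; rewrite !partial_sE.
by have -> := derive_open_eq (dir_t R) oU fg qU.
Qed.

Lemma zener_adjoint_local tau f g : {in U, f =1 g} ->
  {in U, zener_adjoint tau f =1 zener_adjoint tau g}.
Proof.
move=> e0; have e1 := partial_s_local e0; have e2 := partial_s_local e1.
have e3 := partial_s_local e2.
have ew : {in U, (fun q => f q + s f q) =1 (fun q => g q + s g q)}.
  by move=> q qU; rewrite e0// e1.
have ex := partial_x_local (partial_x_local ew).
by move=> q qU; exact: adjoint_eq (e2 q qU) (e3 q qU) (ex q qU).
Qed.

End locality.

Lemma zener_adjoint_shift tau f p : smooth f ->
  zener_adjoint tau (fun q => f (p + q)) = fun q => zener_adjoint tau f (p + q).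
Proof.
move=> s0; have s1 := smooth_partial_s s0; have s2 := smooth_partial_s s1.
have sw := smoothD s0 s1; have sx := smooth_partial_x sw.
pose F q := f (p + q).
have a1 : s F = fun q => s f (p + q) := partial_s_shift p s0.
have a2 : s (s F) = fun q => s (s f) (p + q) := etrans (congr1 s a1) (partial_s_shift p s1).
have a3 : s (s (s F)) = fun q => s (s (s f)) (p + q) := etrans (congr1 s a2) (partial_s_shift p s2).
have aw : (fun q => F q + s F q) = fun q => f (p + q) + s f (p + q) by rewrite a1.
have ax : Dx (fun q => F q + s F q) = fun q => Dx (fun z => f z + s f z) (p + q) :=
  etrans (congr1 Dx aw) (partial_x_shift p sw).
have axx : Dx (Dx (fun q => F q + s F q)) = fun q => Dx (Dx (fun z => f z + s f z)) (p + q) :=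
  etrans (congr1 Dx ax) (partial_x_shift p sx).
apply/funext => q.
exact: adjoint_eq (congr1 (@^~ q) a2) (congr1 (@^~ q) a3) (congr1 (@^~ q) axx).
Qed.

Section box_convolution.
Variables (L : R) (T : (plane -> R) -> R).
Hypothesis TL : box_functional L T.
Let conv f p := T (fun q => f (p + q)).

Let c_shift f p : smooth f -> continuous (fun q => f (p + q)).
Proof. by move=> sf; apply: smooth_continuous; exact: smooth_shift. Qed.

Let conv_lin (c : R) f g p : smooth f -> smooth g ->
  conv (fun q => f q + c * g q) p = conv f p + c * conv g p.
Proof.
move=> sf sg; have [Tlin _] := TL; rewrite addrC /conv -Tlin; [|exact: c_shift..].
by congr T; apply/funext => q; rewrite addrC.
Qed.

Let partial_x_conv f : smooth f -> Dx (conv f) = conv (Dx f).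
Proof. by move=> sf; rewrite !partial_xE (derive_box_conv TL sf). Qed.

Let partial_s_conv f : smooth f -> s (conv f) = conv (s f).
Proof.
move=> sf; rewrite !partial_sE; apply/funext => p.
rewrite (congr1 (fun f => f p) (derive_box_conv TL sf (dir_t R))).
have sD := smooth_derive (dir_t R) sf; have [Tlin _] := TL.
have c0 : continuous (cst 0 : plane -> R) by exact: cst_continuous.
rewrite -[LHS]addr0 -(box_functional0 TL) -mulN1r -(Tlin (-1) _ _ (@c_shift _ p sD) c0).
by congr T; apply/funext => q; rewrite /cst mulN1r addr0.
Qed.

Lemma box_conv_resolvent tau f p : smooth f ->
  conv f p + tau * s (conv f) p = T (fun q => f (p + q) + tau * s f (p + q)).
Proof. by move=> sf; rewrite partial_s_conv// -conv_lin//; exact: smooth_partial_s. Qed.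

Lemma zener_adjoint_conv tau f p : smooth f ->
  zener_adjoint tau (conv f) p = T (zener_adjoint tau (fun q => f (p + q))).
Proof.
move=> s0; have s1 := smooth_partial_s s0; have s2 := smooth_partial_s s1.
have s3 := smooth_partial_s s2; have sw := smoothD s0 s1; have sx := smooth_partial_x sw.
have sxx := smooth_partial_x sx.
rewrite (zener_adjoint_shift tau p s0).
have a1 := partial_s_conv s0.
have a2 : s (s (conv f)) = conv (s (s f)) := etrans (congr1 s a1) (partial_s_conv s1).
have a3 : s (s (s (conv f))) = conv (s (s (s f))) := etrans (congr1 s a2) (partial_s_conv s2).
have aw : (fun q => conv f q + s (conv f) q) = conv (fun q => f q + s f q).
  rewrite a1; apply/funext => q; have := conv_lin 1 q s0 s1; rewrite mul1r => <-.
  by congr (conv _ q); apply/funext => z; rewrite mul1r.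
have ax : Dx (fun q => conv f q + s (conv f) q) = conv (Dx (fun q => f q + s f q)) :=
  etrans (congr1 Dx aw) (partial_x_conv sw).
have axx : Dx (Dx (fun q => conv f q + s (conv f) q)) = conv (Dx (Dx (fun q => f q + s f q))) :=
  etrans (congr1 Dx ax) (partial_x_conv sx).
apply: etrans (adjoint_eq _ (congr1 (@^~ p) a2) (congr1 (@^~ p) a3) (congr1 (@^~ p) axx)) _.
have e1 := conv_lin tau p s2 s3.
have e2 := conv_lin (-1) p (smoothD s2 (smoothZ tau s3)) sxx.
rewrite mulN1r in e2; rewrite -e1 -e2.
by congr T; apply/funext => q; rewrite mulN1r.
Qed.

End box_convolution.

End partial_derivatives.

Section fundamental_solution.
Context {R : realType}.
Local Notation plane := (R * R)%type.
Local Notation Dx := (@partial_x R).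
Local Notation s := (@partial_s R).
Variables (tau : R) (chi : R -> R) (K : tempered_distribution R) (S : tempered_distribution plane).
Hypotheses (tau_gt0 : 0 < tau) (tau_lt1 : tau < 1) (chi_cutoff : cutoff chi).
Hypothesis K_invL : is_inverse_laplace chi K
                (fun z : R[i] => (1 + z) / (1 + tau%:C * z)).
Hypothesis S_fund : wave_fundamental_solution chi K S.
Implicit Types (f g phi : plane -> R) (p q : plane).
Let sigma : R := Num.sqrt tau.

Lemma smooth_cutoff_snd : smooth (fun p : plane => chi p.2).
Proof.
have [schi _ _] := chi_cutoff.
have := smooth_affine (is_diff_affine_snd 0 1) schi.
rewrite (_ : chi \o _ = fun p : plane => chi p.2)//.
by apply/funext => p /=; rewrite add0r mul1r.
Qed.

Let kernel_vertical k p : smooth k -> bounded_support k ->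
  K (fun u => (chi u * (k (p + vertical u) + tau * s k (p + vertical u)))%:C) =
  (k p + s k p)%:C.
Proof.
move=> sk [M kM]; pose A (r : R) := (p.1 + 0 * r, p.2 + 1 * r).
have AE (r : R) : A r = p + vertical r by rewrite /A mul0r mul1r [RHS]surjective_pairing.
have dA (t : R) : is_diff t A (fun y => (0 * y, 1 * y)) by exact: is_diff_affine_line.
pose g (u : R) := k (p + vertical u).
have sg : smooth g.
  by have := smooth_affine dA sk; rewrite (_ : k \o A = g)//; apply/funext => y /=; rewrite AE.
have dg (u : R) : - 'D_1 g u = s k (p + vertical u).
  have [_ ->] := is_derive_vertical p u sk.
  by rewrite (congr1 (fun f => f _) (partial_sE k)).
have g0 t : M - p.2 + 1 <= t -> g t = 0.
  move=> Mt; apply: kM; apply: (@lt_le_trans _ _ `|(p + vertical t).2|).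
    by apply: lt_le_trans (ler_norm _); rewrite /= -ltrBlDl; apply: lt_le_trans Mt; rewrite ltrDl.
  by rewrite [leRHS]prod_normE le_max lexx orbT.
have := inverse_laplace_kernelE tau_gt0 chi_cutoff K_invL sg g0.
have p0 : p + vertical 0 = p by exact: addr0.
rewrite -[X in _ = X%:C]/(g 0 + - 'D_1 g 0) dg /g p0 => <-; congr (K _); apply/funext => u.
by rewrite -dg mulrN.
Qed.

Let weak_equation (f : plane -> R[i]) : schwartz f ->
  S (deriveC (dir_t R) (deriveC (dir_t R) f)) - S (deriveC (dir_x R) (deriveC (dir_x R)
    (fun p => (chi p.2)%:C * K (fun u => (chi u)%:C * f (p.1, p.2 + u))))) = f 0.
Proof.
move=> sf; have [_ Sf] := S_fund.
have alg (x y z : R[i]) : - - x - - - y = z -> x - y = z by rewrite !opprK.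
exact: alg (Sf f sf).
Qed.

Lemma smooth_resolvent k : smooth k -> smooth (fun q => k q + tau * s k q).
Proof. by move=> sk; exact: (smoothD sk (smoothZ tau (smooth_partial_s sk))). Qed.

Lemma bounded_support_resolvent k : bounded_support k ->
  bounded_support (fun q => k q + tau * s k q).
Proof.
move=> bk; have [M kM] := bounded_support_lin tau (bounded_support_partial_s bk) bk.
by exists M => q Mq; rewrite addrC kM.
Qed.

Lemma smooth_cutoff_mul k : smooth k -> smooth (fun q => chi q.2 * (k q + s k q)).
Proof. by move=> sk; exact: (smoothM smooth_cutoff_snd (smoothD sk (smooth_partial_s sk))). Qed.

Lemma bounded_support_cutoff_mul k : bounded_support k ->
  bounded_support (fun q => chi q.2 * (k q + s k q)).
Proof.
move=> bk; have [M kM] := bounded_support_lin 1 bk (bounded_support_partial_s bk).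
by exists M => q Mq; have := kM q Mq; rewrite mul1r => ->; rewrite mulr0.
Qed.

(** Testing with k + tau s k cancels the denominator 1 + tau s of the transform: the convolution
    reduces to k + s k, and the equation becomes local. *)
Lemma fundamental_solution_real k : smooth k -> bounded_support k ->
  S (fun p => (s (s (fun q => k q + tau * s k q)) p -
               Dx (Dx (fun q => chi q.2 * (k q + s k q))) p)%:C) =
  (k 0 + tau * s k 0)%:C.
Proof.
move=> sk bk; pose f q := k q + tau * s k q; pose F q := chi q.2 * (k q + s k q).
have sf : smooth f := smooth_resolvent sk; have bf : bounded_support f := bounded_support_resolvent bk.
have sF : smooth F := smooth_cutoff_mul sk; have bF : bounded_support F := bounded_support_cutoff_mul bk.
have := weak_equation (schwartz_realC (bounded_support_schwartz sf bf)).
have -> : (fun p => (chi p.2)%:C * K (fun u => (chi u)%:C * (f (p.1, p.2 + u))%:C)) =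
    fun p => (F p)%:C.
  have mC (x y : R) : (x * y)%:C = x%:C * y%:C :> R[i] by rewrite rmorphM.
  apply/funext => p; rewrite /F mC -(kernel_vertical p sk bk); congr (_ * K _).
  apply/funext => u; rewrite mC; congr (_ * (f _)%:C).
  by rewrite [RHS]surjective_pairing /= addr0.
have d2 v g : deriveC v (deriveC v (fun p => (g p)%:C)) =
    fun p => ('D_v (fun q => 'D_v g q) p)%:C.
  exact: etrans (congr1 (deriveC v) (deriveC_real v g)) (deriveC_real v _).
have -> : deriveC (dir_t R) (deriveC (dir_t R) (fun p => (f p)%:C)) = fun p => (s (s f) p)%:C.
  rewrite (d2 (dir_t R) f); apply/funext => p.
  exact: (congr1 (fun h : plane -> R => (h p)%:C) (esym (partial_ssE sf))).
have -> : deriveC (dir_x R) (deriveC (dir_x R) (fun p => (F p)%:C)) = fun p => (Dx (Dx F) p)%:C.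
  rewrite (d2 (dir_x R) F); apply/funext => p.
  have xE : Dx (Dx F) = fun p => 'D_(dir_x R) (fun q => 'D_(dir_x R) F q) p.
    by rewrite (partial_xE (Dx F)) (partial_xE F).
  exact: (congr1 (fun h : plane -> R => (h p)%:C) (esym xE)).
move=> e; have ssf := bounded_support_schwartz (smooth_partial_s (smooth_partial_s sf))
  (bounded_support_partial_s (bounded_support_partial_s bf)).
have sxF := bounded_support_schwartz (smooth_partial_x (smooth_partial_x sF))
  (bounded_support_partial_x (bounded_support_partial_x bF)).
apply: etrans e.
have := td_real_linear S (-1) sxF ssf; rewrite rmorphN rmorph1 mulN1r addrC => <-.
by congr (S _); apply/funext => p; congr (_%:C); rewrite mulN1r addrC.
Qed.

End fundamental_solution.

Section representation.
Context {R : realType}.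
Local Notation plane := (R * R)%type.
Local Notation mu := (@lebesgue_measure R).
Local Notation Dx := (@partial_x R).
Local Notation s := (@partial_s R).
Variables (tau : R) (chi : R -> R) (K : tempered_distribution R) (S : tempered_distribution plane).
Hypotheses (tau_gt0 : 0 < tau) (tau_lt1 : tau < 1) (chi_cutoff : cutoff chi).
Hypothesis K_invL : is_inverse_laplace chi K
                (fun z : R[i] => (1 + z) / (1 + tau%:C * z)).
Hypothesis S_fund : wave_fundamental_solution chi K S.
Implicit Types (f g : plane -> R) (p q : plane).
Let sigma : R := Num.sqrt tau.
Variables (phi : plane -> R) (M a L : R).
Hypotheses (sphi : smooth phi) (M0 : 0 <= M) (phi0 : forall p, M < `|p| -> phi p = 0).
Hypotheses (a0 : 0 < a) (chi1 : forall t, - a < t -> chi t = 1) (ML : M + a < sigma * L).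

Let L0 : 0 <= L.
Proof.
rewrite leNgt; apply/negP => Lneg; have : sigma * L <= 0.
  by rewrite mulr_ge0_le0 ?sqrtr_ge0// ltW.
by move: ML M0 a0; lra.
Qed.

Let ML1 : M + a < L.
Proof.
have s1 : sigma <= 1 by rewrite -sqrtr1 ler_wsqrtr// ltW.
by apply: lt_le_trans ML _; rewrite -[leRHS]mul1r ler_wpM2r.
Qed.

(** Green's function of 1 + tau s acting backwards in time, so that [h] vanishes above the support
    of [phi]. *)
Let k (u : R) := tau^-1 * expR (- (tau^-1 * u)).

Let dk (r : R) : is_derive r (1 : R) (fun u : R => - expR (- (tau^-1 * u))) (k r).
Proof.
have := is_deriveN (is_derive_expRN tau^-1 r).
by rewrite mulNr opprK.
Qed.

Let ck : continuous k.
Proof.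
move=> u; apply: cvgM; first exact: cvg_cst.
apply: (continuous_comp (f := fun u : R => - (tau^-1 * u))); last exact: continuous_expR.
by apply: cvgN; apply: cvgM; [exact: cvg_cst|exact: cvg_id].
Qed.

Let h := vertical_conv k L phi.

Let sh : smooth h. Proof. by have [] := vertical_convE L ck sphi. Qed.

Let phi_above p : M < `|p.1| \/ M < p.2 -> phi p = 0.
Proof.
move=> Mp; apply: phi0; rewrite prod_normE lt_max.
case: Mp => [->//|Mp]; apply/orP; right; exact: lt_le_trans (ler_norm _).
Qed.

Let h0 p : M < `|p.1| \/ M < p.2 -> h p = 0.
Proof.
move=> Mp; rewrite /h vertical_conv_unlock.
transitivity (\int[mu]_(r in `[0, L]) (0 : R)); last by rewrite Rintegral_cst ?mul0r.
apply: eq_Rintegral => r; rewrite inE /= in_itv/= => /andP[r0 _].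
rewrite phi_above ?mulr0//=; case: Mp => Mp; [left|right]; first by rewrite addr0.
by apply: lt_le_trans Mp _; rewrite lerDl.
Qed.

Let h_resolvent p : M - L < p.2 -> h p + tau * s h p = phi p.
Proof.
move=> Mp; have t0 : tau != 0 by rewrite gt_eqF.
have [_ Dh] := vertical_convE L ck sphi.
have sD := smooth_derive (dir_t R) sphi.
rewrite (congr1 (fun f => f p) (partial_sE h)) (congr1 (fun f => f p) (Dh (dir_t R))) /h.
have := vertical_conv_lin L (- tau) p ck sD sphi.
set X := vertical_conv k L (fun p => 'D_(dir_t R) phi p) p.
have -> : - tau * X + vertical_conv k L phi p = vertical_conv k L phi p + tau * - X by ring.
move=> <-; rewrite vertical_conv_unlock.
pose E (u : R) := - expR (- (tau^-1 * u)).
(* The exponential turns [phi] minus tau times its time derivative into a total derivative in r. *)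
pose G (r : R) := E r * phi (p + vertical r).
pose G' (r : R) := k r * (- tau * 'D_(dir_t R) phi (p + vertical r) + phi (p + vertical r)).
have cG' : continuous G'.
  have cl := @continuous_lin R plane (- tau) _ _ (smooth_continuous sD) (smooth_continuous sphi).
  have cv := @continuous_vertical R _ p cl.
  by move=> r; apply: cvgM; [exact: ck|exact: cv].
have dG (r : R) : is_derive r (1 : R) G (G' r).
  apply: is_derive_eq (is_deriveM (dk r) (is_derive_vertical p r sphi)) _.
  rewrite /GRing.scale/= /G' /k /E.
  by move: ('D_(dir_t R) phi _) (phi _) (expR _) => x y z; field.
apply: etrans (Rintegral_FTC L0 cG' dG) _.
have -> : G L = 0.
  by rewrite /G phi_above ?mulr0//; right; rewrite /= -ltrBlDr.
rewrite /G /E mulr0 oppr0 expR0 mulN1r opprK add0r.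
by rewrite (_ : p + vertical 0 = p)//; exact: addr0.
Qed.

Let T := kernel_functional tau L.
Let TL : box_functional L T := box_functional_kernel tau_gt0 tau_lt1 L0.
Let g p := T (fun q => h (p + q)).
Let sg : smooth g. Proof. exact: smooth_box_conv TL sh. Qed.

Let T_eq f1 f2 : (forall q, upper_box L q -> f1 q = f2 q) -> T f1 = T f2.
Proof. by move=> e; apply: eq_Rintegral => q; rewrite inE => /e ->. Qed.

Let T0 f : (forall q, upper_box L q -> f q = 0) -> T f = 0.
Proof.
move=> /T_eq ->; rewrite /T /kernel_functional.
transitivity (\int[lebesgue2 R]_(q in upper_box L) (0 : R)).
  by apply: eq_Rintegral => q _; rewrite mulr0.
by rewrite Rintegral_cst ?mul0r//; exact: measurable_upper_box.
Qed.

(** The shifted [h] vanishes above l = max (0, M - t), and for t > - a the size of L meets both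
    conditions of [kernel_functional_adjoint]; this range is also where [chi] is 1. *)
Let g_adjoint p : - a < p.2 -> zener_adjoint tau g p = phi p.
Proof.
move=> ap; rewrite (zener_adjoint_conv TL tau p sh).
pose l := Num.max 0 (M - p.2).
have lL : l < L by rewrite gt_max; apply/andP; split; move: ML1 M0 a0 ap; lra.
have lsL : l < sigma * L by rewrite gt_max; apply/andP; split; move: ML M0 a0 ap; lra.
have l0 : 0 <= l by rewrite le_max lexx.
have vh : vanishes_above l (fun q => h (p + q)).
  by move=> q; rewrite gt_max => /andP[_ lq]; apply: h0; right; rewrite /= -ltrBlDl.
apply: etrans (kernel_functional_adjoint tau_gt0 tau_lt1 l0 lL lsL (smooth_shift p sh) vh) _.
rewrite (congr1 (fun f => f 0) (derive_shiftf p (dir_t R) sh)) addr0.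
have -> : h p - tau * 'D_(dir_t R) h p = h p + tau * s h p.
  by rewrite (congr1 (fun f => f p) (partial_sE h)) mulrN.
by apply: h_resolvent; move: ML1 M0 a0 ap; lra.
Qed.

Let kk p := chi p.2 * g p.
Let skk : smooth kk. Proof. exact: smoothM (smooth_cutoff_snd chi_cutoff) sg. Qed.

(** Sideways and in the future [g] itself vanishes, [h] being out of reach of the box; in the past
    [chi] does the cutting. *)
Let bkk : bounded_support kk.
Proof.
have [_ _ [b chib]] := chi_cutoff; exists (Num.max (M + L) `|b|) => p.
rewrite gt_max => /andP[MLp bp]; rewrite /kk.
have [Mp|Mp] := ltP (M + L) `|p.1|.
  rewrite /g T0 ?mulr0// => q /upper_box_norm; rewrite plane_normE => /andP[q1 _].
  apply: h0; left; rewrite /=; have := ler_normB (p.1 + q.1) q.1.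
  by rewrite addrK; move: Mp q1; lra.
have np : `|p| = `|p.2|.
  rewrite prod_normE; apply/max_idPr; rewrite leNgt; apply/negP => p21.
  by move: MLp; rewrite prod_normE (max_idPl (ltW p21)) ltNge Mp.
have [p0|p0] := leP 0 p.2; last first.
  rewrite chib ?mul0r//; move: bp; rewrite np (ltr0_norm p0).
  by have := ler_norm (- b); rewrite normrN; lra.
rewrite /g T0 ?mulr0// => q [_]; rewrite /= in_itv/= => /andP[q0 _].
apply: h0; right; rewrite /=; move: MLp; rewrite np (ger0_norm p0).
by move: L0 q0; lra.
Qed.

Lemma fundamental_solution_kernel : S (fun p => (phi p)%:C) = (T phi)%:C.
Proof.
have bphi : bounded_support phi by exists M.
pose Q p := s (s (fun q => kk q + tau * s kk q)) p - Dx (Dx (fun q => chi q.2 * (kk q + s kk q))) p.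
have SQ := fundamental_solution_real tau_gt0 chi_cutoff K_invL S_fund skk bkk.
pose U := [set p : plane | - a < p.2].
have oU : open U by exact: open_upper_half_plane.
have skk1 := smooth_partial_s skk.
have sf := smooth_resolvent tau skk; have bf := bounded_support_resolvent tau bkk.
have sF := smooth_cutoff_mul chi_cutoff skk; have bF := bounded_support_cutoff_mul chi bkk.
have sQ : smooth Q.
  by apply: smoothB; [do 2!apply: smooth_partial_s|do 2!apply: smooth_partial_x].
have bQ : bounded_support Q.
  have := bounded_support_lin (-1) (bounded_support_partial_x (bounded_support_partial_x bF))
    (bounded_support_partial_s (bounded_support_partial_s bf)).
  by move=> [N QN]; exists N => p Np; rewrite -(QN p Np) mulN1r addrC.
have eg : {in U, kk =1 g} by move=> p; rewrite inE => Up; rewrite /kk chi1// mul1r.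
have Qphi p : U p -> Q p = phi p.
  move=> Up; have pU : p \in U by rewrite inE.
  rewrite -(g_adjoint Up) -(zener_adjoint_local oU tau eg pU).
  have e1 : s (s (fun q => kk q + tau * s kk q)) p = s (s kk) p + tau * s (s (s kk)) p.
    have e := partial_s_lin tau skk skk1.
    have e' := etrans (congr1 s e) (partial_s_lin tau skk1 (smooth_partial_s skk1)).
    exact: (congr1 (@^~ p) e').
  have e2 : {in U, (fun q => chi q.2 * (kk q + s kk q)) =1 (fun q => kk q + s kk q)}.
    by move=> q; rewrite inE => Uq; rewrite chi1// mul1r.
  have e3 := partial_x_local oU (partial_x_local oU e2) pU.
  have alg (x y x' y' : R) : x = x' -> y = y' -> x - y = x' - y' by move=> -> ->.
  exact: alg e1 e3.
(* The cutoff alters [Q] only for t <= - a, where [S] vanishes. *)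
have S0 : S (fun p => (-1 * phi p + Q p)%:C) = 0.
  have [vS _] := S_fund; apply: vS.
  apply: (@bounded_support_test_function R _ _ [set p : plane | p.2 <= - a]).
  - exact: smoothD (smoothZ (-1) sphi) sQ.
  - exact: bounded_support_lin.
  - rewrite (_ : [set p : plane | _] = ~` U); first exact: open_closedC.
    by apply/seteqP; split=> p /=; rewrite leNgt => /negP.
  - by move=> p /= pa; apply: le_lt_trans pa _; rewrite oppr_lt0.
  - by move=> p /= /negP; rewrite -ltNge => /Qphi ->; rewrite mulN1r addNr.
have := td_real_linear S (-1) (bounded_support_schwartz sphi bphi) (bounded_support_schwartz sQ bQ).
rewrite S0 rmorphN rmorph1 mulN1r => /esym/eqP; rewrite addrC subr_eq0 => /eqP <-.
apply: etrans SQ _; congr (_%:C).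
have U0 : (0 : plane) \in U by rewrite inE /U /= oppr_lt0.
rewrite (partial_s_local oU eg U0) (eg _ U0).
rewrite [LHS](box_conv_resolvent TL tau 0 sh).
apply: T_eq => q [_]; rewrite /= in_itv/= => /andP[q0 _].
by rewrite add0r; apply: h_resolvent; move: ML1 M0 a0 q0; lra.
Qed.

End representation.

(** * Continuous representatives *)

Section test_bumps.
Context {R : realType}.
Local Notation plane := (R * R)%type.
Local Notation mR := (measurableTypeR R).
Variable chi : R -> R.
Hypothesis chi_cutoff : cutoff chi.
Implicit Types (p q : plane) (e : R) (phi : plane -> R).

(** The square of the derivative of [chi]: [chi] is constant far to either side, and passes from 0
    to 1, so its derivative is non-zero somewhere by the mean value theorem. *)
Let profile : exists2 rho : R -> R, smooth rho & [/\ forall t, 0 <= rho t,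
  exists N : R, forall t, N < `|t| -> rho t = 0 & exists t, 0 < rho t].
Proof.
have [schi [a a0 chi1] [b chi0]] := chi_cutoff.
have sD := smooth_derive (1 : R) schi.
exists (fun t => 'D_1 chi t * 'D_1 chi t); first exact: smoothM.
have D0 (c : R) (U : set R) t : open U -> {in U, chi =1 cst c} -> U t -> 'D_1 chi t = 0.
  move=> oU e Ut; have := derive_open_eq (1 : R) oU e; move=> ->; last by rewrite inE.
  by rewrite derive_cst.
split.
- by move=> t; rewrite -expr2 sqr_ge0.
- exists (Num.max `|b| a) => t; rewrite gt_max => /andP[bt at_].
  rewrite [X in X * _](_ : _ = 0) ?mul0r//; have [t0|t0] := leP 0 t.
    apply: (@D0 1 [set t | - a < t]); first exact: open_gt.
      by move=> u; rewrite inE => /chi1.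
    by rewrite /= (lt_le_trans _ t0)// oppr_lt0.
  apply: (@D0 0 [set t | t < b]); first exact: open_lt.
    by move=> u; rewrite inE => /chi0.
  by move: bt; rewrite /= (ltr0_norm t0); have := ler_norm (- b); rewrite normrN; lra.
- have b0 : Num.min b 0 - 1 < 0 by rewrite ltrBlDr add0r (le_lt_trans _ ltr01)// ge_min lexx orbT.
  have [t _] := @MVT R chi (fun t => 'D_1 chi t) _ 0 b0
    (fun t _ => smooth_is_derive t (1 : R) schi) (continuous_subspaceT (smooth_continuous schi)).
  rewrite chi1 ?oppr_lt0// chi0; last by rewrite ltrBlDr (le_lt_trans (_ : _ <= b)) ?ltrDl ?ge_min ?lexx.
  rewrite subr0 => e; exists t; rewrite -expr2 exprn_even_gt0//=; apply/eqP => D.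
  by move: e; rewrite D mul0r => /eqP; rewrite oner_eq0.
Qed.

Lemma bump_exists q e : 0 < e -> exists2 phi : plane -> R, smooth phi &
  [/\ forall p, 0 <= phi p, forall p, e < `|p - q| -> phi p = 0 & 0 < phi q].
Proof.
move=> e0; have [rho srho [rho0 [N rhoN] [z rhoz]]] := profile.
(* The affine map sends a coordinate of q to z, where the profile is positive; the slope D / e
   throws every coordinate further than e from q beyond N. *)
pose D := `|N| + `|z| + 1; have D0 : 0 < D by rewrite /D ltr_wpDl// addr_ge0.
pose c := D / e; have c0 : 0 < c by rewrite divr_gt0.
pose f1 (p : plane) := (z - c * q.1) + c * p.1; pose f2 (p : plane) := (z - c * q.2) + c * p.2.
exists (fun p => rho (f1 p) * rho (f2 p)).
  apply: smoothM.
    exact: (smooth_affine (is_diff_affine_fst (z - c * q.1) c) srho).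
  exact: (smooth_affine (is_diff_affine_snd (z - c * q.2) c) srho).
have far (x y : R) : e < `|x - y| -> rho (z - c * y + c * x) = 0.
  move=> exy; apply: rhoN; have -> : z - c * y + c * x = c * (x - y) - - z by ring.
  apply: lt_le_trans (lerB_dist _ _); rewrite normrN normrM (gtr0_norm c0).
  have : D < c * `|x - y| by rewrite /c mulrAC -mulrA ltr_pMr// ltr_pdivlMr// mul1r.
  by have := ler_norm N; rewrite /D; lra.
split=> [p|p|]; first exact: mulr_ge0.
  rewrite prod_normE lt_max => /orP[] /far; rewrite /f1 /f2 => -> ; first by rewrite mul0r.
  by rewrite mulr0.
by rewrite /f1 /f2 !subrK mulr_gt0.
Qed.

Definition box_at q e := [set p : plane | `|p - q| <= e].

Lemma box_atE q e : box_at q e = `[q.1 - e, q.1 + e] `*` `[q.2 - e, q.2 + e].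
Proof.
by apply/seteqP; split=> p; rewrite /box_at /= plane_normE !in_itv/= !ler_distl => /andP.
Qed.

Lemma compact_box_at q e : compact (box_at q e).
Proof. by rewrite box_atE; apply: compact_setX; exact: segment_compact. Qed.

Lemma closed_box_at q e : closed (box_at q e).
Proof. by have := compact_closed (@norm_hausdorff R plane) (@compact_box_at q e). Qed.

Lemma measurable_box_at q e : measurable (box_at q e : set (mR * mR)).
Proof. by apply: measurable_closed_plane; exact: closed_box_at. Qed.

Lemma bounded_box_at q e phi : continuous phi ->
  exists M : R, forall p, box_at q e p -> `|phi p| <= M.
Proof.
move=> cphi; have [M M0 phiM] := bounded_box (`|q| + e) cphi.
exists M => p pq; apply: phiM; rewrite -(subrK q p) addrC.
by apply: le_trans (ler_normD _ _) _; rewrite lerD2l.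
Qed.

Lemma continuous_integrable_box_at q e phi : continuous phi ->
  (lebesgue2 R).-integrable (box_at q e) (EFin \o phi).
Proof.
move=> cphi; have [M phiM] := bounded_box_at q e cphi.
apply: (@integrable_compact_plane R phi _ M) => //; first exact: compact_box_at.
by apply: measurable_funTS; exact: measurable_continuous_plane.
Qed.

Lemma Rintegral_bump_gt0 q e phi : 0 < e -> continuous phi -> (forall p, 0 <= phi p) ->
  0 < phi q -> 0 < \int[lebesgue2 R]_(p in box_at q e) phi p.
Proof.
move=> e0 cphi phi0 phiq; have h0 : 0 < phi q / 2 by rewrite divr_gt0.
have : nbhs q [set p | phi q / 2 <= phi p].
  have /cvgrPdist_le/(_ _ h0) := cphi q; apply: filterS => p.
  by rewrite ler_norml /= => /andP[_]; lra.
move=> /nbhs_ballP[r /= r0 rq].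
pose d := Num.min (r / 2) e.
have d0 : 0 < d by rewrite lt_min e0 divr_gt0.
have dr : d < r by rewrite gt_min ltr_pdivrMr// ltr_pMr// ltr1n.
have sub : box_at q d `<=` box_at q e.
  by move=> p /= pd; apply: le_trans pd _; rewrite ge_min lexx orbT.
apply: fine_gt0; apply/andP; split; last first.
  have := integrable_fin_num (measurable_box_at q e) (continuous_integrable_box_at q e cphi).
  by rewrite fin_numE => /andP[_]; rewrite ltey.
have m : measurable_fun (box_at q e) (EFin \o (phi : mR * mR -> R)).
  by apply/measurable_EFinP; apply: measurable_funTS; exact: measurable_continuous_plane.
apply: (@lt_le_trans _ _ (\int[lebesgue2 R]_(p in box_at q d) (phi p)%:E)%E); last first.
  apply: ge0_subset_integral => //; [exact: measurable_box_at|exact: measurable_box_at|].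
  by move=> p _; rewrite lee_fin.
apply: (@lt_le_trans _ _ (\int[lebesgue2 R]_(p in box_at q d) (phi q / 2)%:E)%E); last first.
  apply: ge0_le_integral => //.
  - exact: measurable_box_at.
  - by move=> p _; rewrite lee_fin ltW.
  - by apply: (measurable_funS _ sub m); exact: measurable_box_at.
  - move=> p /= pd; rewrite lee_fin; apply: rq.
    by rewrite -ball_normE /= distrC; exact: le_lt_trans dr.
rewrite integral_cst; last exact: measurable_box_at.
set vol := (X in (_ < _ * X)%E); have -> : vol = (@lebesgue_measure R `[(q.1 - d)%R, (q.1 + d)%R] *
    @lebesgue_measure R `[(q.2 - d)%R, (q.2 + d)%R])%E.
  by rewrite /vol box_atE; apply: product_measure1E; exact: measurable_itv.
rewrite !lebesgue_measure_itv/= !lte_fin.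
have lt (x : R) : x - d < x + d by lra.
rewrite !lt -!EFinB -!EFinM lte_fin; apply: mulr_gt0 => //.
by apply: mulr_gt0; lra.
Qed.

End test_bumps.

Section representatives.
Context {R : realType}.
Local Notation plane := (R * R)%type.
Local Notation mR := (measurableTypeR R).
Implicit Types (p q : plane) (phi : plane -> R).

Lemma Re_mul_real (z : R[i]) (x : R) : complex.Re (z * x%:C) = complex.Re z * x.
Proof. by case: z => u v; rewrite /= mulr0 subr0. Qed.

Lemma represented_by_subset (T : (plane -> R[i]) -> R[i]) (U V : set plane) (g : plane -> R[i]) :
  V `<=` U -> represented_by T U g -> represented_by T V g.
Proof.
move=> VU [li Tg]; split=> [A cA AV|f [s1 s2 cf fV]].
  by apply: li => //; exact: subset_trans VU.
by apply: Tg; split=> //; exact: subset_trans VU.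
Qed.

Lemma mean_gap (f phi : plane -> R) q (e c eta : R) :
  measurable_fun (box_at q e) (f : mR * mR -> R) -> continuous phi -> (forall p, 0 <= phi p) ->
  (forall p, box_at q e p -> `|f p - c| <= eta) ->
  `|\int[lebesgue2 R]_(p in box_at q e) (f p * phi p) -
    c * \int[lebesgue2 R]_(p in box_at q e) phi p| <=
  eta * \int[lebesgue2 R]_(p in box_at q e) phi p.
Proof.
move=> mf cphi phi0 fc; set A := box_at q e; have mA := measurable_box_at q e.
have iphi := continuous_integrable_box_at q e cphi.
have cc (k : R) : continuous (fun p => k * phi p).
  by move=> p; apply: cvgM; [exact: cvg_cst|exact: cphi].
have ic k := continuous_integrable_box_at q e (cc k).
have [M phiM] := bounded_box_at q e cphi.
have mphi : measurable_fun A (phi : mR * mR -> R).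
  by apply: measurable_funTS; exact: measurable_continuous_plane.
have i_f : (lebesgue2 R).-integrable A (EFin \o (fun p => f p * phi p)).
  apply: (@integrable_compact_plane R _ A ((`|c| + eta) * M)); first exact: compact_box_at.
    exact: measurable_funM.
  move=> p pA; rewrite normrM; apply: ler_pM => //; last exact: phiM.
  by rewrite -(subrK c (f p)) addrC; apply: le_trans (ler_normD _ _) _; rewrite lerD2l; exact: fc.
rewrite -RintegralZl// -RintegralB//.
have id : (lebesgue2 R).-integrable A (EFin \o (fun p => f p * phi p - c * phi p)).
  have := integrableB mA i_f (ic c).
  by congr (_.-integrable); apply/funext => p /=; rewrite EFinB.
apply: le_trans (le_normr_Rintegral mA id) _; rewrite -RintegralZl//.
apply: le_Rintegral => //.
  have := id => /integrable_norm.
  by congr (_.-integrable); apply/funext => p.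
move=> p pA; rewrite -mulrBl normrM (ger0_norm (phi0 p)).
by apply: ler_wpM2r => //; exact: fc.
Qed.

Lemma pairing_real (g : plane -> R[i]) phi q (e : R) : (forall p, e < `|p - q| -> phi p = 0) ->
  complex.Re (pairing g (fun p => (phi p)%:C)) =
  \int[lebesgue2 R]_(p in box_at q e) (Ref g p * phi p).
Proof.
move=> phi0; rewrite Rintegral_mkcond /pairing /=; apply: eq_Rintegral => p _.
rewrite Re_mul_real patchE; case: ifPn => // /negP; rewrite inE /box_at /= => /negP.
by rewrite -ltNge => /phi0 ->; rewrite mulr0.
Qed.

(** Both representatives have the same average against a bump, and each average is within eta of its
    constant; hence the factor 2. *)
Lemma representatives_close (chi : R -> R) (T : (plane -> R[i]) -> R[i]) (U : set plane)
    (g1 g2 : plane -> R[i]) q (e c1 c2 eta : R) : cutoff chi -> 0 < e ->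
  represented_by T U g1 -> represented_by T U g2 -> box_at q e `<=` U ->
  (forall p, box_at q e p -> `|Ref g1 p - c1| <= eta) ->
  (forall p, box_at q e p -> `|Ref g2 p - c2| <= eta) -> `|c1 - c2| <= 2 * eta.
Proof.
move=> cchi e0 [l1 T1] [l2 T2] AU g1c g2c.
have [phi sphi [phi0 phie phiq]] := bump_exists cchi q e0.
have cphi := smooth_continuous sphi.
have tphi : test_function U (fun p => (phi p)%:C).
  apply: (bounded_support_test_function sphi _ (@closed_box_at R q e) AU); last first.
    by move=> p /negP; rewrite -ltNge; exact: phie.
  exists (`|q| + e) => p pe; apply: phie; rewrite -ltrBrDl in pe.
  by apply: lt_le_trans pe _; exact: lerB_dist.
have I0 := Rintegral_bump_gt0 e0 cphi phi0 phiq.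
have m (g : plane -> R[i]) : locally_integrable2 U g ->
    measurable_fun (box_at q e) (Ref g : mR * mR -> R).
  move=> /(_ _ (@compact_box_at R q e) AU)[/measurable_int mg _].
  by apply/measurable_EFinP.
have := mean_gap (m _ l1) cphi phi0 g1c; have := mean_gap (m _ l2) cphi phi0 g2c.
rewrite -(pairing_real g1 phie) -(pairing_real g2 phie) -(T1 _ tphi) -(T2 _ tphi).
move: I0; set I := \int[_]_(p in _) _; move: (complex.Re _) => X; move: I => I I0.
rewrite !ler_norml => /andP[a1 a2] /andP[b1 b2]; apply/andP; split.
  by rewrite -(ler_pM2r I0) mulrBl; lra.
by rewrite -(ler_pM2r I0) mulrBl; lra.
Qed.

End representatives.

(** * Representation of the fundamental solution and its jump at the front *)

Section zener_solution.
Context {R : realType}.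
Local Notation plane := (R * R)%type.
Local Notation mR := (measurableTypeR R).
Variables (tau : R) (chi : R -> R) (K : tempered_distribution R) (S : tempered_distribution plane).
Hypotheses (tau_gt0 : 0 < tau) (tau_lt1 : tau < 1) (chi_cutoff : cutoff chi).
Hypothesis K_invL : is_inverse_laplace chi K
                (fun z : R[i] => (1 + z) / (1 + tau%:C * z)).
Hypothesis S_fund : wave_fundamental_solution chi K S.
Implicit Types (p q : plane) (phi : plane -> R).
Let sigma : R := Num.sqrt tau.
Let sigma_gt0 : 0 < sigma. Proof. by rewrite sqrtr_gt0. Qed.
Let sigma_le1 : sigma <= 1. Proof. by rewrite -sqrtr1 ler_wsqrtr// ltW. Qed.

Let kernel_pairing phi : smooth phi -> bounded_support phi ->
  S (fun p => (phi p)%:C) = (\int[lebesgue2 R]_p (zener_kernel tau p * phi p))%:C.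
Proof.
move=> sphi [M' phi0']; have [_ [a a0 chi1] _] := chi_cutoff.
pose M := Num.max M' 0; have M0 : 0 <= M by rewrite le_max lexx orbT.
have phi0 p : M < `|p| -> phi p = 0 by rewrite gt_max => /andP[+ _]; exact: phi0'.
pose L := (M + a + 1) / sigma.
have ML : M + a < sigma * L by rewrite /L mulrC divfK ?gt_eqF// ltrDl.
have LM : M <= L.
  by rewrite /L ler_pdivlMr//; apply: le_trans (ler_piMr M0 sigma_le1) _; move: a0; lra.
rewrite (fundamental_solution_kernel tau_gt0 tau_lt1 chi_cutoff K_invL S_fund sphi M0 phi0 a0 chi1 ML).
congr (_%:C); rewrite /kernel_functional Rintegral_mkcond; apply: eq_Rintegral => p _.
rewrite patchE; case: ifPn => //; rewrite notin_setE => pL.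
have [pM|/phi0 ->] := leP `|p| M; last by rewrite mulr0.
rewrite zener_kernel_out ?mul0r//; have [p0|p0] := ltP p.2 0.
  by rewrite subr_lt0; apply: lt_le_trans p0 _; apply: mulr_ge0 => //; exact: ltW.
exfalso; apply: pL; move: (le_trans pM LM); rewrite plane_normE => /andP[p1 p2].
by split; rewrite /= in_itv/= ?p0 -?ler_norml//; exact: le_trans (ler_norm _) p2.
Qed.

Lemma represented_by_zener_kernel : represented_by S setT (fun p => (zener_kernel tau p)%:C).
Proof.
split=> [A cA _|f [sr si cf _]].
  have [M [_ AM]] := compact_bounded cA.
  have L0 : 0 <= `|M| + 1 by exact: addr_ge0.
  have [B kB] := zener_kernel_bound tau_gt0 tau_lt1 L0.
  split; rewrite ?Ref_real ?Imf_real.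
    apply: (@integrable_compact_plane R _ A B) => //.
      by apply: measurable_funTS; exact: measurable_zener_kernel.
    move=> p Ap; apply: kB; apply: AM => //.
    by apply: le_lt_trans (ler_norm _) _; rewrite ltrDl.
  apply: (@integrable_compact_plane R _ A 0) => //.
  by move=> p _; rewrite /cst normr0.
have [M fM] := @compact_bounded_support R _ f (fun z => z != 0) cf.
have br : bounded_support (Ref f).
  by exists M => p /fM /negbFE/eqP; rewrite /Ref => ->.
have bi : bounded_support (Imf f).
  by exists M => p /fM /negbFE/eqP; rewrite /Imf => ->.
have er := kernel_pairing sr br; have ei := kernel_pairing si bi.
have -> : f = fun p => (0 +i* 1) * (Imf f p)%:C + (Ref f p)%:C.
  apply/funext => p; rewrite /Ref /Imf; case: (f p) => x y; apply/eqP.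
  by rewrite eq_complex /=; apply/andP; split; apply/eqP; ring.
rewrite td_linear; [|exact: schwartz_realC (bounded_support_schwartz _ _)..].
rewrite er ei /pairing; apply/eqP; rewrite eq_complex /=; apply/andP; split; apply/eqP.
  rewrite mul0r mul1r sub0r oppr0 add0r; apply: eq_Rintegral => p _.
  by rewrite /Ref /Imf; case: (f p) => x y /=; ring.
rewrite mul0r add0r mul1r addr0; apply: eq_Rintegral => p _.
by rewrite /Ref /Imf; case: (f p) => x y /=; ring.
Qed.

Lemma forward_coneE : forward_cone tau = [set p | 0 <= p.2 - sigma * `|p.1|].
Proof. by apply/seteqP; split=> p; rewrite /forward_cone /= ler_pdivlMr// mulrC subr_ge0. Qed.

Lemma closed_forward_cone : closed (forward_cone tau).
Proof.
rewrite forward_coneE; have cl := proj1 (continuous_closedP _) (@continuous_front R tau).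
by have := cl _ (@closed_ge R 0).
Qed.

(** The cone is closed, so a boundary point lies in it, and a strict inequality there would make the
    point interior. *)
Lemma forward_cone_boundary p : (closure (forward_cone tau) `\` interior (forward_cone tau)) p ->
  p.2 - sigma * `|p.1| = 0.
Proof.
rewrite -(proj1 (closure_id _) closed_forward_cone) => -[pC pI].
apply/eqP; rewrite eq_le; apply/andP; split; last by move: pC; rewrite forward_coneE.
rewrite leNgt; apply/negP => p0; apply: pI; rewrite forward_coneE.
have : nbhs p [set q : plane | 0 < q.2 - sigma * `|q.1|].
  have oP := proj1 (continuousP _) (@continuous_front R tau).
  have oU := oP _ (@open_gt R 0).
  by have := open_nbhs_nbhs (conj oU (p0 : (_ @^-1` [set y | 0 < y]) p)).
by apply: filterS => q /= /ltW.
Qed.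

(** A continuous function on the whole plane that agrees with the kernel in the cone; its value on
    the front is the height of the jump. *)
Let amplitude p : R := sigma / 2 * expR (- (sigma / 2 * (tau^-1 - 1) * `|p.1|)) + zener_remainder tau p.

Let zener_kernel_in p : 0 <= p.2 - sigma * `|p.1| -> zener_kernel tau p = amplitude p.
Proof. by move=> p0; rewrite /zener_kernel /zener_leading_term /heaviside p0 mulr1. Qed.

Let continuous_amplitude : continuous amplitude.
Proof.
move=> p; apply: cvgD; last exact: continuous_zener_remainder.
apply: cvgM; first exact: cvg_cst.
apply: continuous_comp; last exact: continuous_expR.
apply: cvgN; apply: cvgM; first exact: cvg_cst.
by apply: cvg_norm; exact: cvg_fst.
Qed.

(* On the boundary the continuous part vanishes, so the kernel jumps from 0 to
   the leading amplitude; small boxes on either side of the boundary detect the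
   two values. *)
Lemma zener_discontinuous_at p :
  (closure (forward_cone tau) `\` interior (forward_cone tau)) p -> discontinuous_at S p.
Proof.
move=> /forward_cone_boundary dp U g oU Up gU [cg _].
pose A := amplitude p; have A0 : 0 < A.
  by rewrite /A /amplitude zener_remainder_eq0 ?dp// addr0 mulr_gt0 ?expR_gt0// divr_gt0.
have A8 : 0 < A / 8 by rewrite divr_gt0.
have n1 : nbhs p [set q | `|Ref g p - Ref g q| <= A / 8] by have /cvgrPdist_le := cg; exact.
have n2 : nbhs p [set q | `|A - amplitude q| <= A / 8].
  by have /cvgrPdist_le := @continuous_amplitude p; exact.
have n3 : nbhs p U by exact: open_nbhs_nbhs.
have : nbhs p (U `&` ([set q | `|Ref g p - Ref g q| <= A / 8] `&`
    [set q | `|A - amplitude q| <= A / 8])).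
  by apply: filterI => //; exact: filterI.
move=> /nbhs_ballP[r /= r0 rP].
have kU := represented_by_subset (@subsetT _ U) represented_by_zener_kernel.
have r8 : 0 < r / 8 by rewrite divr_gt0.
(* In a box of half-width r/8 around the point at height b above p, t - sigma |x| stays within r/4
   of b because sigma <= 1; for b = r/2 and b = - r/2 its sign is therefore known. *)
have inball (b : R) q : `|b| <= r / 2 -> box_at (p.1, p.2 + b) (r / 8) q ->
    [/\ U q, `|Ref g q - Ref g p| <= A / 8, `|amplitude q - A| <= A / 8 &
     b - r / 4 <= q.2 - sigma * `|q.1| <= b + r / 4].
  move=> br; rewrite /box_at /= plane_normE /= => /andP[q1 q2].
  have qp : ball p r q.
    rewrite -ball_normE /= prod_normE gt_max /=.
    move: br q1 q2; rewrite !ler_norml !ltr_norml.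
    by move=> /andP[? ?] /andP[? ?] /andP[? ?]; apply/andP; split; apply/andP; split; move: r0; lra.
  have [Uq [gq aq]] := rP _ qp.
  split=> //; [by rewrite distrC|by rewrite distrC|].
  have d1 : `|sigma * `|q.1| - sigma * `|p.1| | <= r / 8.
    rewrite -mulrBr normrM (gtr0_norm sigma_gt0) -[leRHS]mul1r; apply: ler_pM => //.
      exact: ltW.
    exact: le_trans (ler_dist_dist _ _) q1.
  move: d1 q2 dp; rewrite !ler_norml -/sigma; move: (sigma * `|p.1|) (sigma * `|q.1|) => y y'.
  by move=> /andP[? ?] /andP[? ?] ?; apply/andP; split; lra.
have close c b : (forall q, box_at (p.1, p.2 + b) (r / 8) q -> `|zener_kernel tau q - c| <= A / 8) ->
    `|b| <= r / 2 -> `|Ref g p - c| <= 2 * (A / 8).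
  move=> kc br; apply: (representatives_close chi_cutoff r8 gU kU (q := (p.1, p.2 + b))) => //.
  - by move=> q /(inball _ _ br)[].
  - by move=> q /(inball _ _ br)[].
have above : `|Ref g p - A| <= 2 * (A / 8).
  have b2 : `|r / 2| <= r / 2 by rewrite ger0_norm// divr_ge0// ltW.
  apply: (close _ (r / 2)) => // q /(inball _ _ b2)[_ _ aq /andP[dq _]].
  by rewrite zener_kernel_in//; apply: le_trans dq; move: r0; lra.
have below : `|Ref g p - 0| <= 2 * (A / 8).
  have b2 : `|- (r / 2)| <= r / 2 by rewrite normrN ger0_norm// divr_ge0// ltW.
  apply: (close _ (- (r / 2))) => // q /(inball _ _ b2)[_ _ _ /andP[_ dq]].
  rewrite zener_kernel_out ?subrr ?normr0 ?ltW//.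
  by apply: le_lt_trans dq _; move: r0; lra.
(* The value of the representative at p would be within A/4 of both A and 0, against A > 0. *)
move: above below; rewrite !ler_norml => /andP[? ?] /andP[? ?]; lra.
Qed.

Lemma zener_remainder_support : closure [set p | zener_remainder tau p != 0] `<=` forward_cone tau.
Proof.
rewrite [X in _ `<=` X](proj1 (closure_id _) closed_forward_cone); apply: closureS => p /=.
rewrite forward_coneE /= => Ep; rewrite leNgt; apply/negP => /ltW p0.
by move: Ep; rewrite zener_remainder_eq0 ?eqxx.
Qed.

End zener_solution.

Theorem theorem5p1 (R : realType) (tau : R) (tau_gt0 : 0 < tau)
    (tau_lt1 : tau < 1)
    (chi : R -> R) (chi_cutoff : cutoff chi)
    (K : tempered_distribution R)
    (K_invL : is_inverse_laplace chi K
                (fun s : R[i] => (1 + s) / (1 + tau%:C * s)))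
    (S : tempered_distribution (R * R)%type)
    (S_fund : wave_fundamental_solution chi K S) :
  (forall p : (R * R)%type,
     (closure (forward_cone tau) `\` interior (forward_cone tau)) p ->
     discontinuous_at S p) /\
  exists E : R * R -> R,
    [/\ continuous E,
        closure [set p | E p != 0] `<=` forward_cone tau &
        represented_by S setT
          (fun p => (zener_leading_term tau p + E p)%:C)].
Proof.
split=> [p|]; first exact: (zener_discontinuous_at tau_gt0 tau_lt1 chi_cutoff K_invL S_fund).
exists (zener_remainder tau); split.
- exact: continuous_zener_remainder.
- exact: zener_remainder_support.
- exact: (represented_by_zener_kernel tau_gt0 tau_lt1 chi_cutoff K_invL S_fund).
Qed.
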